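(* (I) Let $Z:\mathcal{P}(\mathbb{Z}^2)\to \mathbb{Q}[[x,y]]$ be a $\mathcal{G}(\mathbb{Z}^2)$ equivariant valuation. Then $Z(\{o\})$ is a constant power series $c\in\mathbb{Q}$, and $$f_1(x,y):=Z([o,e_1])(x,y)=g(x^2)\cdot \exp\left(\tfrac12 x\right)$$ for some $g\in\mathbb{Q}[[x]]$; moreover, $$Z(T)(x,y)=f_2(x,y)+\tfrac12 f_1(x,y)+\tfrac12 f_1(y,-x)+\tfrac{e^x}{2} f_1(-x+y,-x), \qquad (1)$$ where $f_2\in\mathbb{Q}[[x,y]]$ is given by $$f_2(x,y)=\frac{e^x}{y}\cdot \frac{e^{y-x}-1}{y-x}\cdot \varrho(y-x,x)-\frac{1}{y}\cdot \frac{e^{x}-1}{x}\cdot \varrho(x,y-x) \qquad (2)$$ for some $\varrho\in\mathbb{Q}[[x,y]]^{D_4}$ satisfying $$(2x+y)\,\varrho(x,y)=(x+y)\,\varrho(x,x+y)+x\,\varrho(x+y,x). \qquad (3)$$ In particular, $Z=Z_1+Z_2$ where $Z_1,Z_2:\mathcal{P}(\mathbb{Z}^2)\to \mathbb{Q}[[x,y]]$ are $\mathcal{G}(\mathbb{Z}^2)$ equivariant valuations such that $Z_1(\{o\})=c$, $Z_1([o,e_1])=f_1$ and $Z_1(T)(x,y)=\tfrac12 f_1(x,y)+\tfrac12 f_1(y,-x)+\tfrac{e^x}{2} f_1(-x+y,-x)$, and $Z_2$ is simple with $Z_2(T)=f_2$. (II) Conversely, if $c\in\mathbb{Q}$, $f_1(x,y)=g(x^2)\cdot\exp\left(\tfrac12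 x\right)$ for some $g\in\mathbb{Q}[[x]]$, and $f_2$ is defined by (2) for some $\varrho\in\mathbb{Q}[[x,y]]^{D_4}$ satisfying (3), then there exists a $\mathcal{G}(\mathbb{Z}^2)$ equivariant valuation $Z:\mathcal{P}(\mathbb{Z}^2)\to\mathbb{Q}[[x,y]]$ such that $Z(\{o\})= c$, $Z([o,e_1])=f_1$, and $Z(T)$ is given by (1).
   Context: $\mathcal{P}(\mathbb{Z}^2)$ is the family of convex hulls of finitely many (at least one) points of $\mathbb{Z}^2$ (points and segments included). A map $Z:\mathcal{P}(\mathbb{Z}^2)\to\mathbb{Q}[[x,y]]$ is a valuation if $Z(P\cup Q)+Z(P\cap Q)=Z(P)+Z(Q)$ for all $P,Q\in\mathcal{P}(\mathbb{Z}^2)$ such that $P\cup Q$ is convex (then $P\cup Q,P\cap Q\in\mathcal{P}(\mathbb{Z}^2)$). $Z$ is simple if $Z(P)=0$ whenever $\dim P\le 1$. $\mathcal{G}(\mathbb{Z}^2)=\mathbb{Z}^2\rtimes \mathrm{GL}(2,\mathbb{Z})$ is the affine unimodular group, acting naturally on $\mathcal{P}(\mathbb{Z}^2)$. For $\Xi(x,y)=(ax+by+\alpha,\,cx+dy+\beta)$ with $a,b,c,d,\alpha,\beta\in\mathbb{Z}$, $ad-bc=\pm1$, and $f\in\mathbb{Q}[[x,y]]$, put $(\Xi\cdot f)(x,y)=\exp(\alpha x+\beta y)\cdot f(ax+cy,bx+dy)$, where $\exp(t)=e^t=\sum_{n\ge0}t^n/n!$ is a formal power series. $Z$ is $\mathcal{G}(\mathbb{Z}^2)$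 equivariant if $Z(\Xi P)=\Xi\cdot Z(P)$ for all $P\in\mathcal{P}(\mathbb{Z}^2)$, $\Xi\in\mathcal{G}(\mathbb{Z}^2)$. $o=(0,0)$, $e_1=(1,0)$, $e_2=(0,1)$; $[x_1,\dots,x_k]$ denotes the convex hull; $T=[e_1,e_2,o]$. The expression $\frac{e^t-1}{t}$ denotes the power series $\sum_{n\ge0}\frac{t^n}{(n+1)!}$. $D_4$ is the subgroup of $\mathrm{GL}(2,\mathbb{Z})$ generated by $\begin{pmatrix}1&0\\1&-1\end{pmatrix}$ and $\begin{pmatrix}1&-2\\0&-1\end{pmatrix}$, acting on $\mathbb{Q}[[x,y]]$ via the action above (with $\alpha=\beta=0$), and $\mathbb{Q}[[x,y]]^{D_4}$ is the subalgebra of $D_4$ invariant elements; i.e. $\varrho\in\mathbb{Q}[[x,y]]^{D_4}$ if and only if $\varrho(x,y)=\varrho(x+y,-y)$ and $\varrho(x,y)=\varrho(x,-2x-y)$. For $\varrho\in\mathbb{Q}[[x,y]]^{D_4}$ satisfying (3), the right hand side of (2) is a formal power series. *)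

(* Defs.v *)
From HB Require Import structures.
From mathcomp Require Import all_boot all_order all_algebra.
From mathcomp Require Import boolp classical_sets reals convex.

Set Implicit Arguments.
Unset Strict Implicit.
Unset Printing Implicit Defensive.

Import Order.TTheory GRing.Theory Num.Theory.

Local Open Scope classical_set_scope.
Local Open Scope ring_scope.

(* Formal power series are wrapped in a record because [nat -> R] already
   carries the pointwise ring structure. *)
Record fps (R : Type) := Fps { coefs : nat -> R }.

Lemma fpsP (R : Type) (f g : fps R) : coefs f =1 coefs g <-> f = g.
Proof.
split=> [|->] //; case: f g => f [g] /= fg.
by congr Fps; apply/funext.
Qed.

HB.instance Definition _ (R : Type) := gen_eqMixin (fps R).
HB.instance Definition _ (R : Type) := gen_choiceMixin (fps R).

Section FpsZmodule.
Variable R : zmodType.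
Implicit Types f g h : fps R.

Definition fps_zero : fps R := Fps (fun=> 0).
Definition fps_opp f : fps R := Fps (fun n => - coefs f n).
Definition fps_add f g : fps R := Fps (fun n => coefs f n + coefs g n).

Fact fps_addA : associative fps_add.
Proof. by move=> f g h; apply/fpsP => n /=; rewrite addrA. Qed.
Fact fps_addC : commutative fps_add.
Proof. by move=> f g; apply/fpsP => n /=; rewrite addrC. Qed.
Fact fps_add0 : left_id fps_zero fps_add.
Proof. by move=> f; apply/fpsP => n /=; rewrite add0r. Qed.
Fact fps_addN : left_inverse fps_zero fps_opp fps_add.
Proof. by move=> f; apply/fpsP => n /=; rewrite addNr. Qed.

HB.instance Definition _ := GRing.isZmodule.Build (fps R)
  fps_addA fps_addC fps_add0 fps_addN.

End FpsZmodule.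

Section FpsRing.
Variable R : comNzRingType.
Implicit Types f g h : fps R.

Definition fpsC (c : R) : fps R := Fps (fun n => if n == 0 then c else 0).
Definition fpsX : fps R := Fps (fun n => (n == 1)%:R).

Definition fps_mul f g : fps R :=
  Fps (fun n => \sum_(j < n.+1) coefs f j * coefs g (n - j)%N).

Lemma coefs_mul_rev f g n :
  coefs (fps_mul f g) n = \sum_(j < n.+1) coefs f (n - j)%N * coefs g j.
Proof.
rewrite /= (reindex_inj rev_ord_inj) /=.
by apply: eq_bigr => j _; rewrite (sub_ordK j).
Qed.

Fact fps_mulA : associative fps_mul.
Proof.
move=> p q r; apply/fpsP=> i; rewrite [RHS]coefs_mul_rev [LHS]/=.
pose coef3 j k := coefs p j * (coefs q (i - j - k)%N * coefs r k).
transitivity (\sum_(j < i.+1) \sum_(k < i.+1 | (k <= i - j)%N) coef3 j k).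
  apply: eq_bigr => /= j _.
  rewrite -[\sum_(_ < _) _]/(coefs (fps_mul q r) _) coefs_mul_rev big_distrr /=.
  by rewrite (big_ord_narrow_leq (leq_subr _ _)).
rewrite (exchange_big_dep predT) //=; apply: eq_bigr => k _.
transitivity (\sum_(j < i.+1 | (j <= i - k)%N) coef3 j k).
  apply: eq_bigl => j; rewrite -ltnS -(ltnS j) -!subSn ?leq_ord //.
  by rewrite -subn_gt0 -(subn_gt0 j) -!subnDA addnC.
rewrite (big_ord_narrow_leq (leq_subr _ _)) big_distrl /=.
by apply: eq_bigr => j _; rewrite /coef3 -!subnDA addnC mulrA.
Qed.

Fact fps_mulC : commutative fps_mul.
Proof.
move=> f g; apply/fpsP => n; rewrite coefs_mul_rev /=.
by apply: eq_bigr => j _; rewrite mulrC.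
Qed.

Fact fps_mul1 : left_id (fpsC 1) fps_mul.
Proof.
move=> f; apply/fpsP => n /=; rewrite big_ord_recl /= subn0 mul1r.
by rewrite big1 ?addr0 // => j _; rewrite mul0r.
Qed.

Fact fps_mulDl : left_distributive fps_mul +%R.
Proof.
move=> f g h; apply/fpsP => n /=; rewrite -big_split /=.
by apply: eq_bigr => j _; rewrite mulrDl.
Qed.

Fact fps_1neq0 : fpsC 1 != 0.
Proof.
by apply/eqP => /fpsP/(_ 0%N) /= /eqP; rewrite (negbTE (oner_neq0 R)).
Qed.

HB.instance Definition _ := GRing.Zmodule_isComNzRing.Build (fps R)
  fps_mulA fps_mulC fps_mul1 fps_mulDl fps_1neq0.

End FpsRing.

(* Q[[x,y]], as power series in x whose coefficients are power series in y. *)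
Notation Qxy := (fps (fps rat)).

Definition coefxy (f : Qxy) (i j : nat) : rat := coefs (coefs f i) j.
Definition cst (c : rat) : Qxy := fpsC (fpsC c).
Definition vx : Qxy := fpsX (fps rat).
Definition vy : Qxy := fpsC (fpsX rat).

(* g(p) and f(p, q). These are only used when p and q have zero constant term:
   then p^k, resp. p^i q^j, has no term of total degree less than k, resp.
   i + j, so the sums may be truncated at the total degree m + n. *)
Definition subst1 (g : fps rat) (p : Qxy) : Qxy :=
  Fps (fun m => Fps (fun n =>
    \sum_(k < (m + n).+1) coefs g k * coefxy (p ^+ k) m n)).
Definition subst2 (f p q : Qxy) : Qxy :=
  Fps (fun m => Fps (fun n =>
    \sum_(i < (m + n).+1) \sum_(j < (m + n).+1)
      coefxy f i j * coefxy (p ^+ i * q ^+ j) m n)).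

Definition fexp (p : Qxy) : Qxy := subst1 (Fps (fun n => n`!%:R^-1)) p.

(* (e^p - 1) / p *)
Definition fexp1 (p : Qxy) : Qxy := subst1 (Fps (fun n => n.+1`!%:R^-1)) p.

Definition mx2 (a b c d : int) : 'M[int]_2 :=
  \matrix_(i, j) (if i == 0 then if j == 0 then a else b
                  else if j == 0 then c else d).

(* Elements of the affine unimodular group are pairs of M in GL(2, Z), i.e.
   [M \in unitmx], and t in Z^2, acting on points by v |-> M v + t; points are
   column vectors. The linear forms substituted below are the entries of
   (x, y) M. *)
Definition affine_act (M : 'M[int]_2) (t : 'cV[int]_2) (f : Qxy) : Qxy :=
  fexp (vx *~ t 0 0 + vy *~ t 1 0) *
  subst2 f (vx *~ M 0 0 + vy *~ M 1 0) (vx *~ M 0 1 + vy *~ M 1 1).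

Inductive generated (S : set 'M[int]_2) : set 'M[int]_2 :=
| gen_in M of S M : generated S M
| gen_1 : generated S 1%:M
| gen_mul M N of generated S M & generated S N : generated S (M *m N)
| gen_inv M of generated S M : generated S (invmx M).

Definition D4 : set 'M[int]_2 :=
  generated [set mx2 1 0 1 (-1); mx2 1 (-2) 0 (-1)].

Definition D4_invariant (rho : Qxy) : Prop :=
  forall M, D4 M -> affine_act M 0 rho = rho.

Section Polygons.
Variable R : realType.
Implicit Types (P Q : set 'cV[R]_2) (s : seq 'cV[int]_2).

Definition to_plane (v : 'cV[int]_2) : 'cV[R]_2 := map_mx intr v.

Definition hull s : set 'cV[R]_2 :=
  smallest (@convex_set R 'cV[R]_2) (to_plane @` [set` s]).

Definition lattice_polygon P : Prop := exists2 s, s != [::] & P = hull s.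

Definition affine_map (M : 'M[int]_2) (t : 'cV[int]_2) (p : 'cV[R]_2) :
  'cV[R]_2 := map_mx intr M *m p + to_plane t.

Definition has_affinely_independent (k : nat) P : Prop :=
  exists (p : 'cV[R]_2) (X : k.-tuple 'cV[R]_2),
    [/\ P p, free X & forall v, v \in X -> P (p + v)].

(* The dimension of the affine hull: the largest k such that P contains k + 1
   affinely independent points. *)
Definition dim P : nat := \max_(k < 3 | `[< has_affinely_independent k P >]) k.

(* A map on the lattice polygons is represented by a map on all subsets of the
   plane, whose values outside the lattice polygons are irrelevant. *)
Implicit Type Z : set 'cV[R]_2 -> Qxy.

Definition valuation Z : Prop :=
  forall P Q, lattice_polygon P -> lattice_polygon Q ->
    @convex_set R 'cV[R]_2 (P `|` Q) ->
    Z (P `|` Q) + Z (P `&` Q) = Z P + Z Q.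

Definition equivariant Z : Prop :=
  forall P (M : 'M[int]_2) (t : 'cV[int]_2),
    lattice_polygon P -> M \in unitmx ->
    Z (affine_map M t @` P) = affine_act M t (Z P).

Definition simple Z : Prop :=
  forall P, lattice_polygon P -> (dim P <= 1)%N -> Z P = 0.

End Polygons.

Definition o : 'cV[int]_2 := 0.
Definition e1 : 'cV[int]_2 := delta_mx 0 0.
Definition e2 : 'cV[int]_2 := delta_mx 1 0.
Definition T (R : realType) : set 'cV[R]_2 := hull [:: e1; e2; o].
Arguments T : clear implicits.

(* g(x^2) exp(x/2) *)
Definition f1_of (g : fps rat) : Qxy :=
  subst1 g (vx ^+ 2) * fexp (cst 2^-1 * vx).

(* f1(x,y)/2 + f1(y,-x)/2 + (e^x/2) f1(-x+y,-x) *)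
Definition boundary_part (f1 : Qxy) : Qxy :=
  cst 2^-1 * f1 + cst 2^-1 * subst2 f1 vy (- vx)
  + cst 2^-1 * fexp vx * subst2 f1 (- vx + vy) (- vx).

Definition rho_equation (rho : Qxy) : Prop :=
  (vx *+ 2 + vy) * rho =
  (vx + vy) * subst2 rho vx (vx + vy) + vx * subst2 rho (vx + vy) vx.

(* f2 = (e^x / y) ((e^(y-x) - 1) / (y-x)) rho(y-x, x)
        - (1 / y) ((e^x - 1) / x) rho(x, y-x),
   with the denominator y cleared; f2 is unique since y is not a zero divisor
   in Q[[x,y]]. *)
Definition is_f2 (rho f2 : Qxy) : Prop :=
  vy * f2 = fexp vx * fexp1 (vy - vx) * subst2 rho (vy - vx) vx
            - fexp1 vx * subst2 rho vx (vy - vx).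

(* Main.v *)
(* For linear forms a, b put sigma(a,b) = rho(a, b - a) and
   tau(a,b) = sigma(a,b) / (a b). D4 invariance of rho makes tau symmetric and
   odd in each variable, and (3) reads tau(a,b) = tau(a,a+b) + tau(a+b,b): tau
   is additive when a unimodular cone is cut into unimodular cones. By Euclid's
   algorithm there is an even function h on lattice directions, with values in
   the fraction field of Q[[x,y]], such that h(w) - h(u) = det(u,w) tau(u,w) if
   det(u,w) = 1 or -1, and (2) says that f2 is the sum of (e^q - e^p) h(q - p)
   over the edges (p,q) of T.
   Such a sum over the edges of any lattice triangle is a power series, because
   the triangle can be cut into unimodular ones. Summing the series of the
   triangles (o,a,b) over the primitive boundary segments (a,b) of P gives the
   simple valuation: the valuation property holds segment by segment, and the
   sum does not depend on o since every lattice point is the start of as many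
   boundary segments as it is the end.
   The other part is the sum over these segments of half the value f1 dictates,
   corrected by c times the lattice point enumerator, whose own simple part
   vanishes. Subtracting it from Z leaves a simple valuation; if s is the value
   of that one at the unit square, then
   tau(x,y) = s(x,y) / ((e^x - 1) (e^y - 1)), as in the sum of s over the
   translates of the square that tile the cone spanned by e1 and e2. *)

From HB Require Import structures.
Require Import Defs.
From mathcomp Require Import all_boot all_order all_algebra.
From mathcomp Require Import boolp classical_sets reals convex.
From mathcomp Require Import ring lra zify.

Set Implicit Arguments.
Unset Strict Implicit.
Unset Printing Implicit Defensive.

Import Order.TTheory GRing.Theory Num.Theory.

Local Open Scope classical_set_scope.
Local Open Scope ring_scope.

(** The function h depends on a choice of basis: it is normalised to vanish at e1, so a unimodular
    map also shifts it by a constant. Only sums around closed polygons are free of that constant,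
    because their coefficients e^q - e^p add up to 0. Moreover the group acts on power series, not
    on the fraction field in which h lives. Integrality and equivariance of the series of a triangle
    are therefore proved in one induction on its area.

    For a single boundary segment e, the valuation property depends on which of P and Q lie to the
    left of e. If only P does, points of P on the line of e are limits of points of Q; if neither
    does, the last point of P on a segment from P to Q lies in both. Both arguments use that
    polygons are closed, which is not built into a hull defined as a smallest convex set.

    In the converse direction, from Z to rho, no fractions are needed: (e^x - 1) / x has constant
    term 1 and is invertible, so x y tau(x,y) is a power series by construction. *)

(** * Coefficients of power series and order of vanishing *)

Lemma coefsD (A : zmodType) (f g : fps A) n :
  coefs (f + g) n = coefs f n + coefs g n.
Proof. by []. Qed.
Lemma coefsN (A : zmodType) (f : fps A) n : coefs (- f) n = - coefs f n.
Proof. by []. Qed.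
Lemma coefsM (A : comNzRingType) (f g : fps A) n :
  coefs (f * g) n = \sum_(j < n.+1) coefs f j * coefs g (n - j)%N.
Proof. by []. Qed.
Lemma coefs_sum (A : zmodType) I r (P : pred I) (F : I -> fps A) n :
  coefs (\sum_(i <- r | P i) F i) n = \sum_(i <- r | P i) coefs (F i) n.
Proof. exact: (big_morph (fun f : fps A => coefs f n)). Qed.
Lemma coefs1 (A : comNzRingType) n : coefs (1 : fps A) n = (n == 0%N)%:R.
Proof. by rewrite /=; case: eqP. Qed.

Lemma coefxyD f g i j : coefxy (f + g) i j = coefxy f i j + coefxy g i j.
Proof. by []. Qed.
Lemma coefxyN f i j : coefxy (- f) i j = - coefxy f i j.
Proof. by []. Qed.
Lemma coefxyB f g i j : coefxy (f - g) i j = coefxy f i j - coefxy g i j.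
Proof. by []. Qed.
Lemma coefxy_sum I r (P : pred I) (F : I -> Qxy) m n :
  coefxy (\sum_(i <- r | P i) F i) m n = \sum_(i <- r | P i) coefxy (F i) m n.
Proof. exact: (big_morph (fun f => coefxy f m n)). Qed.
Lemma coefxyM f g m n : coefxy (f * g) m n =
  \sum_(i < m.+1) \sum_(j < n.+1) coefxy f i j * coefxy g (m - i) (n - j).
Proof.
by rewrite /coefxy coefsM coefs_sum; apply: eq_bigr => i _; rewrite coefsM.
Qed.

Lemma coefxyP (f g : Qxy) : (forall m n, coefxy f m n = coefxy g m n) -> f = g.
Proof.
by move=> fg; apply/fpsP => m; apply/fpsP => n; exact: fg.
Qed.

Lemma coefs_fpsXM (A : comNzRingType) (f : fps A) n :
  coefs (fpsX A * f) n = if n is n'.+1 then coefs f n' else 0.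
Proof.
rewrite coefsM; case: n => [|n]; first by rewrite big_ord1 mul0r.
rewrite !big_ord_recl /= mul0r add0r mul1r /bump /= subSS subn0.
by rewrite big1 ?addr0 // => i _; rewrite mul0r.
Qed.
Lemma coefs_fpsCM (A : comNzRingType) (c : A) (f : fps A) n :
  coefs (fpsC c * f) n = c * coefs f n.
Proof.
rewrite coefsM big_ord_recl /= subn0.
by rewrite big1 ?addr0 // => i _; rewrite mul0r.
Qed.

Lemma coefxy_cstM c f m n : coefxy (cst c * f) m n = c * coefxy f m n.
Proof. by rewrite /coefxy coefs_fpsCM coefs_fpsCM. Qed.
Lemma coefxy_vxM f m n :
  coefxy (vx * f) m n = if m is m'.+1 then coefxy f m' n else 0.
Proof. by rewrite /coefxy coefs_fpsXM; case: m. Qed.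
Lemma coefxy_vyM f m n :
  coefxy (vy * f) m n = if n is n'.+1 then coefxy f m n' else 0.
Proof. by rewrite /coefxy coefs_fpsCM coefs_fpsXM; case: n. Qed.
Lemma coefxy1 m n : coefxy 1 m n = ((m == 0) && (n == 0))%N%:R.
Proof.
by rewrite /coefxy coefs1; case: m => [|m] //; rewrite eqxx mulr1n coefs1.
Qed.
Lemma cst1 : cst 1 = 1. Proof. by []. Qed.
Lemma cst0 : cst 0 = 0.
Proof. by apply: coefxyP => m n; rewrite /coefxy/=; case: m; case: n. Qed.
Lemma cstD a b : cst (a + b) = cst a + cst b.
Proof.
by apply: coefxyP => m n; rewrite coefxyD /coefxy/=; case: m; case: n => //=;
   rewrite addr0.
Qed.
Lemma cstM a b : cst (a * b) = cst a * cst b.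
Proof.
by apply: coefxyP => m n; rewrite coefxy_cstM /coefxy/=;
  case: m; case: n => //= *; rewrite mulr0.
Qed.

#[local] Opaque cst vx vy coefxy fps_mul.

(** Membership in the k-th power of the maximal ideal (x, y). Identities between infinite series are
    proved modulo all of these powers. *)
Definition order_ge (k : nat) (f : Qxy) :=
  forall m n, (m + n < k)%N -> coefxy f m n = 0.

Lemma order_ge0 f : order_ge 0 f. Proof. by []. Qed.
Lemma order_geD k f g : order_ge k f -> order_ge k g -> order_ge k (f + g).
Proof. by move=> kf kg m n mn; rewrite coefxyD kf ?kg ?addr0. Qed.
Lemma order_geN k f : order_ge k f -> order_ge k (- f).
Proof. by move=> kf m n mn; rewrite coefxyN kf ?oppr0. Qed.
Lemma order_geB k f g : order_ge k f -> order_ge k g -> order_ge k (f - g).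
Proof. by move=> kf kg; apply: order_geD => //; apply: order_geN. Qed.
Lemma order_geM k l f g :
  order_ge k f -> order_ge l g -> order_ge (k + l) (f * g).
Proof.
move=> kf lg m n mn; rewrite coefxyM big1 // => i _; rewrite big1 // => j _.
have [ijk|ijk] := ltnP (i + j)%N k; first by rewrite kf ?mul0r.
rewrite lg ?mulr0 //; have := ltn_ord i; have := ltn_ord j; lia.
Qed.
Lemma order_geMl k f g : order_ge k f -> order_ge k (f * g).
Proof. by move=> /order_geM /(_ (order_ge0 g)); rewrite addn0. Qed.
Lemma order_geMr k f g : order_ge k f -> order_ge k (g * f).
Proof. by rewrite mulrC; apply: order_geMl. Qed.
Lemma order_geX f n : order_ge 1 f -> order_ge n (f ^+ n).
Proof.
move=> f1; elim: n => [|n IHn]; first by [].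
by rewrite exprS -add1n; apply: order_geM.
Qed.
Lemma order_geXX p q i j :
  order_ge 1 p -> order_ge 1 q -> order_ge (i + j) (p ^+ i * q ^+ j).
Proof. by move=> p1 q1; apply: order_geM; apply: order_geX. Qed.
Lemma order_ge_vx : order_ge 1 vx.
Proof. by move=> m n mn; rewrite -[vx]mulr1 coefxy_vxM; case: m mn. Qed.
Lemma order_ge_vy : order_ge 1 vy.
Proof. by move=> m n mn; rewrite -[vy]mulr1 coefxy_vyM; case: n mn => //; case: m. Qed.
Lemma order_ge_all f : (forall k, order_ge k f) -> f = 0.
Proof. by move=> kf; apply: coefxyP => m n; apply: (kf (m + n).+1). Qed.
Lemma order_ge_eq f g : (forall k, order_ge k (f - g)) -> f = g.
Proof. by move=> /order_ge_all /eqP; rewrite subr_eq0 => /eqP. Qed.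
Lemma order_ge_Mz k f (z : int) : order_ge k f -> order_ge k (f *~ z).
Proof.
move=> kf; case: z => n.
  rewrite -pmulrn; elim: n => [|n IHn] ; first by rewrite mulr0n.
  by rewrite mulrS; apply: order_geD.
rewrite NegzE mulrNz; apply: order_geN; rewrite -pmulrn.
elim: n => [|n IHn] ; first by rewrite mulr1n.
by rewrite mulrS; apply: order_geD.
Qed.

(** * Substitution *)

Lemma coefxy_monom i j m n :
  coefxy (vx ^+ i * vy ^+ j) m n = ((m == i) && (n == j))%:R.
Proof.
elim: i m => [|i IHi] m; last first.
  by rewrite exprS -mulrA coefxy_vxM; case: m => [|m] //; rewrite IHi.
rewrite expr0 mul1r; elim: j n => [|j IHj] n.
  by rewrite expr0 coefxy1.
by rewrite exprS coefxy_vyM; case: n => [|n]; rewrite ?IHj ?andbF // eqSS.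
Qed.

HB.lock Definition trunc (N : nat) (f : Qxy) : Qxy :=
  \sum_(i < N) \sum_(j < N) cst (coefxy f i j) * (vx ^+ i * vy ^+ j).

Lemma truncE N f : trunc N f =
  \sum_(i < N) \sum_(j < N) cst (coefxy f i j) * (vx ^+ i * vy ^+ j).
Proof. by rewrite trunc.unlock. Qed.

Lemma coefxy_trunc N f m n : (m < N)%N -> (n < N)%N ->
  coefxy (trunc N f) m n = coefxy f m n.
Proof.
move=> mN nN; rewrite truncE coefxy_sum (bigD1 (Ordinal mN)) //= [X in _ + X]big1 => [|i im].
  rewrite addr0 coefxy_sum (bigD1 (Ordinal nN)) //= [X in _ + X]big1 => [|j jn].
    by rewrite addr0 coefxy_cstM coefxy_monom !eqxx mulr1.
  rewrite coefxy_cstM coefxy_monom (_ : (n == j) = false) ?andbF ?mulr0 //.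
  by apply: contraNF jn => /eqP jn; apply/eqP/val_inj.
rewrite coefxy_sum big1 // => j _.
rewrite coefxy_cstM coefxy_monom (_ : (m == i) = false) ?mulr0 //.
by apply: contraNF im => /eqP jn; apply/eqP/val_inj.
Qed.

Lemma order_ge_trunc N f : order_ge N (f - trunc N f).
Proof.
move=> m n mn; rewrite coefxyB coefxy_trunc ?subrr //; lia.
Qed.

(* Sealed copies of subst2, subst1, fexp and fexp1, which unification would
   otherwise unfold down to sums of coefficients. *)
HB.lock Definition sub2 (f p q : Qxy) : Qxy := subst2 f p q.

Lemma sub2E f p q : subst2 f p q = sub2 f p q.
Proof. by rewrite sub2.unlock. Qed.

Section Subst.
Variables p q : Qxy.
Hypotheses (p1 : order_ge 1 p) (q1 : order_ge 1 q).

Lemma coefxy_sub2 f m n : coefxy (sub2 f p q) m n =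
  \sum_(i < (m + n).+1) \sum_(j < (m + n).+1)
      coefxy f i j * coefxy (p ^+ i * q ^+ j) m n.
Proof. by rewrite sub2.unlock. Qed.

Lemma order_ge_sub2 k f : order_ge k f -> order_ge k (sub2 f p q).
Proof.
move=> kf m n mn; rewrite coefxy_sub2 big1 // => i _; rewrite big1 // => j _.
have [ijk|ijk] := ltnP (i + j)%N k; first by rewrite kf ?mul0r.
by rewrite (order_geXX (i := i) (j := j) p1 q1) ?mulr0 //; apply: leq_trans ijk.
Qed.

Lemma sub2D f g : sub2 (f + g) p q = sub2 f p q + sub2 g p q.
Proof.
apply: coefxyP => m n; rewrite coefxyD !coefxy_sub2 -big_split.
apply: eq_bigr => i _; rewrite -big_split; apply: eq_bigr => j _.
by rewrite coefxyD mulrDl.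
Qed.

Lemma sub2_0 : sub2 0 p q = 0.
Proof.
apply: coefxyP => m n; rewrite coefxy_sub2.
by rewrite big1 // => i _; rewrite big1 // => j _; rewrite mul0r.
Qed.

Lemma sub2_sum I r (P : pred I) (F : I -> Qxy) :
  sub2 (\sum_(i <- r | P i) F i) p q = \sum_(i <- r | P i) sub2 (F i) p q.
Proof. exact: (big_morph (fun f => sub2 f p q) sub2D sub2_0). Qed.

Lemma sub2N f : sub2 (- f) p q = - sub2 f p q.
Proof.
by apply/eqP; rewrite -addr_eq0 -sub2D addNr sub2_0.
Qed.

Lemma sub2B f g : sub2 (f - g) p q = sub2 f p q - sub2 g p q.
Proof. by rewrite sub2D sub2N. Qed.

Lemma sub2_monom c k l :
  sub2 (cst c * (vx ^+ k * vy ^+ l)) p q = cst c * (p ^+ k * q ^+ l).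
Proof.
apply: coefxyP => m n; rewrite coefxy_sub2 [RHS]coefxy_cstM.
under eq_bigr => i _ do under eq_bigr => j _ do
  rewrite coefxy_cstM coefxy_monom.
(* Below total degree k + l the exponents k, l may lie outside the truncated double sum, but there
   both sides vanish. *)
have [mn|mn] := ltnP (m + n) (k + l)%N.
  rewrite (order_geXX (i := k) (j := l) p1 q1) // mulr0.
  rewrite big1 // => i _; rewrite big1 // => j _.
  case: (eqVneq (i : nat) k) => [ik|_]; last by rewrite mulr0 mul0r.
  case: (eqVneq (j : nat) l) => [jl|_]; last by rewrite mulr0 mul0r.
  by rewrite ik jl (order_geXX (i := k) (j := l) p1 q1) // mulr0.
have kK : (k < (m + n).+1)%N by lia.
have lK : (l < (m + n).+1)%N by lia.
rewrite (bigD1 (Ordinal kK)) //= [X in _ + X]big1 => [|i ik].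
  rewrite addr0 (bigD1 (Ordinal lK)) //= [X in _ + X]big1 => [|j jl].
    by rewrite !eqxx mulr1 addr0.
  have /negPf -> : (j : nat) != l by apply: contraNneq jl => jl; apply/eqP/val_inj.
  by rewrite andbF mulr0 mul0r.
rewrite big1 // => j _.
have /negPf -> : (i : nat) != k by apply: contraNneq ik => jl; apply/eqP/val_inj.
by rewrite mulr0 mul0r.
Qed.

Lemma sub2_trunc N f : sub2 (trunc N f) p q =
  \sum_(i < N) \sum_(j < N) cst (coefxy f i j) * (p ^+ i * q ^+ j).
Proof.
rewrite truncE sub2_sum; apply: eq_bigr => i _.
by rewrite sub2_sum; apply: eq_bigr => j _; rewrite sub2_monom.
Qed.

(** Monomials are settled by [sub2_monom], hence truncations too; replacing f and g by their
    truncations at N changes both sides only in order at least N, for every N. *)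
Lemma sub2M f g : sub2 (f * g) p q = sub2 f p q * sub2 g p q.
Proof.
have monM c k l N : sub2 (cst c * (vx ^+ k * vy ^+ l) * trunc N g) p q =
    sub2 (cst c * (vx ^+ k * vy ^+ l)) p q * sub2 (trunc N g) p q.
  rewrite sub2_trunc [X in _ * X]truncE mulr_sumr [RHS]mulr_sumr sub2_sum.
  apply: eq_bigr => i _; rewrite mulr_sumr [RHS]mulr_sumr sub2_sum.
  apply: eq_bigr => j _; rewrite [X in sub2 X](_ : _ =
    cst (c * coefxy g i j) * (vx ^+ (k + i) * vy ^+ (l + j))).
    by rewrite !sub2_monom cstM !exprD; ring.
  by rewrite cstM !exprD; ring.
have truncM N : sub2 (trunc N f * trunc N g) p q =
    sub2 (trunc N f) p q * sub2 (trunc N g) p q.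
  have {}monM c k l := monM c k l N.
  move: (trunc N g) monM => h monM; rewrite truncE.
  rewrite mulr_suml !sub2_sum mulr_suml; apply: eq_bigr => i _.
  rewrite mulr_suml !sub2_sum mulr_suml; apply: eq_bigr => j _.
  exact: monM.
apply: order_ge_eq => N.
have -> : sub2 (f * g) p q - sub2 f p q * sub2 g p q =
    sub2 ((f - trunc N f) * g + trunc N f * (g - trunc N g)) p q
    - (sub2 (f - trunc N f) p q * sub2 g p q
       + sub2 (trunc N f) p q * sub2 (g - trunc N g) p q).
  have -> : (f - trunc N f) * g + trunc N f * (g - trunc N g)
    = f * g - trunc N f * trunc N g by ring.
  by rewrite !sub2B truncM; ring.
apply: order_geB; first apply: order_ge_sub2; apply: order_geD.
- by apply: order_geMl; apply: order_ge_trunc.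
- by apply: order_geMr; apply: order_ge_trunc.
- by apply: order_geMl; apply: order_ge_sub2; apply: order_ge_trunc.
- by apply: order_geMr; apply: order_ge_sub2; apply: order_ge_trunc.
Qed.

Lemma sub2_cst c : sub2 (cst c) p q = cst c.
Proof. by have := sub2_monom c 0 0; rewrite !expr0 !mulr1. Qed.
Lemma sub2_1 : sub2 1 p q = 1. Proof. exact: sub2_cst. Qed.
Lemma sub2_vx : sub2 vx p q = p.
Proof. by have := sub2_monom 1 1 0; rewrite cst1 !expr0 !expr1 !mulr1 !mul1r. Qed.
Lemma sub2_vy : sub2 vy p q = q.
Proof. by have := sub2_monom 1 0 1; rewrite cst1 !expr0 !expr1 !mul1r. Qed.
Lemma sub2X f n : sub2 (f ^+ n) p q = sub2 f p q ^+ n.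
Proof.
by elim: n => [|n IHn]; rewrite ?expr0 ?sub2_1 // !exprS sub2M IHn.
Qed.
Lemma sub2Mz f z : sub2 (f *~ z) p q = sub2 f p q *~ z.
Proof.
have Mn n : sub2 (f *+ n) p q = sub2 f p q *+ n.
  by elim: n => [|n IHn]; rewrite ?mulr0n ?sub2_0 // !mulrS sub2D IHn.
by case: z => n; rewrite ?NegzE ?mulrNz -!pmulrn ?sub2N Mn.
Qed.

End Subst.

(** The same passage to truncations: on monomials the outer substitution is multiplicative by
    [sub2M]. *)
Lemma sub2_comp f p q p' q' :
  order_ge 1 p -> order_ge 1 q -> order_ge 1 p' -> order_ge 1 q' ->
  sub2 (sub2 f p q) p' q' = sub2 f (sub2 p p' q') (sub2 q p' q').
Proof.
move=> p1 q1 p'1 q'1.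
have sp : order_ge 1 (sub2 p p' q') by apply: order_ge_sub2.
have sq : order_ge 1 (sub2 q p' q') by apply: order_ge_sub2.
apply: order_ge_eq => N.
have E1 : sub2 (sub2 (f - trunc N f) p q) p' q' =
    sub2 (sub2 f p q) p' q' - sub2 (sub2 (trunc N f) p q) p' q'.
  by rewrite (sub2B _ _ f) sub2B.
have E2 : sub2 (sub2 (trunc N f) p q) p' q' =
    sub2 (trunc N f) (sub2 p p' q') (sub2 q p' q').
  rewrite (sub2_trunc p1 q1) (sub2_trunc sp sq) sub2_sum.
  apply: eq_bigr => i _; rewrite sub2_sum; apply: eq_bigr => j _.
  by rewrite !sub2M // sub2_cst // !sub2X.
have E3 : sub2 (sub2 f p q) p' q' - sub2 f (sub2 p p' q') (sub2 q p' q') =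
    sub2 (sub2 (f - trunc N f) p q) p' q'
    - sub2 (f - trunc N f) (sub2 p p' q') (sub2 q p' q').
  by rewrite E1 E2 (sub2B _ _ f (trunc N f)); ring.
rewrite E3.
by apply: order_geB; do ![apply: order_ge_sub2 => //]; apply: order_ge_trunc.
Qed.

Lemma sub2_id f : sub2 f vx vy = f.
Proof.
apply: order_ge_eq => N.
have -> : sub2 f vx vy - f = sub2 (f - trunc N f) vx vy - (f - trunc N f).
  rewrite sub2B sub2_trunc //; first by rewrite truncE; ring.
    exact: order_ge_vx.
  exact: order_ge_vy.
apply: order_geB; last exact: order_ge_trunc.
apply: order_ge_sub2; [exact: order_ge_vx|exact: order_ge_vy|].
exact: order_ge_trunc.
Qed.

Lemma order_ge_cstM k c f : order_ge k f -> order_ge k (cst c * f).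
Proof. exact: order_geMr. Qed.

#[local] Hint Resolve order_ge_vx order_ge_vy order_ge_Mz order_geD order_geN
  order_geB order_ge_cstM order_ge0 : core.

Lemma order_ge_series0 k : order_ge k 0. Proof. by []. Qed.
Arguments order_ge_series0 : clear implicits.
#[local] Hint Resolve order_ge_series0 : core.

(** * Series in one variable and the exponential *)

(** g(x) as a series constant in y: substitution into one variable becomes a case of [sub2] and
    inherits its algebra. *)
Definition ser (g : fps rat) : Qxy := Fps (fun i => fpsC (coefs g i)).

Lemma coefxy_ser g i j : coefxy (ser g) i j = if j == 0%N then coefs g i else 0.
Proof. by []. Qed.

Lemma serM g h : ser (g * h) = ser g * ser h.
Proof.
apply: coefxyP => m n; rewrite coefxyM coefxy_ser.
case: n => [|n].
  by rewrite eqxx coefsM; apply: eq_bigr => i _; rewrite big_ord1 !coefxy_ser.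
rewrite big1 // => i _; rewrite big1 // => j _; rewrite !coefxy_ser.
case: ifP => [/eqP ->|]; last by rewrite mul0r.
by rewrite subn0 mulr0.

Qed.

HB.lock Definition sub1 (g : fps rat) (p : Qxy) : Qxy := subst1 g p.

Lemma sub1E g p : subst1 g p = sub1 g p.
Proof. by rewrite sub1.unlock. Qed.

Lemma sub1_sub2 g p q : order_ge 1 p -> order_ge 1 q ->
  sub1 g p = sub2 (ser g) p q.
Proof.
move=> p1 q1; apply: coefxyP => m n; rewrite coefxy_sub2 sub1.unlock.
transitivity (\sum_(k < (m + n).+1) coefs g k * coefxy (p ^+ k) m n) => //.
apply: eq_bigr => i _; rewrite big_ord_recl [X in _ + X]big1 => [|j _].
  by rewrite addr0 expr0 mulr1 coefxy_ser.
by rewrite coefxy_ser mul0r.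
Qed.

Lemma sub2_sub1 g p a b : order_ge 1 p -> order_ge 1 a -> order_ge 1 b ->
  sub2 (sub1 g p) a b = sub1 g (sub2 p a b).
Proof.
move=> p1 a1 b1; rewrite (sub1_sub2 g p1 (order_ge_series0 1)) sub2_comp //.
by rewrite -sub1_sub2 ?sub2_0 //; apply: order_ge_sub2.
Qed.

Lemma sub1M g h p : order_ge 1 p -> sub1 (g * h) p = sub1 g p * sub1 h p.
Proof.
by move=> p1; rewrite !(sub1_sub2 _ p1 (order_ge_series0 1)) serM sub2M.
Qed.
Lemma sub1D g h p : order_ge 1 p -> sub1 (g + h) p = sub1 g p + sub1 h p.
Proof.
move=> p1; rewrite !(sub1_sub2 _ p1 (order_ge_series0 1)) -sub2D; congr sub2.
by apply: coefxyP => m n; rewrite coefxyD !coefxy_ser; case: ifP; rewrite ?addr0.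
Qed.
Lemma sub1B g h p : order_ge 1 p -> sub1 (g - h) p = sub1 g p - sub1 h p.
Proof. by move=> p1; rewrite -{2}[g](subrK h) [in RHS]sub1D // addrK. Qed.
Lemma sub1_X p : order_ge 1 p -> sub1 (fpsX rat) p = p.
Proof.
move=> p1; rewrite (sub1_sub2 _ p1 (order_ge_series0 1)) -[RHS](sub2_vx p1 (order_ge_series0 1)).
congr sub2; apply: coefxyP => m n; rewrite coefxy_ser -[vx]mulr1 coefxy_vxM.
case: m => [|m]; first by case: ifP.
by rewrite coefxy1; case: m => [|m]; case: n.
Qed.
Lemma sub1_C c p : order_ge 1 p -> sub1 (fpsC c) p = cst c.
Proof.
move=> p1; rewrite (sub1_sub2 _ p1 (order_ge_series0 1)) -[RHS](sub2_cst p1 (order_ge_series0 1)).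
congr sub2; apply: coefxyP => m n; rewrite coefxy_ser -[cst c]mulr1 coefxy_cstM.
by rewrite coefxy1; case: m => [|m]; case: n => [|n]; rewrite ?mulr1 ?mulr0.
Qed.

Definition expc : fps rat := Fps (fun n => n`!%:R^-1).
Definition exp1c : fps rat := Fps (fun n => n.+1`!%:R^-1).
HB.lock Definition ex (p : Qxy) := sub1 expc p.
HB.lock Definition ex1 (p : Qxy) := sub1 exp1c p.

Lemma fexpE p : fexp p = ex p.
Proof. by rewrite ex.unlock sub1.unlock. Qed.
Lemma fexp1E p : fexp1 p = ex1 p.
Proof. by rewrite ex1.unlock sub1.unlock. Qed.

Lemma sub2_ex p a b : order_ge 1 p -> order_ge 1 a -> order_ge 1 b ->
  sub2 (ex p) a b = ex (sub2 p a b).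
Proof. by rewrite ex.unlock; apply: sub2_sub1. Qed.
Lemma sub2_ex1 p a b : order_ge 1 p -> order_ge 1 a -> order_ge 1 b ->
  sub2 (ex1 p) a b = ex1 (sub2 p a b).
Proof. by rewrite ex1.unlock; apply: sub2_sub1. Qed.

Lemma coefxy_sub1_vx g m n :
  coefxy (sub1 g vx) m n = if n == 0%N then coefs g m else 0.
Proof.
by rewrite (sub1_sub2 _ order_ge_vx order_ge_vy) sub2_id coefxy_ser.
Qed.

Lemma coefxyXDY i j m n :
  coefxy (vx ^+ i * (vx + vy) ^+ j) m n = ('C(j, n) * (m + n == i + j))%N%:R.
Proof.
rewrite exprDn mulr_sumr coefxy_sum.
have E k : (k <= j)%N -> coefxy (vx ^+ i * ((vx ^+ (j - k) * vy ^+ k) *+ 'C(j, k))) m n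
  = ('C(j, k) * ((m == i + (j - k)) && (n == k)))%N%:R.
  move=> kj; have cM f c : coefxy (f *+ c) m n = coefxy f m n *+ c.
    by elim: c => [|c IHc]; rewrite ?mulr0n // !mulrS coefxyD IHc.
  by rewrite mulrnAr cM mulrA -exprD coefxy_monom -mulrnA mulnC.
under eq_bigr => k _ do rewrite E ?leq_ord //.
have [nj|nj] := leqP n j; last first.
  rewrite bin_small // big1 // => k _; rewrite (_ : (n == k) = false) ?andbF ?muln0 //.
  by apply/eqP => nk; have := ltn_ord k; lia.
have nj' : (n < j.+1)%N by [].
rewrite (bigD1 (Ordinal nj')) //= big1 => [|k kn].
  by rewrite addr0 eqxx andbT; congr ((_ * nat_of_bool _)%N%:R); lia.
rewrite (_ : (n == k) = false) ?andbF ?muln0 //.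
by apply: contraNF kn => /eqP kn; apply/eqP/val_inj.
Qed.

Lemma coef_swap f m n : coefxy (sub2 f vy vx) m n = coefxy f n m.
Proof.
rewrite coefxy_sub2.
under eq_bigr => i _ do under eq_bigr => j _ do rewrite mulrC mulrC [_ ^+ _ * _]mulrC coefxy_monom.
have mK : (m < (m + n).+1)%N by lia.
have nK : (n < (m + n).+1)%N by lia.
rewrite (bigD1 (Ordinal nK)) //= [X in _ + X]big1 => [|i ik].
  rewrite addr0 (bigD1 (Ordinal mK)) //= [X in _ + X]big1 => [|j jl].
    by rewrite !eqxx mulr1 addr0.
  have /negPf -> : m != j by apply: contraNneq jl => jl; apply/eqP/val_inj.
  by rewrite mulr0.
rewrite big1 // => j _.
have /negPf -> : n != i by apply: contraNneq ik => jl; apply/eqP/val_inj.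
by rewrite andbF mulr0.
Qed.

(** The universal case of [exD]. The coefficient of x^m y^n in e^(x+y) is C(m + n, n) / (m + n)! = 1
    / (m! n!). *)
Lemma ex_vxDvy : ex (vx + vy) = ex vx * ex vy.
Proof.
have xy1 : order_ge 1 (vx + vy) by auto.
have -> : ex vy = sub2 (ex vx) vy vx by rewrite sub2_ex // sub2_vx.
apply: coefxyP => m n; rewrite coefxyM.
rewrite [RHS](bigD1 ord_max) //= [X in _ = _ + X]big1 => [|i im]; last first.
  rewrite big1 // => j _; rewrite coef_swap ex.unlock !coefxy_sub1_vx.
  rewrite [X in _ * X]ifN ?mulr0 //; have := ltn_ord i.
  suff : (i : nat) != m by lia.
  by apply: contraNneq im => im; apply/eqP/val_inj.
rewrite [in RHS]big_ord_recl [X in _ = _ + X + _]big1 => [|j _]; last first.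
  by rewrite ex.unlock coefxy_sub1_vx mul0r.
rewrite !addr0 subnn subn0 coef_swap ex.unlock !coefxy_sub1_vx /=.
rewrite (sub1_sub2 _ xy1 order_ge_vx) coefxy_sub2 (bigD1 ord_max) //=.
rewrite [X in _ + X]big1 => [|i im]; last first.
  rewrite big1 // => j _; rewrite coefxy_ser; case: ifP => [/eqP ->|]; last by rewrite mul0r.
  rewrite expr0 mulr1 -[_ ^+ i]mul1r -(expr0 vx) coefxyXDY add0n.
  rewrite (_ : (_ == _) = false) ?muln0 ?mulr0 //.
  by apply: contraNF im => /eqP im; apply/eqP/val_inj.
rewrite addr0 big_ord_recl [X in _ + X]big1 => [|j _]; last by rewrite coefxy_ser mul0r.
rewrite addr0 coefxy_ser /= expr0 mulr1 -[_ ^+ _]mul1r -(expr0 vx) coefxyXDY add0n eqxx muln1.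
rewrite -bin_sub ?leq_addl // addnK.
have /(congr1 (fun n => n%:R : rat)) := bin_fact (leq_addr n m).
rewrite addKn !natrM => <-.
have Hf k : (k`!%:R : rat) != 0 by rewrite pnatr_eq0 -lt0n fact_gt0.
have Hb : ('C(m + n, m)%:R : rat) != 0 by rewrite pnatr_eq0 -lt0n bin_gt0 leq_addr.
by field; rewrite !Hf Hb.
Qed.

Lemma exD p q : order_ge 1 p -> order_ge 1 q -> ex (p + q) = ex p * ex q.
Proof.
move=> p1 q1; have := congr1 (fun f => sub2 f p q) ex_vxDvy.
by rewrite sub2M // !sub2_ex ?sub2D ?sub2_vx ?sub2_vy //; auto.
Qed.

Lemma ex0 : ex 0 = 1.
Proof.
rewrite ex.unlock (sub1_sub2 _ (order_ge_series0 1) (order_ge_series0 1)).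
apply: coefxyP => m n; rewrite coefxy_sub2 big_ord_recl [X in _ + X]big1.
  rewrite addr0 big_ord_recl [X in _ + X]big1 => [|j _].
    by rewrite addr0 coefxy_ser !expr0 mulr1 /= invr1 mul1r.
  by rewrite coefxy_ser mul0r.
by move=> i _; rewrite big1 // => j _; rewrite exprS !mul0r; apply: mulr0.
Qed.

Lemma exN p : order_ge 1 p -> ex p * ex (- p) = 1.
Proof. by move=> p1; rewrite -exD ?subrr ?ex0 //; auto. Qed.

Lemma ex_ex1 p : order_ge 1 p -> p * ex1 p = ex p - 1.
Proof.
move=> p1; rewrite ex.unlock ex1.unlock.
have -> : expc = fpsX rat * exp1c + fpsC 1.
  apply/fpsP => n; rewrite coefsD coefs_fpsXM; case: n => [|n] /=.
    by rewrite add0r invr1.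
  by rewrite addr0.
by rewrite sub1D // sub1M // sub1_X // sub1_C // cst1 addrK.
Qed.

Lemma mul_vx_inj f g : vx * f = vx * g -> f = g.
Proof.
by move=> fg; apply: coefxyP => m n; have := congr1 (fun h => coefxy h m.+1 n) fg;
  rewrite !coefxy_vxM.
Qed.
Lemma ex1N p : order_ge 1 p -> ex p * ex1 (- p) = ex1 p.
Proof.
move=> p1.
(* The factor p may be 0 and cannot be cancelled; x can, and p is substituted for it afterwards. *)
suff /(congr1 (fun f => sub2 f p p)) : ex vx * ex1 (- vx) = ex1 vx.
  by rewrite sub2M // !sub2_ex1 ?sub2_ex ?sub2N ?sub2_vx //; auto.
apply: mul_vx_inj; rewrite ex_ex1 // mulrCA.
have -> : vx * ex1 (- vx) = 1 - ex (- vx).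
  by rewrite -[LHS]opprK -mulNr ex_ex1 ?opprB //; auto.
by rewrite mulrBr exN // mulr1.
Qed.

(** * Inverses of series with constant term 1 *)

Definition geom : fps rat := Fps (fun=> 1).
(** The geometric series in 1 - f: an explicit inverse, so that it commutes with substitution. *)
HB.lock Definition inv1 (f : Qxy) := sub1 geom (1 - f).

Lemma inv1P f : order_ge 1 (1 - f) -> f * inv1 f = 1.
Proof.
move=> f1; rewrite inv1.unlock -{1}[f](subKr 1).
have : (fpsC 1 - fpsX rat) * geom = fpsC 1.
  rewrite mulrBl; apply/fpsP => n; rewrite coefsD coefsN coefs_fpsXM coefs_fpsCM.
  by case: n => [|n] /=; rewrite mulr1 ?subr0 ?subrr.
move=> /(congr1 (fun g => sub1 g (1 - f))); rewrite sub1M // sub1_C // cst1 => E.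
rewrite -[RHS]E.
by congr (_ * _); rewrite sub1B // sub1_C // sub1_X // cst1.
Qed.

Lemma sub2_inv1 f a b : order_ge 1 (1 - f) -> order_ge 1 a -> order_ge 1 b ->
  sub2 (inv1 f) a b = inv1 (sub2 f a b).
Proof.
by move=> f1 a1 b1; rewrite inv1.unlock sub2_sub1 // sub2B sub2_1.
Qed.

Lemma order_ge_ex1 p : order_ge 1 p -> order_ge 1 (1 - ex1 p).
Proof.
move=> p1; have -> : 1 - ex1 p = sub2 (1 - ser exp1c) p p.
  by rewrite ex1.unlock (sub1_sub2 _ p1 p1) sub2B // sub2_1.
apply: (order_ge_sub2 p1 p1) => m n mn.
have [-> ->] : m = 0%N /\ n = 0%N by lia.
by rewrite coefxyB coefxy_ser coefxy1 /= invr1 subrr.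
Qed.

(** * Invariant series *)

Lemma big_single (F : nat -> nat -> rat) a b K : (a < K)%N -> (b < K)%N ->
  \sum_(i < K) \sum_(j < K)
    (if (i == a :> nat) && (j == b :> nat) then F i j else 0) = F a b.
Proof.
move=> aK bK.
rewrite (bigD1 (Ordinal aK)) //= [X in _ + X]big1 => [|i ik].
  rewrite addr0 (bigD1 (Ordinal bK)) //= [X in _ + X]big1 => [|j jl].
    by rewrite !eqxx addr0.
  by rewrite ifN // eqxx /=; apply: contraNneq jl => jl; apply/eqP/val_inj.
rewrite big1 // => j _; rewrite ifN // negb_and; apply/orP; left.
by apply: contraNneq ik => jl; apply/eqP/val_inj.
Qed.

(** By induction on m: the coefficient of x^(m+1) y^n in f(x, x + y) is that of f plus n + 1 times
    the coefficient of x^m y^(n+1). Terms with a lower power of x vanish by induction, those with a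
    higher one carry a binomial C(j, n) with j < n. *)
Lemma shear_invariant f :
  sub2 f vx (vx + vy) = f -> forall m n, (0 < n)%N -> coefxy f m n = 0.
Proof.
move=> fE; elim/ltn_ind => m IHm [|n] // _.
have xy1 : order_ge 1 (vx + vy) by auto.
have := congr1 (fun f => coefxy f m.+1 n) fE; rewrite coefxy_sub2.
have E i j : coefxy f i j * coefxy (vx ^+ i * (vx + vy) ^+ j) m.+1 n =
    (if (i == m.+1 :> nat) && (j == n :> nat) then coefxy f i j else 0) +
    (if (i == m :> nat) && (j == n.+1 :> nat) then coefxy f i j *+ n.+1 else 0).
  rewrite coefxyXDY; case: (eqVneq (m.+1 + n)%N (i + j)%N) => ij; last first.
    by rewrite muln0 mulr0 !ifN ?addr0 //; lia.
  rewrite muln1; case: ifP => [/andP[/eqP -> /eqP ->]|ijm].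
    by rewrite binn mulr1 ifN ?addr0 //; lia.
  case: ifP => [/andP[_ /eqP ->]|ijn]; first by rewrite binSn mulr_natr add0r.
  have [jn|jn] := ltnP j n; first by rewrite bin_small // mulr0 addr0.
  by rewrite IHm ?mul0r ?addr0 //; lia.
under eq_bigr => i _ do under eq_bigr => j _ do rewrite E.
have mK : (m.+1 < (m.+1 + n).+1)%N by lia.
have mK' : (m < (m.+1 + n).+1)%N by lia.
have nK : (n < (m.+1 + n).+1)%N by lia.
have nK' : (n.+1 < (m.+1 + n).+1)%N by lia.
under eq_bigr => i _ do rewrite big_split.
rewrite big_split /= (big_single (coefxy f)) //.
rewrite (big_single (fun i j => coefxy f i j *+ n.+1)) //.
move/eqP; rewrite -subr_eq0 addrAC subrr add0r mulrn_eq0 /= => /eqP //.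
Qed.

Lemma cstN a : cst (- a) = - cst a.
Proof. by apply/eqP; rewrite -addr_eq0 -cstD addNr cst0. Qed.

(** The shear leaves only powers of x, which the swap turns into powers of y. *)
Lemma const_invariant f :
  sub2 f vx (vx + vy) = f -> sub2 f vy vx = f -> f = cst (coefxy f 0 0).
Proof.
move=> fE fsw; apply: coefxyP => m n.
rewrite -[cst _]mulr1 coefxy_cstM coefxy1.
have f0 := shear_invariant fE.
case: n => [|n]; last by rewrite f0 // andbF mulr0.
case: m => [|m]; last by rewrite -fsw coef_swap f0 // mulr0.
by rewrite mulr1.
Qed.

Lemma coefxy_subNvx f m n :
  coefxy (sub2 f (- vx) vy) m n = (-1) ^+ m * coefxy f m n.
Proof.
rewrite coefxy_sub2.
have E i j : coefxy f i j * coefxy ((- vx) ^+ i * vy ^+ j) m n =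
    if (i == m :> nat) && (j == n :> nat) then (-1) ^+ m * coefxy f m n else 0.
  have -> : (- vx) ^+ i * vy ^+ j = cst ((-1) ^+ i) * (vx ^+ i * vy ^+ j).
    rewrite mulrA; congr (_ * _); elim: i => [|i IHi]; first by rewrite !expr0 mul1r.
    by rewrite !exprS IHi cstM cstN cst1; ring.
  rewrite coefxy_cstM coefxy_monom [m == i]eq_sym [n == j]eq_sym.
  case: andP => [[/eqP -> /eqP ->]|_]; last by rewrite !mulr0.
  by rewrite mulr1 mulrC.
under eq_bigr => i _ do under eq_bigr => j _ do rewrite E.
by rewrite (big_single (fun _ _ => (-1) ^+ m * coefxy f m n)) //; lia.
Qed.

(** * The series of a segment *)

Lemma f1_ofE g :
  f1_of g = sub1 g (vx ^+ 2) * ex (cst 2^-1 * vx).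
Proof. by rewrite /f1_of sub1E fexpE. Qed.

Lemma order_ge_sqr p : order_ge 1 p -> order_ge 1 (p ^+ 2).
Proof. by move=> p1; rewrite expr2; apply: order_geMl. Qed.

Lemma coefxy_sub1_sqr g m n : coefxy (sub1 g (vx ^+ 2)) m n =
  if (n == 0%N) && ~~ odd m then coefs g m./2 else 0.
Proof.
have x21 := order_ge_sqr order_ge_vx.
rewrite (sub1_sub2 _ x21 order_ge_vy) coefxy_sub2.
have E i j : coefxy (ser g) i j * coefxy ((vx ^+ 2) ^+ i * vy ^+ j) m n =
    if (i == m./2 :> nat) && (j == n :> nat)
    then (if (n == 0%N) && ~~ odd m then coefs g m./2 else 0) else 0.
  rewrite -exprM coefxy_monom coefxy_ser.
  have := odd_double_half m.
  case: (eqVneq j n) => [->|jn] mE; last first.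
    by rewrite !andbF mulr0.
  rewrite !andbT; case: (eqVneq n 0%N) => n0 /=; last by rewrite mul0r if_same.
  case: (eqVneq i m./2) => [->|im].
    case: (odd m) mE => /= mE; last by rewrite (_ : _ == _) ?mulr1 //; lia.
    by rewrite (_ : (_ == _) = false) ?mulr0 //; lia.
  by rewrite (_ : (_ == _) = false) ?mulr0 //; apply: contraNF im; lia.
under eq_bigr => i _ do under eq_bigr => j _ do rewrite E.
rewrite (big_single (fun _ _ => _)) //; last by lia.
by have := odd_double_half m; lia.
Qed.

Lemma coefxy_sub1_scale g c m n : coefxy (sub1 g (cst c * vx)) m n =
  if n == 0%N then c ^+ m * coefs g m else 0.
Proof.
have cx1 : order_ge 1 (cst c * vx) by auto.
rewrite (sub1_sub2 _ cx1 order_ge_vy) coefxy_sub2.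
have E i j : coefxy (ser g) i j * coefxy ((cst c * vx) ^+ i * vy ^+ j) m n =
    if (i == m :> nat) && (j == n :> nat)
    then (if n == 0%N then c ^+ m * coefs g m else 0) else 0.
  have -> : (cst c * vx) ^+ i = cst (c ^+ i) * vx ^+ i.
    elim: i => [|i IH]; first by rewrite !expr0 mul1r.
    by rewrite !exprS IH cstM; ring.
  rewrite -mulrA coefxy_cstM coefxy_monom coefxy_ser.
  case: (eqVneq i m) => [->|] /=; last by rewrite !mulr0.
  case: (eqVneq j n) => [->|] /=; last by rewrite !mulr0.
  by rewrite mulr1; case: eqP; rewrite ?mul0r // mulrC.
under eq_bigr => i' _ do under eq_bigr => j _ do rewrite E.
by rewrite (big_single (fun _ _ => _)) //; lia.
Qed.

(** Centring the segment at the origin: multiplied by e^(-x/2), f becomes invariant under x -> -x,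
    so that only even powers of x survive. *)
Lemma f1_of_reflection f :
  (forall m n, (0 < n)%N -> coefxy f m n = 0) ->
  ex vx * sub2 f (- vx) vy = f -> exists g, f = f1_of g.
Proof.
move=> f0 fE; pose h := cst 2^-1 * vx.
have h1 : order_ge 1 h by apply: order_ge_cstM.
have pot : h + h = vx.
  rewrite -mulrDl -cstD (_ : 2^-1 + 2^-1 = 1) ?cst1 ?mul1r //.
have Nx1 : order_ge 1 (- vx) by auto.
pose e := f * ex (- h).
have fe : f = e * ex h by rewrite /e -mulrA [ex _ * _]mulrC exN // mulr1.
have eE : sub2 e (- vx) vy = e.
  rewrite /e sub2M // sub2_ex; auto; rewrite sub2N /h sub2M // sub2_cst // sub2_vx //.
  rewrite mulrN opprK -/h -[in RHS]fE -pot exD // [ex h * ex h * _]mulrAC.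
  by rewrite -[RHS]mulrA exN // mulr1 mulrC.
have e0 m n : (0 < n)%N -> coefxy e m n = 0.
  move=> n0; rewrite /e coefxyM big1 // => i _; rewrite big_ord_recr /=.
  rewrite f0 // mul0r addr0 big1 // => j _.
  have -> : - h = cst (- 2^-1) * vx by rewrite cstN mulNr.
  rewrite ex.unlock.
  by rewrite coefxy_sub1_scale ifN ?mulr0 //; have := ltn_ord j; lia.
exists (Fps (fun n => coefxy e n.*2 0)); rewrite f1_ofE -/h [LHS]fe; congr (_ * _).
apply: coefxyP => m n; rewrite coefxy_sub1_sqr /=.
case: (eqVneq n 0%N) => [->|n0] /=; last by rewrite e0 // lt0n.
case: ifPn => [/even_halfK -> //|/negPn om].
have /eqP := congr1 (fun f => coefxy f m 0) eE; rewrite coefxy_subNvx.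
by rewrite -signr_odd om mulN1r => /eqP; move: (coefxy e m 0) => a ?; lra.
Qed.

Section f1_of_theory.
Variable g : fps rat.

Lemma sub2_f1 p q : order_ge 1 p -> order_ge 1 q ->
  sub2 (f1_of g) p q = sub1 g (p ^+ 2) * ex (cst 2^-1 * p).
Proof.
move=> p1 q1; have x21 := order_ge_sqr order_ge_vx.
rewrite f1_ofE sub2M // sub2_sub1 // sub2X // sub2_vx // sub2_ex //; auto.
by rewrite sub2M // sub2_cst // sub2_vx.
Qed.

Lemma f1_of_sub2 q : order_ge 1 q -> sub2 (f1_of g) vx q = f1_of g.
Proof. by move=> q1; rewrite sub2_f1 // f1_ofE. Qed.

(** The reflection exchanging the ends of a segment. The second arguments q and r are free since
    [f1_of g] does not involve y. *)
Lemma sub2_f1N p q r : order_ge 1 p -> order_ge 1 q -> order_ge 1 r ->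
  ex p * sub2 (f1_of g) (- p) q = sub2 (f1_of g) p r.
Proof.
move=> p1 q1 r1; rewrite !sub2_f1 //; auto.
rewrite sqrrN mulrCA; congr (_ * _); rewrite mulrN.
have h1 : order_ge 1 (cst 2^-1 * p) by auto.
have {1}-> : p = cst 2^-1 * p + cst 2^-1 * p.
  by rewrite -mulrDl -cstD (_ : 2^-1 + 2^-1 = 1) ?cst1 ?mul1r.
by rewrite exD // -mulrA exN // mulr1.
Qed.
End f1_of_theory.

(** * Linear forms *)

Notation pt := 'cV[int]_2.

Definition vec (a b : int) : pt := \col_i (if i == 0 then a else b).

Lemma vecE (v : pt) : v = vec (v 0 0) (v 1 0).
Proof.
apply/colP => i; rewrite mxE; case: eqP => [->//|/eqP i0]; congr (v _ _).
by apply/val_inj => /=; case: i i0 => -[|[]].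
Qed.
Lemma vec0 a b : vec a b 0 0 = a. Proof. by rewrite mxE. Qed.
Lemma vec1 a b : vec a b 1 0 = b. Proof. by rewrite mxE. Qed.
Lemma vec_inj a b c d : vec a b = vec c d -> a = c /\ b = d.
Proof. by move=> e; rewrite -(vec0 a b) -{2}(vec1 a b) e vec0 vec1. Qed.
Lemma vecD a b c d : vec a b + vec c d = vec (a + c) (b + d).
Proof. by apply/colP => i; rewrite !mxE; case: ifP. Qed.
Lemma vecN a b : - vec a b = vec (- a) (- b).
Proof. by apply/colP => i; rewrite !mxE; case: ifP. Qed.
Lemma ptP (u v : pt) : u 0 0 = v 0 0 -> u 1 0 = v 1 0 -> u = v.
Proof. by move=> e0 e1; rewrite (vecE u) (vecE v) e0 e1. Qed.

HB.lock Definition lin (v : pt) : Qxy := vx *~ v 0 0 + vy *~ v 1 0.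

Lemma order_ge_lin v : order_ge 1 (lin v).
Proof. by rewrite lin.unlock; auto. Qed.
#[local] Hint Resolve order_ge_lin : core.

Lemma linD u v : lin (u + v) = lin u + lin v.
Proof. by rewrite lin.unlock !mxE !mulrzDr addrACA. Qed.
Lemma linN u : lin (- u) = - lin u.
Proof. by rewrite lin.unlock !mxE !mulrNz opprD. Qed.
Lemma linB u v : lin (u - v) = lin u - lin v.
Proof. by rewrite linD linN. Qed.
Lemma lin0 : lin 0 = 0.
Proof. by rewrite lin.unlock !mxE !mulr0z addr0. Qed.

Lemma linE a b : lin (vec a b) = vx *~ a + vy *~ b.
Proof. by rewrite lin.unlock vec0 vec1. Qed.

Definition det2 (u v : pt) : int := u 0 0 * v 1 0 - u 1 0 * v 0 0.

Definition lincomb (u v w : pt) : pt :=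
  vec (u 0 0 * w 0 0 + v 0 0 * w 1 0) (u 1 0 * w 0 0 + v 1 0 * w 1 0).

Lemma sub2_lin w u v : sub2 (lin w) (lin u) (lin v) = lin (lincomb u v w).
Proof.
rewrite {1}lin.unlock sub2D !sub2Mz sub2_vx ?sub2_vy // lin.unlock vec0 vec1.
by ring.
Qed.

Lemma affine_actE M t f :
  affine_act M t f = ex (lin t) * sub2 f (lin (col 0 M)) (lin (col 1 M)).
Proof. by rewrite /affine_act fexpE sub2E lin.unlock !mxE. Qed.

Lemma mulmx2E (M : 'M[int]_2) (v : pt) : M *m v = lincomb (col 0 M) (col 1 M) v.
Proof.
have E i : (M *m v) i 0 = M i 0 * v 0 0 + M i 1 * v 1 0.
  by rewrite mxE big_ord_recl big_ord1; congr (_ + M _ _ * v _ _); apply/val_inj.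
by apply: ptP; rewrite E ?vec0 ?vec1 !mxE.
Qed.

(** * Power series over an integral domain *)

Section FpsUnitRing.
Variable A : comNzRingType.
Implicit Types f g : fps A.

Definition fps_unit : pred (fps A) := fun f => `[< exists g, g * f = 1 >].
Definition fps_inv f : fps A := xget f [set g | g * f = 1].

Fact fps_mulVx : {in fps_unit, left_inverse 1 fps_inv *%R}.
Proof. by move=> f /asboolP/(xgetPex f). Qed.
Fact fps_unitPl f g : g * f = 1 -> fps_unit f.
Proof. by move=> gf; apply/asboolP; exists g. Qed.
Fact fps_inv_out : {in [predC fps_unit], fps_inv =1 id}.
Proof.
by move=> f /asboolPn uf; apply: xgetPN => g gf; apply: uf; exists g.
Qed.

HB.instance Definition _ := GRing.ComNzRing_hasMulInverse.Build (fps A)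
  fps_mulVx fps_unitPl fps_inv_out.
End FpsUnitRing.

(** The lowest coefficients multiply. Applied twice, this makes Q[[x,y]] a domain, whose fraction
    field houses tau and h. *)
Fact fps_integral (A : idomainType) (f g : fps A) :
  f * g = 0 -> (f == 0) || (g == 0).
Proof.
have lowest (h : fps A) : h != 0 ->
    exists2 n, coefs h n != 0 & forall m, (m < n)%N -> coefs h m = 0.
  move=> h0; have ex : exists n, coefs h n != 0.
    apply/not_existsP => h00; case/eqP: h0; apply/fpsP => n.
    by apply/eqP/negPn/negP; exact: h00.
  exists (ex_minn ex); case: ex_minnP => // m hm mmin n nm.
  by apply: contraTeq nm => /mmin; rewrite -leqNgt.
move=> fg; apply/norP => -[/lowest[m fm f0] /lowest[n gn g0]].
have := congr1 (fun h => coefs h (m + n)) fg; rewrite coefsM.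
have mmn : (m < (m + n).+1)%N by lia.
rewrite (bigD1 (Ordinal mmn)) //= [X in _ + X]big1 => [|i im].
  by rewrite addr0 addKn => /eqP; rewrite mulf_eq0 (negbTE fm) (negbTE gn).
have [im'|im'] := ltnP i m; first by rewrite f0 // mul0r.
rewrite g0 ?mulr0 //; have := ltn_ord i.
suff : (i : nat) != m by lia.
by apply: contraNneq im => im; apply/eqP/val_inj.
Qed.

HB.instance Definition _ (A : idomainType) :=
  GRing.ComUnitRing_isIntegral.Build (fps A) (@fps_integral A).

Lemma lin_eq0 v : (lin v == 0) = (v == 0).
Proof.
apply/eqP/eqP => [|->]; last exact: lin0.
rewrite (vecE v) linE; move: (v 0 0) (v 1 0) => a b ab0.
have xz c m n : coefxy (vx *~ c) m n = c%:~R * coefxy vx m n.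
  elim/int_rec: c => [|c IH|c IH]; rewrite ?mulr0z ?mul0r //.
    by rewrite intS mulrzDr coefxyD IH; ring.
  by rewrite intS opprD mulrzDr coefxyD -[-1 : int]/(-1%:Z) mulrNz coefxyN IH; ring.
have yz c m n : coefxy (vy *~ c) m n = c%:~R * coefxy vy m n.
  elim/int_rec: c => [|c IH|c IH]; rewrite ?mulr0z ?mul0r //.
    by rewrite intS mulrzDr coefxyD IH; ring.
  by rewrite intS opprD mulrzDr coefxyD -[-1 : int]/(-1%:Z) mulrNz coefxyN IH; ring.
have c10 := congr1 (fun f => coefxy f 1 0) ab0.
have c01 := congr1 (fun f => coefxy f 0 1) ab0.
move: c10 c01; rewrite !coefxyD !xz !yz -[vx]mulr1 -[vy]mulr1 !coefxy_vxM !coefxy_vyM.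
rewrite coefxy1 !mulr0 addr0 add0r !mulr1 => /eqP; rewrite intr_eq0 => /eqP ->.
move=> /eqP; rewrite intr_eq0 => /eqP ->.
by apply: ptP; rewrite ?vec0 ?vec1 mxE.
Qed.

Lemma vx_lin : vx = lin (vec 1 0).
Proof. by rewrite linE mulr0z addr0. Qed.
Lemma vy_lin : vy = lin (vec 0 1).
Proof. by rewrite linE mulr0z add0r. Qed.

Notation "f @[ u , w ]" := (sub2 f (lin u) (lin w))
  (at level 2, left associativity, format "f @[ u ,  w ]").

(** * The invariant series rho and the series f2 *)

Section Rho.
Variable rho : Qxy.
Hypotheses (rhoD4 : D4_invariant rho) (rhoE : rho_equation rho).

Definition sigma (a b : pt) : Qxy := rho@[a, b - a].

Lemma rho_inv1 : sub2 rho (vx + vy) (- vy) = rho.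
Proof.
have /rhoD4 : D4 (mx2 1 0 1 (-1)) by apply: gen_in; left.
rewrite affine_actE lin0 ex0 mul1r => E; rewrite -[RHS]E; congr sub2.
  by rewrite lin.unlock !mxE /= !mulr1z.
by rewrite lin.unlock !mxE /= mulr0z add0r mulrN1z.
Qed.

Lemma rho_inv2 : sub2 rho vx (- (vx *+ 2) - vy) = rho.
Proof.
have /rhoD4 : D4 (mx2 1 (-2) 0 (-1)) by apply: gen_in; right.
rewrite affine_actE lin0 ex0 mul1r => E; rewrite -[RHS]E; congr sub2.
  by rewrite lin.unlock !mxE /= mulr1z mulr0z addr0.
by rewrite lin.unlock !mxE /= mulrNz -pmulrn mulrN1z.
Qed.

(** In terms of sigma, the first generator of D4 exchanges a and b; the second, in [sigmaN], changes
    the sign of b. *)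
Lemma sigmaC a b : sigma a b = sigma b a.
Proof.
rewrite /sigma -{1}rho_inv1 sub2_comp // ?sub2D ?sub2N ?sub2_vx ?sub2_vy //; auto.
by rewrite -linN -linD addrC subrK opprB.
Qed.

Lemma sigmaN a b : sigma a (- b) = sigma a b.
Proof.
rewrite /sigma -[in RHS]rho_inv2 sub2_comp //; auto; last first.
  by apply: order_geB => //; apply: order_geN; rewrite mulr2n; auto.
rewrite mulr2n sub2B sub2N sub2D sub2_vx ?sub2_vy //.
rewrite -linD -linN -linB; congr (sub2 _ _ (lin _)).
by apply/matrixP => i j; rewrite !mxE; ring.
Qed.

Lemma sigmaNl a b : sigma (- a) b = sigma a b.
Proof. by rewrite sigmaC sigmaN sigmaC. Qed.

(** This is [rho_equation] at x = a, y = b - a; divided by the product of the forms a, b and a + b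
    it becomes the additivity of tau. *)
Lemma sigma_split a b :
  lin (a + b) * sigma a b = lin b * sigma a (a + b) + lin a * sigma b (a + b).
Proof.
have la := order_ge_lin a; have lb := order_ge_lin (b - a).
move: rhoE; rewrite /rho_equation !sub2E mulr2n => E.
set A := sub2 rho vx (vx + vy) in E; set B := sub2 rho (vx + vy) vx in E.
have := congr1 (fun f => f@[a, b - a]) E.
rewrite (sub2M la lb (vx + vx + vy) rho) (sub2D _ _ ((vx + vy) * A) (vx * B)).
rewrite (sub2M la lb (vx + vy) A) (sub2M la lb vx B) /A /B.
have ox := order_ge_vx; have oxy := order_geD order_ge_vx order_ge_vy.
rewrite (sub2_comp rho ox oxy la lb) (sub2_comp rho oxy ox la lb).
rewrite (sub2D _ _ (vx + vx) vy) (sub2D _ _ vx vx) (sub2D _ _ vx vy).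
rewrite (sub2_vx la lb) (sub2_vy la lb) -!linD.
have -> : a + a + (b - a) = a + b by rewrite addrACA subrr addr0.
have -> : a + (b - a) = b by rewrite addrC subrK.
by rewrite /sigma addrC addrK addrAC subrr add0r.
Qed.

(** Divisibility by y: at y = 0 both terms become ((e^x - 1) / x) rho(x, -x), by [ex1N] and
    sigma(-x, 0) = sigma(x, 0). *)
Lemma exists_f2 : exists f2, is_f2 rho f2.
Proof.
rewrite /is_f2 !sub2E !fexpE !fexp1E.
set h := _ - _.
suff h0 : forall m, coefxy h m 0 = 0.
  exists (Fps (fun m => Fps (fun n => coefxy h m n.+1))).
  by apply: coefxyP => m [|n]; rewrite coefxy_vyM //.
have x1 : order_ge 1 (vy - vx) by auto.
have coef0 f m : coefxy (sub2 f vx 0) m 0 = coefxy f m 0.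
  rewrite coefxy_sub2; pose F := (fun (_ _ : nat) => coefxy f m 0).
  have E i j : coefxy f i j * coefxy (vx ^+ i * 0 ^+ j) m 0 =
      if (i == m :> nat) && (j == 0%N :> nat) then F i j else 0.
    case: j => [|j]; last by rewrite exprS mul0r mulr0 andbF; apply: mulr0.
    rewrite -[_ ^+ 0](expr0 vy) coefxy_monom /= [m == i]eq_sym /F.
    by case: eqP => [->|]; rewrite ?mulr1 ?mulr0.
  under eq_bigr => i _ do under eq_bigr => j _ do rewrite E.
  by rewrite big_single //; lia.
move=> m; rewrite -coef0 /h sub2B.
have ox := order_ge_vx; have o0 := order_ge_series0 1.
rewrite (sub2M ox o0 (ex vx * ex1 (vy - vx))) (sub2M ox o0 (ex vx)) (sub2M ox o0 (ex1 vx)).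
rewrite sub2_ex // !sub2_ex1 //.
rewrite !sub2_comp // !sub2B !sub2_vx ?sub2_vy // sub0r ex1N //.
have vx0 : - vx = lin (vec (-1) 0) by rewrite linE mulr0z addr0 mulrN1z.
have -> : sub2 rho (- vx) vx = sub2 rho vx (- vx).
  have := sigmaNl (vec 1 0) 0; rewrite /sigma vecN !sub0r !vecN opprK oppr0 -vx0.
  by rewrite -vx_lin add0r -vx0.
by rewrite subrr.
Qed.

Section F2.
Variable f2 : Qxy.
Hypothesis f2E : is_f2 rho f2.

Lemma f2_sub u w : lin w * f2@[u, w] =
  ex (lin u) * ex1 (lin (w - u)) * sigma (w - u) w - ex1 (lin u) * sigma u w.
Proof.
have x1 : order_ge 1 (vy - vx) by auto.
have := congr1 (fun f => f@[u, w]) f2E.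
rewrite !sub2E !fexpE !fexp1E.
have lu := order_ge_lin u; have lw := order_ge_lin w.
rewrite (sub2M lu lw vy f2) (sub2B _ _ (ex vx * ex1 (vy - vx) * _)).
rewrite (sub2M lu lw (ex vx * ex1 (vy - vx))) (sub2M lu lw (ex vx)) (sub2M lu lw (ex1 vx)).
have ox := order_ge_vx.
rewrite (sub2_ex ox lu lw) (sub2_ex1 x1 lu lw) (sub2_ex1 ox lu lw).
rewrite (sub2_comp rho x1 ox lu lw) (sub2_comp rho ox x1 lu lw).
rewrite (sub2B _ _ vy vx) (sub2_vx lu lw) (sub2_vy lu lw) -linB => ->.
by rewrite /sigma opprB addrCA subrr addr0.
Qed.

(** The denominators cleared are the forms of the three edge directions of the triangle (0, u, w),
    and the exponentials now occur as differences along edges. *)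
Lemma f2_subM u w : lin w * lin (w - u) * lin u * f2@[u, w] =
  (ex (lin w) - ex (lin u)) * lin u * sigma (w - u) w
  - (ex (lin u) - 1) * lin (w - u) * sigma u w.
Proof.
have E1 := ex_ex1 (order_ge_lin u).
have E2 := ex_ex1 (order_ge_lin (w - u)).
have E3 : ex (lin w) = ex (lin u) * ex (lin (w - u)).
  by rewrite -exD // -linD addrCA subrr addr0.
rewrite E3 -E1 (_ : ex (lin u) * ex (lin (w - u)) - ex (lin u) =
  ex (lin u) * (ex (lin (w - u)) - 1)); last by ring.
rewrite -E2 (_ : _ * f2@[u, w] = lin (w - u) * lin u * (lin w * f2@[u, w])); last by ring.
by rewrite f2_sub; ring.
Qed.
End F2.
End Rho.

Lemma sum_split (F : comNzRingType) (x y z s t r : F) :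
  x + y + z = x + t - s + (y + r - t) + (z + s - r).
Proof. by ring. Qed.

Lemma cycle_sum (F : comNzRingType) (x y z s : F) :
  (y - x) * s + (z - y) * s + (x - z) * s = 0.
Proof. by ring. Qed.

(** Here [cone_sum], [ew], [ea] stand for e^u, e^w, e^a, and [hu], [hv], [hw] for h at u, w - u, w.
    The coefficients of the three values of h add up to 0, so only their differences enter. *)
Lemma triangle_identity (F : fieldType) (eps hu hw hv lu lw lv s1 s2 cone_sum ew ea f : F) :
  hw - hu = eps * (s1 / (lu * lw)) -> hw - hv = - eps * (s2 / (lv * lw)) ->
  lu != 0 -> lw != 0 -> lv != 0 ->
  lw * lv * lu * f = (ew - cone_sum) * lu * s2 - (cone_sum - 1) * lv * s1 ->
  (ea * cone_sum - ea) * hu + (ea * ew - ea * cone_sum) * hv + (ea - ea * ew) * hw = ea * f * eps.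
Proof.
move=> h1 h2 u0 w0 v0 E.
have -> : hu = hw - eps * (s1 / (lu * lw)) by rewrite -h1; ring.
have -> : hv = hw + eps * (s2 / (lv * lw)).
  by rewrite -[eps * _]opprK -mulNr -h2; ring.
have -> : f = ((ew - cone_sum) * lu * s2 - (cone_sum - 1) * lv * s1) / (lw * lv * lu).
  by rewrite -E; field; rewrite w0 v0 u0.
by field; rewrite w0 v0 u0.
Qed.

Lemma three_term (F : fieldType) (la lb l s sa sb : F) :
  la != 0 -> lb != 0 -> l != 0 -> l * s = lb * sa + la * sb ->
  s / (la * lb) = sa / (la * l) + sb / (lb * l).
Proof.
move=> a0 b0 l0 E; have -> : s = (lb * sa + la * sb) / l by rewrite -E; field.
by field; rewrite a0 b0 l0.
Qed.

(** * The function h in the fraction field *)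

Section Cocycle.
Variables rho f2 : Qxy.
Hypotheses (rhoD4 : D4_invariant rho) (rhoE : rho_equation rho).
Hypothesis f2E : is_f2 rho f2.

Local Notation K := {fraction Qxy}.
Local Notation "x %:F" := (@FracField.tofrac (fps (fps rat)) x).

Definition linF (v : pt) : K := (lin v)%:F.
Definition exF (v : pt) : K := (ex (lin v))%:F.
Definition tau (a b : pt) : K := (sigma rho a b)%:F / (linF a * linF b).

Lemma linF_eq0 v : (linF v == 0) = (v == 0).
Proof. by rewrite /linF tofrac_eq0 lin_eq0. Qed.
Lemma linFN u : linF (- u) = - linF u.
Proof. by rewrite /linF linN tofracN. Qed.

Lemma tauC a b : tau a b = tau b a.
Proof. by rewrite /tau sigmaC // mulrC [linF a * _]mulrC mulrC. Qed.
Lemma tauN a b : tau a (- b) = - tau a b.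
Proof. by rewrite /tau sigmaN // linFN mulrN invrN mulrN. Qed.
Lemma tauNl a b : tau (- a) b = - tau a b.
Proof. by rewrite tauC tauN tauC. Qed.
Lemma tau_split a b : a != 0 -> b != 0 -> a + b != 0 ->
  tau a b = tau a (a + b) + tau (a + b) b.
Proof.
move=> a0 b0 ab0; rewrite [tau (a + b) b]tauC.
have := congr1 (@FracField.tofrac (fps (fps rat))) (sigma_split rhoE a b); rewrite tofracD !tofracM.
rewrite -/(linF _) -/(linF a) -/(linF b) => E.
have La : linF a != 0 by rewrite linF_eq0.
have Lb : linF b != 0 by rewrite linF_eq0.
have Lab : linF (a + b) != 0 by rewrite linF_eq0.
move: La Lb Lab E; rewrite /tau; exact: three_term.
Qed.

Lemma det2_neq0 a b : det2 a b != 0 -> [/\ a != 0, b != 0 & a + b != 0].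
Proof.
rewrite /det2 => d; split; apply: contraNneq d.
- by move=> ->; rewrite !mxE !mul0r subrr.
- by move=> ->; rewrite !mxE !mulr0 subrr.
- move/eqP; rewrite addr_eq0 => /eqP ->; rewrite !mxE; apply/eqP; ring.
Qed.

Lemma det2N a b : det2 (- a) b = - det2 a b.
Proof. by rewrite /det2 !mxE; ring. Qed.
Lemma det2Nr a b : det2 a (- b) = - det2 a b.
Proof. by rewrite /det2 !mxE; ring. Qed.
Lemma det2DR a b : det2 a (a + b) = det2 a b.
Proof. by rewrite /det2 !mxE; ring. Qed.
Lemma det2DL a b : det2 (a + b) b = det2 a b.
Proof. by rewrite /det2 !mxE; ring. Qed.

(* Euclid's algorithm: [cone_sum_rec n a b p q] is the sum of tau over the cones of a
   subdivision of the cone spanned by a and p a + q b into unimodular cones,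
   when n >= p + q. *)
Fixpoint cone_sum_rec (n : nat) (a b : pt) (p q : nat) : K :=
  if n is n'.+1 then
    if q == 0%N then 0 else if p == 0%N then tau a b else
    if (q <= p)%N then cone_sum_rec n' a (a + b) (p - q) q
    else tau a (a + b) + cone_sum_rec n' (a + b) b p (q - p)
  else 0.

Lemma cone_sum_fuel n m a b p q : (p + q <= n)%N -> (p + q <= m)%N ->
  cone_sum_rec n a b p q = cone_sum_rec m a b p q.
Proof.
elim: n m a b p q => [|n IHn] [|m] a b p q pn pm //=.
- by rewrite (_ : q == 0%N) //; lia.
- by rewrite (_ : q == 0%N) //; lia.
- case: eqP => // q0; case: eqP => // p0; case: leqP => pq.
    by apply: IHn; lia.
  by congr (_ + _); apply: IHn; lia.
Qed.

Definition cone_sum a b p q := cone_sum_rec (p + q) a b p q.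

Lemma cone_sum0r a b p : cone_sum a b p 0 = 0.
Proof. by rewrite /cone_sum addn0; case: p. Qed.
Lemma cone_sum0l a b q : (0 < q)%N -> cone_sum a b 0 q = tau a b.
Proof. by rewrite /cone_sum add0n; case: q. Qed.
Lemma cone_sum_left a b p q : (q <= p)%N -> cone_sum a b p q = cone_sum a (a + b) (p - q) q.
Proof.
have [->|q0] := eqVneq q 0%N; first by rewrite !cone_sum0r.
rewrite {1}/cone_sum => qp; case E: (p + q)%N => [|n] /=; first by lia.
rewrite (negbTE q0) ifN ?qp; last by lia.
by apply: cone_sum_fuel; lia.
Qed.
(** At p = q the recursion takes the other branch, but both give tau(a, a + b); at p = 0 this is
    [tau_split]. The overlap lets [cone_sum_diff] apply the same step to both directions. *)
Lemma cone_sum_right a b p q : det2 a b != 0 -> (p <= q)%N -> (0 < q)%N ->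
  cone_sum a b p q = tau a (a + b) + cone_sum (a + b) b p (q - p).
Proof.
move=> /det2_neq0[a0 b0 ab0] pq q0.
have [->|p0] := eqVneq p 0%N; first by rewrite subn0 !cone_sum0l // tau_split.
have [<-|npq] := eqVneq p q.
  by rewrite cone_sum_left // !subnn cone_sum0l ?cone_sum0r ?addr0 //; lia.
rewrite {1}/cone_sum; case E: (p + q)%N => [|n] /=; first by lia.
rewrite ifN ?(negbTE p0) ?ifN; try lia.
by congr (_ + _); apply: cone_sum_fuel; lia.
Qed.

(** Two directions of determinant 1 lie on the same side of a + b, unless they are a and b
    themselves. So both follow the same Euclidean steps until they become the basis of the current
    cone, whose tau is the difference. *)
Lemma cone_sum_diff a b p q r s : det2 a b != 0 -> (p * s = 1 + q * r)%N ->
  cone_sum a b r s - cone_sum a b p q = tau (a *+ p + b *+ q) (a *+ r + b *+ s).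
Proof.
have [N] := ubnP (p + q + r + s); elim: N => // N IHN in a b p q r s * => pN d pE.
have [[qp sr]|h1] : (q <= p /\ s <= r)%N \/ ~~ ((q <= p) && (s <= r))%N by lia.
  rewrite (cone_sum_left a b qp) (cone_sum_left a b sr) IHN; last 3 first.
  - by have : (0 < q + s)%N by [nia]; lia.
  - by rewrite det2DR.
  - nia.
  by congr tau; rewrite mulrnDl addrA -mulrnDr subnK.
have [[qp sr]|h2] : (p <= q /\ r <= s)%N \/ ~~ ((p <= q) && (r <= s))%N by lia.
  have p0 : (0 < p)%N by nia.
  have s0 : (0 < s)%N by nia.
  rewrite (cone_sum_right d qp) ?(cone_sum_right d sr) //; last by lia.
  rewrite opprD addrACA subrr add0r IHN; last 3 first.
  - by lia.
  - by rewrite det2DL.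
  - nia.
  by congr tau; rewrite mulrnDl -addrA -mulrnDr subnKC.
have [-> [-> [-> ->]]] : p = 1%N /\ q = 0%N /\ r = 0%N /\ s = 1%N by nia.
by rewrite cone_sum0r cone_sum0l // subr0 !mulr0n addr0 add0r !mulr1n.
Qed.

Lemma cone_sum_homog a b k p q : det2 a b != 0 -> (0 < k)%N ->
  cone_sum a b (k * p) (k * q) = cone_sum a b p q.
Proof.
have [N] := ubnP (p + q); elim: N => // N IHN in a b p q * => pN d k0.
have [->|q0] := eqVneq q 0%N; first by rewrite muln0 !cone_sum0r.
have [->|p0] := eqVneq p 0%N; first by rewrite muln0 !cone_sum0l //; nia.
have [qp|pq] := leqP q p.
  rewrite [RHS]cone_sum_left // cone_sum_left ?leq_mul2l ?qp ?orbT // -mulnBr IHN ?det2DR //; lia.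
have kpq : (k * p <= k * q)%N by rewrite leq_mul2l ltnW ?orbT.
have kq0 : (0 < k * q)%N by rewrite muln_gt0 k0 lt0n.
rewrite (cone_sum_right d kpq kq0) (cone_sum_right d (ltnW pq)) ?lt0n //.
by rewrite -mulnBr IHN ?det2DL //; lia.
Qed.

Let e1 := vec 1 0.
Let e2 := vec 0 1.

(* The two branches are the lines in the cones spanned by e1, e2 and by e2, -e1. *)
Definition pot (v : pt) : K :=
  if 0 <= v 0 0 * v 1 0 then cone_sum e1 e2 `|v 0 0| `|v 1 0|
  else tau e1 e2 + cone_sum e2 (- e1) `|v 1 0| `|v 0 0|.

Lemma potN v : pot (- v) = pot v.
Proof. by rewrite /pot !mxE mulrNN !abszN. Qed.

Lemma pot_pos (p q : nat) : pot (vec p q) = cone_sum e1 e2 p q.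
Proof. by rewrite /pot vec0 vec1 -PoszM !absz_nat. Qed.

Lemma pot_neg (p q : nat) : (0 < p + q)%N ->
  pot (vec (- p%:Z) q) = tau e1 e2 + cone_sum e2 (- e1) q p.
Proof.
move=> pq0; rewrite /pot vec0 vec1 abszN !absz_nat.
case: ifP => // pq.
(* On the axes both branches of [pot] apply and agree; for q = 0 this is tau(e2, -e1) = - tau(e1,
   e2), which closes h up after half a turn. *)
have [p0|q0] : p = 0%N \/ q = 0%N by nia.
  by rewrite p0 cone_sum0r cone_sum0l ?addr0 //; lia.
by rewrite q0 cone_sum0r cone_sum0l ?tauN 1?[tau e2 _]tauC ?subrr //; lia.
Qed.

Definition hdiff u w := pot w - pot u = (det2 u w)%:~R * tau u w.

Lemma hdiffC u w : hdiff u w -> hdiff w u.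
Proof.
rewrite /hdiff -opprB => E; rewrite -[LHS]opprK E tauC -mulNr -rmorphN /=.
by congr (_%:~R * _); rewrite /det2; ring.
Qed.
Lemma hdiffN u w : hdiff u w -> hdiff (- u) w.
Proof.
rewrite /hdiff potN => ->; rewrite tauNl mulrN -mulNr -rmorphN /=.
by congr (_%:~R * _); rewrite /det2 !mxE; ring.
Qed.
Lemma hdiffNr u w : hdiff u w -> hdiff u (- w).
Proof. by move=> /hdiffC /hdiffN /hdiffC. Qed.

Lemma hdiff_pos (p q r s : nat) :
  (p * s = 1 + q * r)%N -> hdiff (vec p q) (vec r s).
Proof.
move=> pE; rewrite /hdiff !pot_pos cone_sum_diff //; last by rewrite /det2 !vec0 !vec1.
have -> : det2 (vec p q) (vec r s) = 1 by rewrite /det2 !vec0 !vec1; lia.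
rewrite mul1r; congr tau; apply: ptP; rewrite ?vec0 ?vec1 !mxE /= ?vec0 ?vec1;
  rewrite ?mulmxnE ?mxE /=; lia.
Qed.

Lemma hdiff_neg (p q r s : nat) :
  (q * r = 1 + p * s)%N -> hdiff (vec (- p%:Z) q) (vec (- r%:Z) s).
Proof.
move=> pE; have pq : (0 < p + q)%N by nia. have rs : (0 < r + s)%N by nia.
rewrite /hdiff !pot_neg // opprD addrACA subrr add0r cone_sum_diff //; last by rewrite /det2 !mxE.
have -> : det2 (vec (- p%:Z) q) (vec (- r%:Z) s) = 1 by rewrite /det2 !vec0 !vec1; lia.
rewrite mul1r; congr tau; apply: ptP; rewrite ?vec0 ?vec1 !mxE /= ?vec0 ?vec1;
  rewrite ?mulmxnE ?mxE /=; lia.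
Qed.

Lemma quadrant (v : pt) : exists p q : nat, exists2 w : pt,
  w = vec p q \/ w = vec (- p%:Z) q & v = w \/ v = - w.
Proof.
rewrite (vecE v); exists (absz (v 0 0)), (absz (v 1 0)).
have [h|h] : 0 <= v 0 0 * v 1 0 \/ v 0 0 * v 1 0 < 0.
- by case: (ltP (v 0 0 * v 1 0) 0); [right|left].
- exists (vec (absz (v 0 0)) (absz (v 1 0))); first by left.
  have [[? ?]|[? ?]] : (0 <= v 0 0 /\ 0 <= v 1 0) \/ (v 0 0 <= 0 /\ v 1 0 <= 0) by nia.
    by left; rewrite !gez0_abs.
  by right; rewrite vecN !lez0_abs ?opprK.
exists (vec (- (absz (v 0 0))%:Z) (absz (v 1 0))); first by right.
have [[? ?]|[? ?]] : (v 0 0 <= 0 /\ 0 <= v 1 0) \/ (0 <= v 0 0 /\ v 1 0 <= 0) by nia.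
  by left; rewrite lez0_abs // gez0_abs // opprK.
by right; rewrite vecN gez0_abs // lez0_abs // !opprK.
Qed.

(** Up to sign, u and w lie in the first two quadrants. If these differ, the determinant is a sum of
    two nonnegative products equal to 1, which puts u or w on a coordinate axis and hence, up to
    sign, in the quadrant of the other. *)
Lemma pot_diff u w : `|det2 u w| = 1 :> int -> hdiff u w.
Proof.
have mixed (p q r s : nat) : `|det2 (vec p q) (vec (- r%:Z) s)| = 1 :> int ->
    hdiff (vec p q) (vec (- r%:Z) s).
  rewrite {1}/det2 !vec0 !vec1 => d.
  have [[p1 [s1 r0]]|[[p1 [s1 q0]]|[[q1 [r1 p0]]|[q1 [r1 s0]]]]] :
    (p = 1 /\ s = 1 /\ r = 0)%N \/ (p = 1 /\ s = 1 /\ q = 0)%N \/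
    (q = 1 /\ r = 1 /\ p = 0)%N \/ (q = 1 /\ r = 1 /\ s = 0)%N.
  - have : (p * s + q * r = 1)%N by lia.
    by move: p q r s {d} => [|[|p]] [|[|q]] [|[|r]] [|[|s]]; nia.
  - by rewrite r0 oppr0; apply: hdiff_pos; lia.
  - rewrite q0 -[vec p 0]opprK vecN oppr0; apply: hdiffN; apply: hdiffC.
    by apply: hdiff_neg; lia.
  - by rewrite p0; apply: (@hdiff_neg 0); lia.
  - rewrite s0 -[vec (- r%:Z) 0]opprK vecN opprK oppr0; apply: hdiffNr.
    by apply: hdiffC; apply: hdiff_pos; lia.
have [p [q [u' u'E uE]]] := quadrant u; have [r [s [w' w'E wE]]] := quadrant w.
move=> d; have {}d : `|det2 u' w'| = 1 :> int.
  by rewrite -d; case: uE => ->; case: wE => ->; rewrite ?det2N ?det2Nr ?opprK ?normrN.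
suff hd : hdiff u' w'.
  case: uE => ->; case: wE => -> //; first exact: hdiffNr.
    exact: hdiffN.
  by apply: hdiffN; apply: hdiffNr.
case: u'E d => ->; case: w'E => -> d; move: (d); rewrite {1}/det2 !vec0 !vec1 => d'.
- have [h|h] : (p * s = 1 + q * r)%N \/ (r * q = 1 + s * p)%N by lia.
    exact: hdiff_pos.
  by apply: hdiffC; apply: hdiff_pos.
- exact: mixed.
- apply: hdiffC; apply: mixed; rewrite -d /det2 !vec0 !vec1; lia.
- have [h|h] : (q * r = 1 + p * s)%N \/ (s * p = 1 + r * q)%N by lia.
    exact: hdiff_neg.
  by apply: hdiffC; apply: hdiff_neg.
Qed.
Lemma pot_homog k a b : k != 0 -> pot (vec (k * a) (k * b)) = pot (vec a b).
Proof.
move=> k0; rewrite /pot !vec0 !vec1 mulrACA !abszM.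
have k0' : (0 < `|k|)%N by rewrite absz_gt0.
have d1 : det2 e1 e2 != 0 by rewrite /det2 !vec0 !vec1.
have d2 : det2 e2 (- e1) != 0 by rewrite /det2 !mxE.
have -> : (0 <= k * k * (a * b)) = (0 <= a * b).
  by rewrite pmulr_rge0 // -expr2 exprn_even_gt0.
by case: ifP => _; rewrite cone_sum_homog.
Qed.

Lemma pot_parallel u w : u != 0 -> w != 0 -> det2 u w = 0 -> pot u = pot w.
Proof.
rewrite (vecE u) (vecE w) /det2 !vec0 !vec1.
move: (u 0 0) (u 1 0) (w 0 0) (w 1 0) => a b c d ab cd D.
have [a0|a0] := eqVneq a 0.
  have b0 : b != 0 by apply: contraNneq ab => ->; rewrite a0; apply/eqP/ptP; rewrite !mxE.
  have c0 : c = 0 by apply/eqP; move/eqP: D; rewrite a0 mul0r sub0r oppr_eq0 mulf_eq0 (negbTE b0).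
  have d0 : d != 0 by apply: contraNneq cd => ->; rewrite c0; apply/eqP/ptP; rewrite !mxE.
  by rewrite -(pot_homog a b d0) -[RHS](pot_homog c d b0) a0 c0 !mulr0 mulrC.
have c0 : c != 0.
  apply: contraNneq cd => c0; move/eqP: D; rewrite c0 mulr0 subr0 mulf_eq0 (negbTE a0) /=.
  by move=> /eqP ->; apply/eqP/ptP; rewrite !mxE.
rewrite -(pot_homog a b c0) -[RHS](pot_homog c d a0); congr (pot (vec _ _)).
  exact: mulrC.
by move: D; lia.
Qed.

Definition edge_pot (p q : pt) : K := (exF q - exF p) * pot (q - p).
Definition tri_pot (a b c : pt) : K := edge_pot a b + edge_pot b c + edge_pot c a.

Lemma edge_pot_anti p q : edge_pot q p = - edge_pot p q.
Proof. by rewrite /edge_pot -[p - q]opprB potN -mulNr opprB. Qed.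
Lemma edge_pot_refl p : edge_pot p p = 0.
Proof. by rewrite /edge_pot subrr mul0r. Qed.

Lemma tri_pot_split a b c p : tri_pot a b c = tri_pot a b p + tri_pot b c p + tri_pot c a p.
Proof.
rewrite /tri_pot (edge_pot_anti a p) (edge_pot_anti b p) (edge_pot_anti c p).
move: (edge_pot a b) (edge_pot b c) (edge_pot c a) (edge_pot a p) (edge_pot b p) (edge_pot c p) => x y z s t r; exact: sum_split.
Qed.

(** The edges share a direction, hence a factor h, and the differences of exponentials telescope. *)
Lemma tri_pot_collinear a b c : det2 (b - a) (c - a) = 0 -> tri_pot a b c = 0.
Proof.
move=> d; rewrite /tri_pot.
have [->|ab] := eqVneq b a; first by rewrite edge_pot_refl add0r (edge_pot_anti a c) subrr.
have [->|ac] := eqVneq c a; first by rewrite edge_pot_refl addr0 (edge_pot_anti a b) subrr.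
have [->|bc] := eqVneq c b; first by rewrite edge_pot_refl addr0 (edge_pot_anti a b) subrr.
have E1 : pot (c - b) = pot (b - a).
  apply: pot_parallel; rewrite ?subr_eq0 //.
  by rewrite -oppr0 -d /det2 !mxE; ring.
have E2 : pot (a - c) = pot (b - a).
  apply: pot_parallel; rewrite ?subr_eq0 // 1?eq_sym //.
  by rewrite -d /det2 !mxE; ring.
rewrite /edge_pot E1 E2.
move: (exF a) (exF b) (exF c) (pot _) => x y z s; exact: cycle_sum.
Qed.

Lemma exFD u w : exF (u + w) = exF u * exF w.
Proof. by rewrite /exF linD exD // tofracM. Qed.

(** The edge directions u, w - u, w have pairwise determinants 1 or -1, so [pot_diff] reduces the
    sum to the formula defining f2. The factor [det2 u w] records the orientation. *)
Lemma tri_pot_unimodular a u w : `|det2 u w| = 1 :> int ->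
  tri_pot a (a + u) (a + w) = ((ex (lin a) * f2@[u, w]) *~ det2 u w)%:F.
Proof.
move=> d1.
have d0 : det2 u w != 0 by apply/eqP => d0; move: d1; rewrite d0.
have [u0 w0 _] := det2_neq0 d0.
have wu0 : w - u != 0.
  by apply: contraNneq d0 => /eqP; rewrite subr_eq0 => /eqP ->; rewrite /det2 mulrC subrr.
have d' : det2 (w - u) w = - det2 u w by rewrite /det2 !mxE; ring.
have := pot_diff d1; rewrite /hdiff => h1.
have : hdiff (w - u) w by apply: pot_diff; rewrite d' normrN.
rewrite /hdiff d' => h2.
rewrite /tri_pot /edge_pot [a + u - a]addrAC subrr add0r.
have -> : a + w - (a + u) = w - u by rewrite opprD addrACA subrr add0r.
have -> : a - (a + w) = - w by rewrite opprD addrA subrr add0r.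
rewrite potN !exFD rmorphMz /= tofracM -/(exF a).
have := congr1 (@FracField.tofrac _) (f2_subM f2E u w).
rewrite tofracB !tofracM !tofracB tofrac1 -/(linF _) -/(linF _) -/(linF _).
rewrite -/(exF w) -/(exF u).
rewrite /tau in h1 h2.
have L1 : linF u != 0 by rewrite linF_eq0.
have L2 : linF w != 0 by rewrite linF_eq0.
have L3 : linF (w - u) != 0 by rewrite linF_eq0.
move=> E; rewrite -[RHS]mulrzr; rewrite rmorphN /= in h2.
move: h1 h2 L1 L2 L3 E; exact: triangle_identity.
Qed.

End Cocycle.

Lemma opp_cycle (F : comNzRingType) (x y z : F) : - z - y - x = - (x + y + z).
Proof. by ring. Qed.

Lemma base_change (F : comNzRingType) (x y z s t r : F) :
  x + y + z = s + y - t + (r + t + z - (r + s - x)).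
Proof. by ring. Qed.

Lemma detM2 (M : 'M[int]_2) : \det M = M 0 0 * M 1 1 - M 0 1 * M 1 0.
Proof.
rewrite (expand_det_row _ 0) big_ord_recl big_ord1 /cofactor !det_mx11 !mxE /=.
rewrite expr0 expr1 mul1r mulN1r mulrN.
by congr (_ * M _ _ - M _ _ * M _ _); apply/val_inj.
Qed.

Lemma mulmx2_0 (M : 'M[int]_2) (v : pt) : (M *m v) 0 0 = M 0 0 * v 0 0 + M 0 1 * v 1 0.
Proof. by rewrite mulmx2E vec0 !mxE. Qed.
Lemma mulmx2_1 (M : 'M[int]_2) (v : pt) : (M *m v) 1 0 = M 1 0 * v 0 0 + M 1 1 * v 1 0.
Proof. by rewrite mulmx2E vec1 !mxE. Qed.

Lemma det2_mulmx (M : 'M[int]_2) (u w : pt) : det2 (M *m u) (M *m w) = \det M * det2 u w.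
Proof. by rewrite /det2 !mulmx2_0 !mulmx2_1 detM2; ring. Qed.

Lemma unitmx_det (M : 'M[int]_2) : M \in unitmx -> \det M = 1 \/ \det M = -1.
Proof.
by rewrite unitmxE => /orP[] /eqP; [left|right].
Qed.

Lemma det2C u w : det2 w u = - det2 u w.
Proof. by rewrite /det2; ring. Qed.
Lemma det2xx u : det2 u u = 0.
Proof. by rewrite /det2 mulrC subrr. Qed.
Lemma det2Dr u v w : det2 u (v + w) = det2 u v + det2 u w.
Proof. by rewrite /det2 !mxE; ring. Qed.
Lemma det2Dl u v w : det2 (v + w) u = det2 v u + det2 w u.
Proof. by rewrite /det2 !mxE; ring. Qed.
Lemma det2Zr u c w : det2 u (c *: w) = c * det2 u w.
Proof. by rewrite /det2 !mxE; ring. Qed.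
Lemma det2Zl u c w : det2 (c *: u) w = c * det2 u w.
Proof. by rewrite /det2 !mxE; ring. Qed.

(* z + a is a lattice point of the triangle (a, a + u, a + w) other than its
   vertices, so that it cuts the triangle into smaller or degenerate ones. *)
Lemma triangle_lattice_point u w : 1 < `|det2 u w| ->
  exists z, [/\ `|det2 u z| < `|det2 u w|, `|det2 z w| < `|det2 u w|
              & `|det2 (w - u) (z - u)| < `|det2 u w|].
Proof.
wlog d0 : u w / 0 < det2 u w.
  move=> th d1; have [d0|d0] := ltP 0 (det2 u w); first exact: th.
  have d0' : 0 < det2 w u by rewrite det2C; lia.
  have d1' : 1 < `|det2 w u| by rewrite det2C normrN.
  have [z [z1 z2 z3]] := th w u d0' d1'.
  exists z; split.
  - by move: z2; rewrite (det2C u z) (det2C u w) !normrN.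
  - by move: z1; rewrite (det2C z w) (det2C u w) !normrN.
  - have -> : det2 (w - u) (z - u) = - det2 (u - w) (z - w).
      by rewrite !(det2Dr, det2Dl, det2N, det2Nr) !det2xx (det2C u w); ring.
    by move: z3; rewrite (det2C u w) !normrN.
set d := det2 u w in d0 *; rewrite gtr0_norm // => d1.
suff [z [i0 id j0 jd ij]] : exists z, [/\ 0 <= det2 z w, det2 z w < d,
    0 <= det2 u z, det2 u z < d & 0 < det2 z w + det2 u z].
  have E x : det2 (w - u) (x - u) = d - det2 x w - det2 u x.
    by rewrite !(det2Dr, det2Dl, det2N, det2Nr) !det2xx (det2C u w) (det2C x w) -/d; ring.
  (* A point of the half-open parallelogram beyond the diagonal from u to w is reflected in the
     centre of the parallelogram. *)
  have [h|h] := leP (det2 z w + det2 u z) d; [exists z|exists (u + w - z)].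
    by rewrite E; split; lia.
  by rewrite E !(det2Dr, det2Dl, det2N, det2Nr) !det2xx -/d; split; lia.
(* Subtracting integer multiples of u and w reduces both coordinates, scaled by d, modulo d. *)
have red x : exists z, det2 z w = (det2 x w %% d)%Z /\ det2 u z = (det2 u x %% d)%Z.
  exists (x - (det2 x w %/ d)%Z *: u - (det2 u x %/ d)%Z *: w).
  rewrite !(det2Dr, det2Dl, det2N, det2Nr) !(det2Zr, det2Zl) !det2xx -/d.
  rewrite !mulr0 !subr0; split; apply/eqP; rewrite subr_eq addrC; exact/eqP/divz_eq.
have dn0 : d != 0 by lia.
suff [x xd] : exists x, ((det2 x w %% d)%Z != 0) || ((det2 u x %% d)%Z != 0).
  have [z [z1 z2]] := red x; exists z; rewrite z1 z2 !modz_ge0 // !ltz_pmod //.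
  by split=> //; have := modz_ge0 (det2 x w) dn0; have := modz_ge0 (det2 u x) dn0; lia.
(* Otherwise d divides the scaled coordinates of both standard basis vectors, and by [dE] its square
   divides d, against d > 1. *)
apply/not_existsP => h.
have {}h x : ((det2 x w %% d)%Z == 0) && ((det2 u x %% d)%Z == 0).
  by rewrite -[_ && _]negbK negb_and; apply/negP/h.
have /andP[/eqP a1 /eqP a2] := h (vec 1 0).
have /andP[/eqP a3 /eqP a4] := h (vec 0 1).
have dE : d = det2 (vec 1 0) w * det2 u (vec 0 1) - det2 (vec 0 1) w * det2 u (vec 1 0).
  by rewrite /d /det2 !vec0 !vec1; ring.
have b1 := divz_eq (det2 (vec 1 0) w) d; rewrite a1 addr0 in b1.
have b2 := divz_eq (det2 u (vec 1 0)) d; rewrite a2 addr0 in b2.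
have b3 := divz_eq (det2 (vec 0 1) w) d; rewrite a3 addr0 in b3.
have b4 := divz_eq (det2 u (vec 0 1)) d; rewrite a4 addr0 in b4.
move: dE; rewrite b1 b2 b3 b4.
move: (_ %/ _)%Z (_ %/ _)%Z (_ %/ _)%Z (_ %/ _)%Z => x y z t dE.
have : d * (d * (t * z - y * x) - 1) = 0.
  have -> : d * (d * (t * z - y * x) - 1) = t * d * (z * d) - y * d * (x * d) - d by ring.
  by rewrite -dE subrr.
move=> /eqP; rewrite mulf_eq0 (negbTE dn0) /= subr_eq0 => /eqP.
by move: (t * z - y * x) => k dk; have [k0|k0] := leP k 0; nia.
Qed.

(** * The affine group acting on points and on series *)

Definition aff (M : 'M[int]_2) (t v : pt) : pt := M *m v + t.

Lemma affB M t u v : aff M t u - aff M t v = M *m (u - v).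
Proof. by rewrite /aff mulmxBr opprD addrACA subrr addr0. Qed.

Lemma affine_actD M t f g :
  affine_act M t (f + g) = affine_act M t f + affine_act M t g.
Proof. by rewrite !affine_actE sub2D mulrDr. Qed.
Lemma affine_act0 M t : affine_act M t 0 = 0.
Proof. by rewrite affine_actE sub2_0 mulr0. Qed.
Lemma affine_actB M t f g :
  affine_act M t (f - g) = affine_act M t f - affine_act M t g.
Proof. by rewrite !affine_actE sub2B mulrBr. Qed.
Lemma affine_actN M t f : affine_act M t (- f) = - affine_act M t f.
Proof. by rewrite !affine_actE sub2N mulrN. Qed.
Lemma affine_actMz M t f z : affine_act M t (f *~ z) = affine_act M t f *~ z.
Proof. by rewrite !affine_actE sub2Mz // mulrzAr. Qed.
Lemma affine_act_cst M t c f : affine_act M t (cst c * f) = cst c * affine_act M t f.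
Proof. by rewrite !affine_actE sub2M // sub2_cst // mulrCA. Qed.

Lemma affine_act_ex M t a : affine_act M t (ex (lin a)) = ex (lin (aff M t a)).
Proof.
by rewrite affine_actE sub2_ex // sub2_lin -mulmx2E /aff linD addrC exD.
Qed.

Lemma affine_act_form M t a f u w :
  affine_act M t (ex (lin a) * f@[u, w]) =
  ex (lin (aff M t a)) * f@[M *m u, M *m w].
Proof.
rewrite -affine_act_ex !affine_actE sub2M // sub2_comp // !sub2_lin -!mulmx2E.
by rewrite mulrA.
Qed.

(** * The power series of a lattice triangle *)

Section TriangleCochain.
Variables rho f2 : Qxy.
Hypotheses (rhoD4 : D4_invariant rho) (rhoE : rho_equation rho).
Hypothesis f2E : is_f2 rho f2.
Local Notation "x %:F" := (@FracField.tofrac (fps (fps rat)) x).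
Local Notation tri_pot := (tri_pot rho).

Lemma tofrac_inj (f g : Qxy) : f%:F = g%:F -> f = g.
Proof. by move/eqP; rewrite tofrac_eq => /eqP. Qed.

Lemma tri_pot_integral a b c : exists d : Qxy, d%:F = tri_pot a b c /\
  forall M t, M \in unitmx ->
    (affine_act M t d *~ \det M)%:F = tri_pot (aff M t a) (aff M t b) (aff M t c).
Proof.
have [n] := ubnP (absz (det2 (b - a) (c - a))); elim: n => // n IHn in a b c * => dn.
have [d0|d0] := eqVneq (det2 (b - a) (c - a)) 0.
  exists 0; rewrite (tri_pot_collinear rhoD4 rhoE d0) tofrac0; split=> // M t _.
  rewrite tri_pot_collinear //; first by rewrite affine_act0 mul0rz tofrac0.
  by rewrite !affB det2_mulmx d0 mulr0.
have [d1|d1] := eqVneq `|det2 (b - a) (c - a)| 1.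
  exists ((ex (lin a) * f2@[b - a, c - a]) *~ det2 (b - a) (c - a)); split.
    by rewrite -(tri_pot_unimodular rhoD4 rhoE f2E) // !(addrC a) !subrK.
  move=> M t uM; rewrite affine_actMz -mulrzA [_ * \det M]mulrC -det2_mulmx affine_act_form -!(affB M t).
  rewrite -(tri_pot_unimodular rhoD4 rhoE f2E) ?(addrC (aff M t a)) ?subrK //.
  by rewrite !affB det2_mulmx normrM d1 mulr1; case: (unitmx_det uM) => ->.
have [|z [z1 z2 z3]] := @triangle_lattice_point (b - a) (c - a); first by lia.
pose p := a + z.
have pa : p - a = z by rewrite /p addrC addKr.
have E1 : det2 (b - a) (p - a) = det2 (b - a) z by rewrite pa.
have E2 : det2 (c - b) (p - b) = det2 (c - a - (b - a)) (z - (b - a)).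
  by rewrite /p !opprB; congr det2; apply/matrixP => i j; rewrite !mxE; ring.
have E3 : det2 (a - c) (p - c) = det2 z (c - a).
  by rewrite /p /det2 !mxE; ring.
have [|x [xE xM]] := IHn a b p; first by rewrite E1; lia.
have [|y [yE yM]] := IHn b c p; first by rewrite E2; lia.
have [|s [sE sM]] := IHn c a p; first by rewrite E3; lia.
exists (x + y + s); split; first by rewrite !tofracD xE yE sE -tri_pot_split.
move=> M t uM; rewrite !affine_actD !mulrzDl !tofracD xM // yM // sM //.
by rewrite -tri_pot_split.
Qed.

Definition tri (a b c : pt) : Qxy := xget 0 [set d : Qxy | d%:F = tri_pot a b c].

Lemma triE a b c : (tri a b c)%:F = tri_pot a b c.
Proof.
by apply: (@xgetPex _ 0 [set d : Qxy | d%:F = tri_pot a b c]); have [d [dE _]] := tri_pot_integral a b c; exists d.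
Qed.

Lemma tri_equivariant M t a b c : M \in unitmx ->
  tri (aff M t a) (aff M t b) (aff M t c) = affine_act M t (tri a b c) *~ \det M.
Proof.
move=> uM; apply: tofrac_inj; rewrite triE.
have [d [dE dM]] := tri_pot_integral a b c.
by rewrite -dM // (_ : d = tri a b c) //; apply: tofrac_inj; rewrite triE.
Qed.

Lemma tri_anti a b c : tri a c b = - tri a b c.
Proof.
apply: tofrac_inj; rewrite tofracN !triE /tri_pot (edge_pot_anti rho a b) (edge_pot_anti rho b c) (edge_pot_anti rho c a).
move: (edge_pot rho a b) (edge_pot rho b c) (edge_pot rho c a) => x y z; exact: opp_cycle.
Qed.

Lemma tri_refl a b : tri a a b = 0.
Proof.
by apply: tofrac_inj; rewrite tofrac0 triE /tri_pot edge_pot_refl add0r (edge_pot_anti rho a b) subrr.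
Qed.

(** A change of base point alters the series by a difference phi(b) - phi(a), which [edge_balance]
    sums to 0 over the edges of a polygon. *)
Lemma tri_base o o' a b :
  tri o a b = tri o' a b + (tri o o' b - tri o o' a).
Proof.
apply: tofrac_inj; rewrite tofracD tofracB !triE /tri_pot.
rewrite (edge_pot_anti rho o a) (edge_pot_anti rho o' b).
move: (edge_pot rho o a) (edge_pot rho a b) (edge_pot rho b o) (edge_pot rho o' a) (edge_pot rho o' b) (edge_pot rho o o').
by move=> x y z s t r; exact: base_change.
Qed.

Lemma tri_T : tri 0 (vec 1 0) (vec 0 1) = f2.
Proof.
apply: tofrac_inj; rewrite triE.
have := tri_pot_unimodular rhoD4 rhoE f2E 0 (u := vec 1 0) (w := vec 0 1).
have -> : det2 (vec 1 0) (vec 0 1) = 1 by rewrite /det2 !vec0 !vec1.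
rewrite !add0r lin0 ex0 mul1r mulr1z -vx_lin -vy_lin sub2_id => -> //.
Qed.
End TriangleCochain.

(** * Sums over finite sets *)

Section SetSum.
Variable V : zmodType.

Definition fin_set (I : choiceType) (A : set I) := exists r : seq I, forall i, A i -> i \in r.

(** An infinite set has no enumeration, so the default gives the empty sum 0. *)
Definition ssum (I : choiceType) (A : set I) (F : I -> V) : V :=
  \sum_(i <- xget [::] [set r | uniq r /\ forall i, (i \in r) <-> A i]) F i.

Lemma ssumE (I : choiceType) (A : set I) F (r : seq I) :
  uniq r -> (forall i, (i \in r) <-> A i) -> ssum A F = \sum_(i <- r) F i.
Proof.
move=> ur rA; apply: perm_big.
have [us sA] := @xgetI _ [::] [set r | uniq r /\ forall i, (i \in r) <-> A i] r (conj ur rA).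
by apply: uniq_perm => // i; apply/idP/idP; rewrite sA rA.
Qed.

Lemma fin_setP (I : choiceType) (A : set I) :
  fin_set A -> exists2 r, uniq r & forall i, (i \in r) <-> A i.
Proof.
move=> [r rA]; exists (undup [seq i <- r | `[< A i >]]); first exact: undup_uniq.
move=> i; rewrite mem_undup mem_filter; split=> [/andP[/asboolP//]|Ai].
by rewrite rA // andbT; apply/asboolP.
Qed.

Lemma sub_fin_set (I : choiceType) (A B : set I) : A `<=` B -> fin_set B -> fin_set A.
Proof. by move=> AB [r rB]; exists r => i /AB /rB. Qed.

Lemma fin_setU (I : choiceType) (A B : set I) : fin_set A -> fin_set B -> fin_set (A `|` B).
Proof.
move=> [r rA] [s sB]; exists (r ++ s) => i; rewrite mem_cat.
by case=> [/rA ->|/sB ->] //; rewrite orbT.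
Qed.

Lemma ssum_mulrn (I : choiceType) (A : set I) F (r : seq I) :
  uniq r -> (forall i, A i -> i \in r) ->
  ssum A F = \sum_(i <- r) F i *+ `[< A i >].
Proof.
move=> ur rA; rewrite (@ssumE _ _ _ [seq i <- r | `[< A i >]]); first last.
- move=> i; rewrite mem_filter; split=> [/andP[/asboolP//]|Ai].
  by rewrite rA // andbT; apply/asboolP.
- exact: filter_uniq.
rewrite big_filter big_mkcond; apply: eq_bigr => i _.
by case: asboolP => _; rewrite ?mulr1n ?mulr0n.
Qed.

(** Reduces the valuation property to inclusion-exclusion for the indicators of one lattice point or
    one edge. *)
Lemma ssum_modular (I : choiceType) (A B C D : set I) F :
  fin_set A -> fin_set B -> fin_set C -> fin_set D ->
  (forall i, (`[< A i >] + `[< B i >] = `[< C i >] + `[< D i >])%N) ->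
  ssum A F + ssum B F = ssum C F + ssum D F.
Proof.
move=> fA fB fC fD ABCD.
have [r rE] := fin_setU (fin_setU fA fB) (fin_setU fC fD).
rewrite !(@ssum_mulrn _ _ F (undup r)) ?undup_uniq //; try by
  move=> i Xi; rewrite mem_undup rE; [|firstorder].
rewrite -!big_split; apply: eq_bigr => i _ /=.
by rewrite -!mulrnDr ABCD.
Qed.

Lemma eq_ssum (I : choiceType) (A : set I) F G :
  fin_set A -> (forall i, A i -> F i = G i) -> ssum A F = ssum A G.
Proof.
move=> /fin_setP[r ur rA] FG; rewrite !(ssumE _ ur rA).
by apply: eq_big_seq => i /rA /FG.
Qed.

Lemma ssumD (I : choiceType) (A : set I) F G :
  ssum A (fun i => F i + G i) = ssum A F + ssum A G.
Proof. exact: big_split. Qed.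

Lemma ssumB (I : choiceType) (A : set I) F G :
  ssum A (fun i => F i - G i) = ssum A F - ssum A G.
Proof. exact: sumrB. Qed.

Lemma ssum_bij (I J : choiceType) (A : set I) (B : set J) (h : I -> J) F :
  fin_set A -> injective h -> (forall i, B (h i) <-> A i) ->
  (forall j, B j -> exists i, j = h i) ->
  ssum B F = ssum A (F \o h).
Proof.
move=> /fin_setP[r ur rA] hi BA Bh.
rewrite (ssumE _ ur rA) -(big_map h xpredT F); apply: ssumE.
  by rewrite map_inj_uniq.
move=> j; split=> [/mapP[i /rA ? ->]|Bj]; first exact/BA.
by have [i jE] := Bh j Bj; rewrite jE mem_map //; apply/rA/BA; rewrite -jE.
Qed.
End SetSum.

Lemma ssum_morph (V W : zmodType) (phi : V -> W) (I : choiceType) (A : set I) F :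
  {morph phi : x y / x + y} -> phi 0 = 0 ->
  phi (ssum A F) = ssum A (phi \o F).
Proof. by move=> phiD phi0; rewrite /ssum (big_morph phi phiD phi0). Qed.

(** * Lattice polygons *)

Section Plane.
Variable R : realType.
Local Notation plane := 'cV[R]_2.
Local Notation pl := (@to_plane R).
Local Notation hull := (@hull R).
Implicit Types (C P Q : set plane) (s : seq pt) (p q : plane).

Definition pvec (x y : R) : plane := \col_i (if i == 0 then x else y).
Lemma pvec0 x y : pvec x y 0 0 = x. Proof. by rewrite mxE. Qed.
Lemma pvec1 x y : pvec x y 1 0 = y. Proof. by rewrite mxE. Qed.
Lemma planeP p q : p 0 0 = q 0 0 -> p 1 0 = q 1 0 -> p = q.
Proof.
move=> e0 e1; apply/colP => i.
have : i = 0 \/ i = 1 by case: i => -[|[]] // h; [left|right]; apply/val_inj.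
by case=> ->.
Qed.

Lemma plE v i : pl v i 0 = (v i 0)%:~R. Proof. by rewrite mxE. Qed.
Lemma plD u v : pl (u + v) = pl u + pl v.
Proof. by apply/matrixP => i j; rewrite !mxE rmorphD. Qed.
Lemma plN u : pl (- u) = - pl u.
Proof. by apply/matrixP => i j; rewrite !mxE rmorphN. Qed.
Lemma pl0 : pl 0 = 0.
Proof. by apply/matrixP => i j; rewrite !mxE. Qed.
Lemma pl_inj : injective pl.
Proof.
move=> u v uv; apply/matrixP => i j; have := congr1 (fun p : plane => p i j) uv.
by rewrite !mxE => /intr_inj.
Qed.

Definition mix (t : R) p q : plane := t *: p + (1 - t) *: q.
Definition cvx C := forall p q t, C p -> C q -> 0 <= t -> t <= 1 -> C (mix t p q).

Lemma mixE t p q i : mix t p q i 0 = t * p i 0 + (1 - t) * q i 0.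
Proof. by rewrite !mxE. Qed.

Lemma cvxP C : convex_set (C : set (convex_lmodType plane)) <-> cvx C.
Proof.
split=> [cC p q t Cp Cq t0 t1|cC p q t].
  have := cC p q (interval_inference.Itv01 t0 t1); rewrite !inE; exact.
by rewrite !inE => Cp Cq; apply: (cC p q (interval_inference.Itv.r t)) => //;
  [exact: interval_inference.ge0|exact: interval_inference.le1].
Qed.

Lemma cvx_hull s : cvx (hull s).
Proof.
move=> p q t hp hq t0 t1 C CP; have /cvxP cC := CP.1.
by apply: cC => //; [exact: hp|exact: hq].
Qed.

Lemma hull_sub s C : cvx C -> (forall v, v \in s -> C (pl v)) -> hull s `<=` C.
Proof.
move=> /cvxP cC sC; apply: smallest_sub => // p [v vs <-]; exact: sC.
Qed.

Lemma hull_mem s v : v \in s -> hull s (pl v).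
Proof. by move=> vs C [_ sC]; apply: sC; exists v. Qed.

Lemma hull_subset s s' : {subset s <= s'} -> hull s `<=` hull s'.
Proof. by move=> ss; apply: hull_sub => [|v /ss]; [exact: cvx_hull|exact: hull_mem]. Qed.

Lemma hull_sub_hull s s' : (forall v, v \in s -> hull s' (pl v)) -> hull s `<=` hull s'.
Proof. by apply: hull_sub; exact: cvx_hull. Qed.

Lemma hull_eq s s' : s =i s' -> hull s = hull s' :> set plane.
Proof.
by move=> ss; apply/seteqP; split; apply: hull_subset => v; rewrite ss.
Qed.

Lemma cvx_halfplane (a b c : R) : cvx [set p | c <= a * p 0 0 + b * p 1 0].
Proof.
move=> p q t /=; rewrite !mixE => hp hq t0 t1.
have -> : a * (t * p 0 0 + (1 - t) * q 0 0) + b * (t * p 1 0 + (1 - t) * q 1 0)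
  = t * (a * p 0 0 + b * p 1 0) + (1 - t) * (a * q 0 0 + b * q 1 0) by ring.
move: (_ + b * _) (_ + b * _) hp hq => x y hp hq; nra.
Qed.

Lemma hull_halfplane s a b c : (forall v, v \in s -> c <= a * pl v 0 0 + b * pl v 1 0) ->
  forall p, hull s p -> c <= a * p 0 0 + b * p 1 0.
Proof. by move=> h p; apply: (hull_sub (@cvx_halfplane a b c)). Qed.

Lemma hull_point v : hull [:: v] = [set pl v] :> set plane.
Proof.
apply/seteqP; split=> [|p ->]; last by apply: hull_mem; rewrite inE.
apply: hull_sub => [p q t -> -> _ _|w]; last by rewrite inE => /eqP ->.
by rewrite /mix -scalerDl addrC subrK scale1r.
Qed.

(** ** Closedness of polygons along lines *)

(** Provides the slope in [hull_seg_closed]. Either list may be empty, so the mean of a maximum and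
    a minimum need not make sense. *)
Lemma separate_seq (x y : seq R) : (forall a b, a \in x -> b \in y -> a < b) ->
  exists k, (forall a, a \in x -> a < k) /\ (forall b, b \in y -> k < b).
Proof.
elim: x => [|a x IHx] ab.
  elim: y {ab} => [|b y [k [_ ky]]]; first by exists 0.
  exists (Num.min k (b - 1)); split=> // c; rewrite inE => /predU1P[->|/ky cy].
    by rewrite gt_min ltrBlDr ltrDl ltr01 orbT.
  by rewrite gt_min cy.
have [|k [kx ky]] := IHx; first by move=> c b cx; apply: ab; rewrite inE cx orbT.
have {}ab b : b \in y -> a < b by apply: ab; rewrite inE eqxx.
have {ky} [k' [kx' ak' ky']] : exists k', [/\ k <= k', a < k' & forall b, b \in y -> k' < b].
  elim: y ky ab {IHx} => [|b y IHy] ky ab.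
    by exists (Num.max k (a + 1)); split; rewrite ?le_max ?lexx // lt_max ltrDl ltr01 orbT.
  have [||k' [kk' ak' ky']] := IHy.
  - by move=> c cy; apply: ky; rewrite inE cy orbT.
  - by move=> c cy; apply: ab; rewrite inE cy orbT.
  have kb : k < b by apply: ky; rewrite inE eqxx.
  have ab' : a < b by apply: ab; rewrite inE eqxx.
  have [bk'|bk'] := ltP k' b.
    by exists k'; split=> // c; rewrite inE => /predU1P[->|/ky'].
  exists ((Num.max k a + b) / 2); split.
  - have : k <= Num.max k a by rewrite le_max lexx.
    by have : Num.max k a < b by [rewrite gt_max kb]; lra.
  - have : a <= Num.max k a by rewrite le_max lexx orbT.
    by have : Num.max k a < b by [rewrite gt_max kb]; lra.
  - have kab : Num.max k a < b by rewrite gt_max kb.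
    move=> c; rewrite inE => /predU1P[->|/ky']; first by lra.
    by lra.
exists k'; split=> // c; rewrite inE => /predU1P[->//|/kx]; lra.
Qed.

(** Closedness along segments, the form in which the valuation property uses that polygons are
    closed. *)
Definition seg_closed C :=
  forall m q, (forall t, 0 < t -> t <= 1 -> C (mix t q m)) -> C m.

Lemma hull_seg_closed s : seg_closed (hull s).
Proof.
move=> m q hq.
have [->|qm] := eqVneq m q.
  by have := hq 1 ltr01 (lexx _); rewrite /mix subrr scale0r scale1r addr0.
(* With origin m, f and g are the coordinates along and across q - m, scaled by its length, and N is
   its squared length. A hull point on the line at or behind m would put m on a segment ending at
   q. *)
pose d0 := q 0 0 - m 0 0; pose d1 := q 1 0 - m 1 0.
pose f p := (d0 * (p 0 0 - m 0 0) + d1 * (p 1 0 - m 1 0)).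
pose g p := (d0 * (p 1 0 - m 1 0) - d1 * (p 0 0 - m 0 0)).
pose N := d0 ^+ 2 + d1 ^+ 2.
have N0 : 0 < N.
  rewrite lt0r addr_ge0 ?sqr_ge0 // andbT paddr_eq0 ?sqr_ge0 // !sqrf_eq0 !subr_eq0.
  apply/negP => /andP[/eqP e0 /eqP e1]; case/eqP: qm; exact: planeP.
have fq : f q = N by rewrite /f /N -/d0 -/d1 !expr2.
have gq : g q = 0 by rewrite /g -/d0 -/d1 mulrC subrr.
have fmix t p p' : f (mix t p p') = t * f p + (1 - t) * f p'.
  by rewrite /f !mixE; ring.
have gmix t p p' : g (mix t p p') = t * g p + (1 - t) * g p'.
  by rewrite /g !mixE; ring.
have fm : f m = 0 by rewrite /f !subrr !mulr0 addr0.
have gm : g m = 0 by rewrite /g !subrr !mulr0 subrr.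
have fgP p p' : f p = f p' -> g p = g p' -> p = p'.
  move=> ef eg.
  have e0 : N * (p 0 0 - p' 0 0) = 0.
    transitivity (d0 * (f p - f p') - d1 * (g p - g p')).
      by rewrite /f /g /N; ring.
    by rewrite ef eg !subrr !mulr0 subrr.
  have e1 : N * (p 1 0 - p' 1 0) = 0.
    transitivity (d1 * (f p - f p') + d0 * (g p - g p')).
      by rewrite /f /g /N; ring.
    by rewrite ef eg !subrr !mulr0 addr0.
  move/eqP: e0; rewrite mulf_eq0 (gt_eqF N0) subr_eq0 => /eqP e0.
  move/eqP: e1; rewrite mulf_eq0 (gt_eqF N0) subr_eq0 => /eqP e1.
  exact: planeP.
have hullq : hull s q.
  by have := hq 1 ltr01 (lexx _); rewrite /mix subrr scale0r scale1r addr0.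
have between z : hull s z -> g z = 0 -> f z <= 0 -> hull s m.
  move=> hz gz fz; pose t := N / (N - f z).
  have Nz : 0 < N - f z by lra.
  have t0 : 0 <= t by rewrite divr_ge0 // ltW.
  have t1 : t <= 1 by rewrite ler_pdivrMr // mul1r; lra.
  have -> : m = mix t z q.
    apply: fgP; rewrite ?fmix ?gmix ?fm ?gm ?gz ?gq ?mulr0 ?addr0 // fq /t.
    by field; rewrite gt_eqF.
  exact: cvx_hull.
have [[z [hz gz fz]]|nz] := pselect (exists z, [/\ hull s z, g z = 0 & f z <= 0]).
  exact: between hz gz fz.
(* Every point of the polygon on the line has f > 0. Then the slopes separate,
   so f + k g is positive at all points of s for some k, hence bounded below by
   some e > 0 on the hull, contradicting f -> 0 along the segment. *)
exfalso.
have {nz} nz z : hull s z -> g z = 0 -> 0 < f z.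
  by move=> hz gz; rewrite ltNge; apply/negP => fz; apply: nz; exists z.
have [|k [kx ky]] := @separate_seq [seq - f (pl v) / g (pl v) | v <- s & 0 < g (pl v)]
    [seq - f (pl v) / g (pl v) | v <- s & g (pl v) < 0].
  move=> a b /mapP[v]; rewrite mem_filter => /andP[gv vs] ->.
  move=> /mapP[w]; rewrite mem_filter => /andP[gw ws] ->.
  set x := pl v in gv *; set y := pl w in gw *.
  have gg : 0 < g x - g y by lra.
  (* The weight at which the segment between x and y meets the line g = 0. There f is positive by
     [nz], which is the inequality between the two slopes. *)
  pose t := - g y / (g x - g y).
  have t0 : 0 <= t by rewrite divr_ge0 //; lra.
  have t1 : t <= 1 by rewrite ler_pdivrMr // mul1r; lra.
  have := nz (mix t x y); rewrite fmix gmix.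
  have -> : t * g x + (1 - t) * g y = 0 by rewrite /t; field; rewrite gt_eqF.
  have -> : t * f x + (1 - t) * f y = (- g y * f x + g x * f y) / (g x - g y).
    by rewrite /t; field; rewrite gt_eqF.
  have hm : hull s (mix t x y) by apply: cvx_hull => //; exact: hull_mem.
  move=> /(_ hm erefl); rewrite pmulr_lgt0 ?invr_gt0 // => pos.
  rewrite -subr_gt0.
  have -> : - f y / g y - - f x / g x = (- g y * f x + g x * f y) / (g x * - g y).
    have gx0 : g x != 0 by rewrite gt_eqF.
    have gy0 : g y != 0 by rewrite lt_eqF.
    by field; rewrite gx0 gy0.
  by rewrite divr_gt0 // mulr_gt0 // oppr_gt0.
have pos v : v \in s -> 0 < f (pl v) + k * g (pl v).
  move=> vs; set x := pl v.
  have [gx|gx|gx] := ltgtP (g x) 0.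
  - have : k < - f x / g x by apply: ky; apply/mapP; exists v => //; rewrite mem_filter gx.
    by rewrite ltr_ndivlMr //; lra.
  - have : - f x / g x < k by apply: kx; apply/mapP; exists v => //; rewrite mem_filter gx.
    by rewrite ltr_pdivrMr //; lra.
  - by rewrite gx mulr0 addr0; apply: nz => //; exact: hull_mem.
have [e e0 eP] : exists2 e, 0 < e & forall v, v \in s -> e <= f (pl v) + k * g (pl v).
  elim: (s) pos => [|v s' IH] pos; first by exists 1.
  have [|e e0 eP] := IH; first by move=> w ws; apply: pos; rewrite inE ws orbT.
  exists (Num.min e (f (pl v) + k * g (pl v))).
    by rewrite lt_min e0 pos // inE eqxx.
  move=> w; rewrite inE => /predU1P[->|/eP ew]; first by rewrite ge_min lexx orbT.
  by rewrite ge_min ew.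
have epos p : hull s p -> e <= f p + k * g p.
  have cC : cvx [set p | e <= f p + k * g p].
    move=> x y t /=; rewrite fmix gmix => hx hy t0 t1.
    have -> : t * f x + (1 - t) * f y + k * (t * g x + (1 - t) * g y)
      = t * (f x + k * g x) + (1 - t) * (f y + k * g y) by ring.
    move: (f x + _) (f y + _) hx hy => a b ha hb; nra.
  by apply: (hull_sub cC).
(* At [mix t q m] the form f + k g equals t N, which is at most e / 2 for this t. *)
have t0 : 0 < Num.min 1 (e / (2 * N)).
  by rewrite lt_min ltr01 divr_gt0 // mulr_gt0.
have /epos : hull s (mix (Num.min 1 (e / (2 * N))) q m).
  by apply: hq => //; rewrite ge_min lexx.
rewrite fmix gmix fm gm fq gq !mulr0 !addr0 mulr0 addr0.
have : Num.min 1 (e / (2 * N)) <= e / (2 * N) by rewrite ge_min lexx orbT.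
move=> tN h; have : Num.min 1 (e / (2 * N)) * N <= e / (2 * N) * N.
  by rewrite ler_pM2r.
have -> : e / (2 * N) * N = e / 2 by field; rewrite gt_eqF.
lra.
Qed.

End Plane.

Implicit Types (u v w : pt).

(** * Primitive lattice vectors *)

Definition primitive (v : pt) : bool := coprimez (v 0 0) (v 1 0).

Lemma primitiveP v : reflect (exists x y, x * v 0 0 + y * v 1 0 = 1) (primitive v).
Proof.
apply: (iffP (coprimezP _ _)) => [[[x y] /= xy]|[x [y xy]]]; first by exists x, y.
by exists (x, y).
Qed.

Lemma primitive_neq0 v : primitive v -> v != 0.
Proof. by move=> /primitiveP[x [y]]; apply: contra_eq_neq => ->; rewrite !mxE !mulr0. Qed.

Lemma primitiveN v : primitive (- v) = primitive v.
Proof. by rewrite /primitive !mxE coprimezN coprimeNz. Qed.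

Lemma primitive_parallel v w : primitive v -> det2 v w = 0 -> exists k, w = k *: v.
Proof.
move=> /primitiveP[x [y xy]]; rewrite /det2 => d; exists (x * w 0 0 + y * w 1 0).
apply: ptP; rewrite !mxE.
  rewrite -[LHS]mul1r -xy.
  have -> : (x * w 0 0 + y * w 1 0) * v 0 0 = x * v 0 0 * w 0 0 + y * (v 0 0 * w 1 0) by ring.
  by move/eqP: d; rewrite subr_eq0 => /eqP ->; ring.
rewrite -[LHS]mul1r -xy.
have -> : (x * w 0 0 + y * w 1 0) * v 1 0 = x * (v 1 0 * w 0 0) + y * v 1 0 * w 1 0 by ring.
by move/eqP: d; rewrite subr_eq0 => /eqP <-; ring.
Qed.

Lemma primitive_parallel_eq v w :
  primitive v -> primitive w -> det2 v w = 0 -> w = v \/ w = - v.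
Proof.
move=> pv pw d; have [k wk] := primitive_parallel pv d.
move: pw => /primitiveP[x [y]]; rewrite wk !mxE => xy.
have : k * (x * v 0 0 + y * v 1 0) = 1 by rewrite -xy; ring.
move: (x * _ + _) => z kz.
have /orP[/eqP ->|/eqP ->] : k \is a GRing.unit by apply/unitrPr; exists z.
  by left; rewrite scale1r.
by right; rewrite scaleN1r.
Qed.

Lemma primitive_part v : v != 0 -> exists w (k : int), [/\ primitive w, 0 < k & v = k *: w].
Proof.
move=> v0; pose g := gcdz (v 0 0) (v 1 0).
have g0 : 0 < g.
  suff : g != 0 by rewrite lt0r => ->.
  rewrite gcdz_eq0; apply: contra v0 => /andP[/eqP e0 /eqP e1].
  by apply/eqP/ptP; rewrite mxE.
have /dvdzP[a aE] : (g %| (v 0 0)%R)%Z := dvdz_gcdl _ _.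
have /dvdzP[b bE] : (g %| (v 1 0)%R)%Z := dvdz_gcdr _ _.
exists (vec a b), g; split=> //; last by apply: ptP; rewrite !mxE /= mulrC.
apply/primitiveP; rewrite !vec0 !vec1.
have [x [y xy]] := Bezoutz (v 0 0) (v 1 0); exists x, y.
move: xy; rewrite -/g {1}aE {1}bE => xy.
have /eqP : g * (x * a + y * b - 1) = 0 by rewrite mulrBr mulr1 -{2}xy; ring.
by rewrite mulf_eq0 (gt_eqF g0) subr_eq0 => /eqP.
Qed.

(** * Primitive boundary segments of a polygon *)

Section Edges.
Variable R : realType.
Local Notation plane := 'cV[R]_2.
Local Notation pl := (@to_plane R).
Local Notation hull := (@hull R).
Implicit Types (C P Q : set plane) (s : seq pt) (p q : plane).

Definition lat P : set pt := [set v | P (pl v)].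

Definition cr (a b p : plane) : R :=
  (b 0 0 - a 0 0) * (p 1 0 - a 1 0) - (b 1 0 - a 1 0) * (p 0 0 - a 0 0).

Definition left_of P (e : pt * pt) := forall p, P p -> 0 <= cr (pl e.1) (pl e.2) p.

(* The primitive lattice segments on the boundary of P, oriented so that P is
   on their left; a segment P contributes each of its primitive pieces in both
   orientations. *)
Definition edge P : set (pt * pt) :=
  [set e | [/\ primitive (e.2 - e.1), P (pl e.1), P (pl e.2) & left_of P e]].

Lemma cr_mix a b t p q : cr a b (mix t p q) = t * cr a b p + (1 - t) * cr a b q.
Proof. by rewrite /cr !mixE; ring. Qed.

Lemma cr_pl (a b w : pt) : cr (pl a) (pl b) (pl w) = (det2 (b - a) (w - a))%:~R.
Proof. by rewrite /cr /det2 !plE !mxE !(rmorphB, rmorphM). Qed.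

Lemma cr_left a b : cr a b a = 0. Proof. by rewrite /cr !subrr !mulr0 subrr. Qed.
Lemma cr_right a b : cr a b b = 0. Proof. by rewrite /cr mulrC subrr. Qed.

Lemma fin_lat s : fin_set (lat (hull s)).
Proof.
pose N := (\sum_(v <- s) (absz (v 0 0)%R + absz (v 1 0)%R))%N.
have vN v : v \in s -> (absz (v 0 0)%R + absz (v 1 0)%R <= N)%N.
  by move=> vs; rewrite /N (big_rem v) //= leq_addr.
pose rng := [seq k%:Z - N%:Z | k <- iota 0 (N + N).+1].
have rngP (k : int) : - N%:Z <= k -> k <= N%:Z -> k \in rng.
  move=> k1 k2; apply/mapP; exists (absz (k + N%:Z)); last by lia.
  by rewrite mem_iota; lia.
exists [seq vec a b | a <- rng, b <- rng] => v hv.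
have bnd i (a b : R) : (forall p : plane, a * p 0 0 + b * p 1 0 = p i 0) ->
    (forall w, w \in s -> (absz (w i 0)%R <= N)%N) -> - N%:Z <= v i 0 /\ v i 0 <= N%:Z.
  move=> ab wN; split.
    have := @hull_halfplane R s a b (- N%:Z)%:~R _ _ hv.
    rewrite ab plE ler_int; apply => w ws; rewrite ab plE ler_int.
    by have := wN w ws; lia.
  have := @hull_halfplane R s (- a) (- b) (- N%:Z)%:~R _ _ hv.
  have abN p : - a * p 0 0 + - b * p 1 0 = - p i 0 by rewrite -ab; ring.
  rewrite abN plE -rmorphN ler_int lerN2; apply => w ws.
  by rewrite abN plE -rmorphN ler_int; have := wN w ws; lia.
have [a1 a2] : - N%:Z <= v 0 0 /\ v 0 0 <= N%:Z.
  by apply: (bnd 0 1 0) => [p|w /vN]; [ring|lia].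
have [b1 b2] : - N%:Z <= v 1 0 /\ v 1 0 <= N%:Z.
  by apply: (bnd 1 0 1) => [p|w /vN]; [ring|lia].
by apply/allpairsP; exists (v 0 0, v 1 0); split; rewrite /= ?rngP //; exact: vecE.
Qed.

Lemma fin_edge P : fin_set (lat P) -> fin_set (edge P).
Proof.
move=> [r rP]; exists [seq (a, b) | a <- r, b <- r] => -[a b] [_ Pa Pb _].
by apply/allpairsP; exists (a, b); split=> //; apply: rP.
Qed.

(* Along the face of the hull on the line of e, linear bounds are inherited from
   the points of s on that line: compare lexicographically. *)
Lemma face_bound s (e : pt * pt) (a b c : R) :
  (forall v, v \in s -> 0 <= cr (pl e.1) (pl e.2) (pl v)) ->
  (forall v, v \in s -> cr (pl e.1) (pl e.2) (pl v) = 0 ->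
     a * pl v 0 0 + b * pl v 1 0 <= c) ->
  forall p, hull s p -> cr (pl e.1) (pl e.2) p = 0 -> a * p 0 0 + b * p 1 0 <= c.
Proof.
move=> s1 s2 p hp p0; pose l := cr (pl e.1) (pl e.2).
suff : 0 < l p \/ (l p = 0 /\ a * p 0 0 + b * p 1 0 <= c).
  by rewrite /l p0 ltxx; case=> // -[].
apply: (@hull_sub R s [set p | 0 < l p \/ (l p = 0 /\ a * p 0 0 + b * p 1 0 <= c)]) => //;
  last first.
  move=> v vs /=; have := s1 v vs; rewrite le_eqVlt => /predU1P[e0|]; last by left.
  by right; split; [rewrite /l|apply: s2].
move=> x y t hx hy t0 t1 /=; rewrite /l cr_mix -/(l x) -/(l y) !mixE.
have -> : a * (t * x 0 0 + (1 - t) * y 0 0) + b * (t * x 1 0 + (1 - t) * y 1 0)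
  = t * (a * x 0 0 + b * x 1 0) + (1 - t) * (a * y 0 0 + b * y 1 0) by ring.
move: hx hy => /=; move: (l x) (l y) (a * x 0 0 + _) (a * y 0 0 + _) => lx ly fx fy.
have [->|tn0] := eqVneq t 0; first by rewrite !mul0r !add0r subr0 !mul1r.
have [->|tn1] := eqVneq t 1; first by rewrite subrr !mul0r !addr0 !mul1r.
have tp : 0 < t by rewrite lt0r tn0.
have tp' : 0 < 1 - t by rewrite subr_gt0 lt_neqAle tn1.
case=> [hx|[hx hx']]; case=> [hy|[hy hy']].
- by left; nra.
- by left; rewrite hy mulr0 addr0 mulr_gt0.
- by left; rewrite hx mulr0 add0r mulr_gt0.
- by right; split; [rewrite hx hy !mulr0 addr0|nra].
Qed.

Lemma cvx_line C (a v : pt) (i j k : int) : cvx C ->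
  C (pl (a + i *: v)) -> C (pl (a + k *: v)) -> i <= j -> j <= k ->
  C (pl (a + j *: v)).
Proof.
move=> cC Ci Ck ij jk; have [ik|ik] := eqVneq i k.
  by have -> : j = i by lia.
have ki : 0 < (k%:~R - i%:~R : R) by rewrite -rmorphB ltr0z; lia.
pose t : R := (k%:~R - j%:~R) / (k%:~R - i%:~R).
have t0 : 0 <= t by rewrite divr_ge0 // ?(ltW ki) // -rmorphB ler0z; lia.
have t1 : t <= 1.
  by rewrite ler_pdivrMr // mul1r lerD2l lerN2 ler_int.
suff -> : pl (a + j *: v) = mix t (pl (a + i *: v)) (pl (a + k *: v)) by apply: cC.
by apply: planeP; rewrite mixE !plE !mxE !(rmorphD, rmorphM) /= /t;
  field; rewrite gt_eqF.
Qed.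

Section EdgeSupport.
Variables (s : seq pt) (a b : pt).
Hypotheses (ab : primitive (b - a)) (sl : left_of (hull s) (a, b)).
Hypothesis smid : hull s (mix 2^-1 (pl a) (pl b)).

Let sl' v : v \in s -> 0 <= cr (pl a) (pl b) (pl v).
Proof. by move=> vs; apply: sl; exact: hull_mem. Qed.

Let v0 : R := pl b 0 0 - pl a 0 0.
Let v1 : R := pl b 1 0 - pl a 1 0.
Let g (p : plane) : R := v0 * p 0 0 + v1 * p 1 0.
Let c : R := g (pl a).

Let vv_gt0 : 0 < v0 * v0 + v1 * v1.
Proof.
rewrite -!expr2 lt0r addr_ge0 ?sqr_ge0 // andbT paddr_eq0 ?sqr_ge0 // !sqrf_eq0 !subr_eq0.
apply: contra (primitive_neq0 ab) => /andP[/eqP e0 /eqP e1]; rewrite subr_eq0.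
by apply/eqP/(@pl_inj R)/planeP.
Qed.

Let on_line w : cr (pl a) (pl b) (pl w) = 0 ->
  exists2 k : int, w = a + k *: (b - a) & g (pl w) = c + k%:~R * (v0 * v0 + v1 * v1).
Proof.
rewrite cr_pl => /eqP; rewrite intr_eq0 => /eqP d.
have [k wk] := primitive_parallel ab d; exists k.
  by rewrite -wk addrC subrK.
have -> : w = a + k *: (b - a) by rewrite -wk addrC subrK.
by rewrite /g /c /g /v0 /v1 !plE !mxE !(rmorphD, rmorphM, rmorphN) /=; ring.
Qed.

Let mid0 : cr (pl a) (pl b) (mix 2^-1 (pl a) (pl b)) = 0.
Proof. by rewrite cr_mix cr_left cr_right !mulr0 addr0. Qed.

Let gmid : g (mix 2^-1 (pl a) (pl b)) = c + 2^-1 * (v0 * v0 + v1 * v1).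
Proof. by rewrite /c /g !mixE /v0 /v1; field. Qed.

(** Otherwise every generator on the line of the edge has position k <= 0, where g <= c;
    [face_bound] extends this to the midpoint, where g > c. *)
Lemma support_right : exists2 k : int, 0 < k & a + k *: (b - a) \in s.
Proof.
apply: contrapT => nk.
have := @face_bound s (a, b) v0 v1 c sl' _ _ smid mid0.
rewrite -/(g _) gmid => h; have : c + 2^-1 * (v0 * v0 + v1 * v1) <= c.
  apply: h => w ws wl; rewrite -/(g (pl w)).
  have [k wk ->] := on_line wl; have k0 : k <= 0.
    by rewrite leNgt; apply/negP => k0; apply: nk; exists k; rewrite -?wk.
  have : (k%:~R : R) <= 0 by rewrite lerz0.
  by move=> k0'; have := vv_gt0; nra.
by have := vv_gt0; lra.
Qed.

Lemma support_left : exists2 k : int, k <= 0 & a + k *: (b - a) \in s.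
Proof.
apply: contrapT => nk.
have := @face_bound s (a, b) (- v0) (- v1) (- c - (v0 * v0 + v1 * v1)) sl' _ _ smid mid0.
have gN p : - v0 * p 0 0 + - v1 * p 1 0 = - g p by rewrite /g; ring.
rewrite gN gmid => h.
have : - (c + 2^-1 * (v0 * v0 + v1 * v1)) <= - c - (v0 * v0 + v1 * v1).
  apply: h => w ws wl; rewrite gN.
  have [k wk ->] := on_line wl; have k0 : 1 <= k.
    suff : ~ (k <= 0) by lia.
    by move=> k0; apply: nk; exists k; rewrite -?wk.
  have : 1 <= (k%:~R : R) by rewrite -[1]/(1%:~R) ler_int.
  by move=> k0'; have := vv_gt0; nra.
have := vv_gt0; lra.
Qed.

Lemma edge_ends : hull s (pl a) /\ hull s (pl b).
Proof.
have [k k0 ks] := support_right; have [i i0 is_] := support_left.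
have hk := @hull_mem R _ _ ks; have hi := @hull_mem R _ _ is_.
have := cvx_line (@cvx_hull R s) hi hk.
move=> line; split.
  by have := line 0 i0 (ltW k0); rewrite scale0r addr0.
by have := line 1; rewrite scale1r addrCA subrr addr0; apply; lia.
Qed.
End EdgeSupport.

Lemma edge_mid s e : edge (hull s) e -> hull s (mix 2^-1 (pl e.1) (pl e.2)).
Proof. by case=> _ ha hb _; apply: cvx_hull => //; lra. Qed.

(** Some q in Q is strictly to the right. The half-open segment from q to m stays strictly right,
    hence outside P and inside Q; closedness adds m. *)
Lemma one_sided P Q e (m : plane) : cvx (P `|` Q) -> seg_closed Q ->
  left_of P e -> ~ left_of Q e -> P m -> cr (pl e.1) (pl e.2) m = 0 -> Q m.
Proof.
move=> cPQ cQ lP lQ Pm m0.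
have [q Qq q0] : exists2 q, Q q & cr (pl e.1) (pl e.2) q < 0.
  apply: contrapT => nq; apply: lQ => q Qq; rewrite leNgt; apply/negP => q0.
  by apply: nq; exists q.
apply: (cQ m q) => t t0 t1.
have [|//] : (P `|` Q) (mix t q m) by apply: cPQ => //; [right|left|exact: ltW].
move=> /lP; rewrite cr_mix m0 mulr0 addr0 pmulr_rge0 // => q0'.
by move: (lt_le_trans q0 q0'); rewrite ltxx.
Qed.

Lemma mix0 p q : mix 0 p q = q.
Proof. by rewrite /mix scale0r add0r subr0 scale1r. Qed.
Lemma mix1 p q : mix 1 p q = p.
Proof. by rewrite /mix scale1r subrr scale0r addr0. Qed.

(** On a segment from p in P to q in Q, both strictly right of e, the last point of P is also a
    limit of points of Q. It lies in both and is strictly right of e. *)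
Lemma crossing P Q e : cvx P -> cvx (P `|` Q) -> seg_closed P -> seg_closed Q ->
  ~ left_of P e -> ~ left_of Q e -> ~ left_of (P `&` Q) e.
Proof.
move=> cP cPQ sP sQ lP lQ lPQ.
have neg X : ~ left_of X e -> exists2 q, X q & cr (pl e.1) (pl e.2) q < 0.
  move=> lX; apply: contrapT => nq; apply: lX => q Xq; rewrite leNgt; apply/negP => q0.
  by apply: nq; exists q.
have [p Pp p0] := neg P lP; have [q Qq q0] := neg Q lQ.
pose A := [set t : R | 0 <= t <= 1 /\ P (mix t q p)].
have A0 : A 0 by split; rewrite ?lexx ?ler01 // mix0.
have Aub : has_ubound A by exists 1 => t [/andP[_ ?] _].
have supA : has_sup A by split=> //; exists 0.
set T := sup A.
have T0 : 0 <= T by apply: ub_le_sup.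
have T1 : T <= 1 by apply: ge_sup; [exists 0|move=> t [/andP[_ ?] _]].
have mixT (t u : R) x y : mix t x (mix u y x) = mix ((1 - t) * u) y x.
  by apply: planeP; rewrite !mixE; ring.
have mixT' (t u : R) x y : mix t y (mix u y x) = mix (t + (1 - t) * u) y x.
  by apply: planeP; rewrite !mixE; ring.
have belowT t : 0 <= t -> t < T -> P (mix t q p).
  move=> t0 tT; have [u [/andP[u0 u1] Pu] tu] := sup_gt (ex_intro A 0 A0) tT.
  have un0 : u != 0 by apply/eqP => u0'; move: tu; rewrite u0' => ?; lra.
  have up : 0 < u by rewrite lt0r un0.
  have -> : mix t q p = mix (1 - t / u) p (mix u q p).
    by rewrite mixT; congr mix; field.
  have tu1 : t / u <= 1 by rewrite ler_pdivrMr // mul1r ltW.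
  have tu0 : 0 <= t / u by rewrite divr_ge0.
  by apply: cP => //; lra.
pose m := mix T q p.
have Pm : P m.
  have [T0'|Tn0] := eqVneq T 0; first by rewrite /m T0' mix0.
  have Tp : 0 < T by rewrite lt0r Tn0.
  apply: (sP m p) => t t0 t1; rewrite mixT; apply: belowT; first by nra.
  by nra.
have Qm : Q m.
  have [T1'|Tn1] := eqVneq T 1; first by rewrite /m T1' mix1.
  have Tp : T < 1 by rewrite lt_neqAle Tn1.
  apply: (sQ m q) => t t0 t1; rewrite mixT'.
  set u := t + _; have u0 : 0 <= u by rewrite /u; nra.
  have u1 : u <= 1 by rewrite /u; nra.
  have uT : T < u by rewrite /u; nra.
  have [Pu|//] : (P `|` Q) (mix u q p) by apply: cPQ => //; [right|left].
  have : u <= T by apply: ub_le_sup => //; split; rewrite ?u0.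
  by move=> /(lt_le_trans uT); rewrite ltxx.
have := lPQ m (conj Pm Qm); rewrite /m cr_mix; nra.
Qed.

End Edges.

(** * Valuations given by sums over lattice points and edges *)

Section Valuations.
Variable R : realType.
Local Notation plane := 'cV[R]_2.
Local Notation pl := (@to_plane R).
Local Notation hull := (@hull R).
Implicit Types (C P Q : set plane) (s : seq pt) (p q : plane) (e : pt * pt).

Lemma hull_nonneg_left s e :
  (forall v, v \in s -> 0 <= det2 (e.2 - e.1) (v - e.1)) -> left_of (hull s) e.
Proof.
move=> h; apply: hull_sub => [p q t hp hq t0 t1|v vs].
  rewrite cr_mix; apply: addr_ge0; apply: mulr_ge0 => //; lra.
by rewrite cr_pl ler0z; apply: h.
Qed.

Definition is_polygon P := exists s, P = hull s.

Lemma edge_modular_mixed P Q e : is_polygon P -> is_polygon Q -> cvx (P `|` Q) ->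
  left_of P e -> ~ left_of Q e ->
  (`[< edge (P `|` Q) e >] + `[< edge (P `&` Q) e >] =
   `[< edge P e >] + `[< edge Q e >])%N.
Proof.
move=> [s PE] [s' QE] cPQ lP lQ.
have -> : `[< edge (P `|` Q) e >] = false.
  by apply/asboolPn => -[_ _ _ l]; apply: lQ => p Qp; apply: l; right.
have -> : `[< edge Q e >] = false by apply/asboolPn => -[].
rewrite add0n addn0; congr nat_of_bool; apply: asbool_equiv_eq.
have sQ : seg_closed Q by rewrite QE; exact: hull_seg_closed.
split=> [[pe [Pa _] [Pb _] _]|[pe Pa Pb _]]; first by split.
split=> //; last by move=> p [/lP].
- by split=> //; apply: (one_sided cPQ sQ lP lQ Pa); exact: cr_left.
- by split=> //; apply: (one_sided cPQ sQ lP lQ Pb); exact: cr_right.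
Qed.

(** Cases by which of P and Q lie to the left of e. If both do, the midpoint of an edge of the union
    lies in one of them and [edge_ends] brings the ends along. If one does, [one_sided] applies. If
    neither does, [crossing] shows that e is an edge of none of the four sets. *)
Lemma edge_modular P Q e : is_polygon P -> is_polygon Q -> cvx (P `|` Q) ->
  (`[< edge (P `|` Q) e >] + `[< edge (P `&` Q) e >] =
   `[< edge P e >] + `[< edge Q e >])%N.
Proof.
move=> polP polQ cPQ.
have [lP|lP] := pselect (left_of P e); have [lQ|lQ] := pselect (left_of Q e).
- have [s PE] := polP; have [s' QE] := polQ.
  have lU : left_of (P `|` Q) e by move=> p [/lP|/lQ].
  have lI : left_of (P `&` Q) e by move=> p [/lP].
  have EI : `[< edge (P `&` Q) e >] = `[< edge P e >] && `[< edge Q e >].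
    apply/asboolP/andP => [[pe [Pa Qa] [Pb Qb] _]|[/asboolP[pe Pa Pb _] /asboolP[_ Qa Qb _]]].
      by split; apply/asboolP.
    by split.
  have EU : `[< edge (P `|` Q) e >] = `[< edge P e >] || `[< edge Q e >].
    apply/asboolP/orP => [[pe Ua Ub _]|[/asboolP[pe Pa Pb _]|/asboolP[pe Qa Qb _]]].
    - have : (P `|` Q) (mix 2^-1 (pl e.1) (pl e.2)).
        by apply: cPQ => //; lra.
      case=> [Pm|Qm]; [left|right]; apply/asboolP.
        rewrite PE in Pm lP *; have [|Pa Pb] := @edge_ends R s e.1 e.2 pe _ Pm.
          by case: (e) lP.
        by split.
      rewrite QE in Qm lQ *; have [|Qa Qb] := @edge_ends R s' e.1 e.2 pe _ Qm.
        by case: (e) lQ.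
      by split.
    - by split=> //; left.
    - by split=> //; right.
  by rewrite EU EI; case: asbool; case: asbool.
- exact: edge_modular_mixed.
- by rewrite setUC setIC [RHS]addnC; apply: edge_modular_mixed => //; rewrite setUC.
- have sP : seg_closed P by have [s ->] := polP; exact: hull_seg_closed.
  have sQ : seg_closed Q by have [s ->] := polQ; exact: hull_seg_closed.
  have cP : cvx P by have [s ->] := polP; exact: cvx_hull.
  have nI := crossing cP cPQ sP sQ lP lQ.
  have nU : ~ left_of (P `|` Q) e by move=> l; apply: lP => p Pp; apply: l; left.
  have E X : ~ left_of X e -> `[< edge X e >] = false by move=> nX; apply/asboolPn => -[].
  by rewrite !E.
Qed.

Definition Zval (al : pt -> Qxy) (be : pt * pt -> Qxy) P : Qxy :=
  ssum (lat P) al + ssum (edge P) be.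

Lemma lattice_polygonP P : lattice_polygon P -> is_polygon P.
Proof. by case=> s _ ->; exists s. Qed.

Lemma fin_lat_polygon P : is_polygon P -> fin_set (lat P).
Proof. by case=> s ->; exact: fin_lat. Qed.

Lemma Zval_valuation al be : valuation (Zval al be).
Proof.
move=> P Q /lattice_polygonP polP /lattice_polygonP polQ /cvxP cPQ.
have fP := fin_lat_polygon polP; have fQ := fin_lat_polygon polQ.
have fU : fin_set (lat (P `|` Q)) by apply: sub_fin_set (fin_setU fP fQ) => v.
have fI : fin_set (lat (P `&` Q)) by apply: sub_fin_set fP => v [].
rewrite /Zval addrACA [RHS]addrACA; congr (_ + _).
  apply: ssum_modular => // v.
  rewrite /lat /= !asbool_or !asbool_and.
  by case: asbool; case: asbool.
apply: ssum_modular; try exact: fin_edge.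
by move=> e; apply: edge_modular.
Qed.

(** * Unimodular equivariance *)

Lemma affine_map_pl (M : 'M[int]_2) t v :
  affine_map M t (pl v) = pl (aff M t v).
Proof. by rewrite /affine_map /aff plD /to_plane map_mxM. Qed.

Lemma affine_mapE (M : 'M[int]_2) t p i : affine_map M t p i 0 =
  (M i 0)%:~R * p 0 0 + (M i 1)%:~R * p 1 0 + (t i 0)%:~R.
Proof.
rewrite !mxE big_ord_recl big_ord1 !mxE.
by congr (_ + (M _ _)%:~R * p _ _ + _); apply/val_inj.
Qed.

Lemma affine_map_mix (M : 'M[int]_2) t x p q :
  affine_map M t (mix x p q) = mix x (affine_map M t p) (affine_map M t q).
Proof.
by apply: planeP; rewrite mixE !affine_mapE !mixE; ring.
Qed.

Lemma affine_map_hull (M : 'M[int]_2) t s :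
  affine_map M t @` hull s = hull (map (aff M t) s).
Proof.
apply/seteqP; split=> [_ [p hp <-]|].
  apply: (@hull_sub R s [set p | hull (map (aff M t) s) (affine_map M t p)]) hp.
    by move=> x y r /=; rewrite affine_map_mix; apply: cvx_hull.
  by move=> v vs /=; rewrite affine_map_pl; apply: hull_mem; apply: map_f.
apply: hull_sub.
  move=> _ _ r [x hx <-] [y hy <-] r0 r1; exists (mix r x y); last exact: affine_map_mix.
  exact: cvx_hull.
move=> _ /mapP[v vs ->]; exists (pl v); first exact: hull_mem.
exact: affine_map_pl.
Qed.

Lemma det2_affine (M : 'M[int]_2) t (a b : pt) p :
  cr (pl (aff M t a)) (pl (aff M t b)) (affine_map M t p)
  = (\det M)%:~R * cr (pl a) (pl b) p.
Proof.
by rewrite /cr -!affine_map_pl !affine_mapE detM2 !(rmorphB, rmorphM) /=; ring.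
Qed.

Section Unimodular.
Variables (M : 'M[int]_2) (t : pt).
Hypothesis uM : M \in unitmx.

Lemma affK : cancel (aff M t) (fun v => invmx M *m (v - t)).
Proof. by move=> v; rewrite /aff addrK mulKmx. Qed.
Lemma aff_surj v : exists u, v = aff M t u.
Proof. by exists (invmx M *m (v - t)); rewrite /aff mulKVmx // subrK. Qed.

Lemma affine_map_inj : injective (@affine_map R M t).
Proof.
move=> p q; rewrite /affine_map => /addIr.
move=> /(congr1 (mulmx (map_mx intr (invmx M)))).
by rewrite !mulmxA -map_mxM mulVmx // map_mx1 !mul1mx.
Qed.

Lemma affine_image P p : (affine_map M t @` P) (affine_map M t p) <-> P p.
Proof.
split=> [[q Pq /affine_map_inj <-]//|Pp]; by exists p.
Qed.

Lemma primitive_mulmx v : primitive v -> primitive (M *m v).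
Proof.
move=> /primitiveP[x [y xy]].
pose N := invmx M; have NM : N *m (M *m v) = v by rewrite mulKmx.
apply/primitiveP.
exists (x * N 0 0 + y * N 1 0), (x * N 0 1 + y * N 1 1).
have e0 : v 0 0 = N 0 0 * (M *m v) 0 0 + N 0 1 * (M *m v) 1 0.
  by rewrite -mulmx2_0 NM.
have e1 : v 1 0 = N 1 0 * (M *m v) 0 0 + N 1 1 * (M *m v) 1 0.
  by rewrite -mulmx2_1 NM.
by rewrite -xy e0 e1; ring.
Qed.
End Unimodular.

Lemma primitive_unimodular (M : 'M[int]_2) v :
  M \in unitmx -> primitive (M *m v) = primitive v.
Proof.
move=> uM; apply/idP/idP; last exact: primitive_mulmx.
by move=> /(@primitive_mulmx (invmx M)); rewrite unitmx_inv mulKmx //; apply.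
Qed.

(** A map of determinant -1 exchanges the ends, which keeps the image polygon on the left. *)
Definition eaff (M : 'M[int]_2) t e : pt * pt :=
  if \det M == 1 then (aff M t e.1, aff M t e.2) else (aff M t e.2, aff M t e.1).

Lemma edge_affine (M : 'M[int]_2) t P e : M \in unitmx ->
  edge (affine_map M t @` P) (eaff M t e) <-> edge P e.
Proof.
move=> uM; have imP v : (affine_map M t @` P) (pl (aff M t v)) <-> P (pl v).
  by rewrite -affine_map_pl; apply: affine_image.
have swap_cr (a b p : plane) : cr b a p = - cr a b p by rewrite /cr; ring.
rewrite /eaff; case: (unitmx_det uM) => dM; rewrite dM /=; split.
- move=> [/= pe /imP Pa /imP Pb l]; split=> //.
    by move: pe; rewrite affB primitive_unimodular.
  move=> p Pp; have /l : (affine_map M t @` P) (affine_map M t p) by exists p.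
  by rewrite /= det2_affine dM mul1r.
- move=> [pe Pa Pb l]; split=> /=; first by rewrite affB primitive_unimodular.
  - exact/imP.
  - exact/imP.
  by move=> _ [p Pp <-] /=; rewrite det2_affine dM mul1r; apply: l.
- move=> [/= pe /imP Pb /imP Pa l]; split=> //.
    by move: pe; rewrite affB primitive_unimodular // -opprB primitiveN.
  move=> p Pp; have /l : (affine_map M t @` P) (affine_map M t p) by exists p.
  by rewrite /= det2_affine dM swap_cr mulrN mulN1r opprK.
- move=> [pe Pa Pb l]; split=> /=.
  - by rewrite affB primitive_unimodular // -opprB primitiveN.
  - exact/imP.
  - exact/imP.
  by move=> _ [p Pp <-] /=; rewrite det2_affine dM swap_cr mulrN mulN1r opprK; apply: l.
Qed.

Lemma ssum_lat_affine (M : 'M[int]_2) t P (al : pt -> Qxy) : M \in unitmx -> is_polygon P ->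
  ssum (lat (affine_map M t @` P)) al = ssum (lat P) (al \o aff M t).
Proof.
move=> uM polP; apply: ssum_bij.
- exact: fin_lat_polygon.
- exact: (can_inj (affK t uM)).
- by move=> v; rewrite /lat /= -affine_map_pl; apply: affine_image.
- by move=> v _; apply: aff_surj.
Qed.

Lemma ssum_edge_affine (M : 'M[int]_2) t P (be : pt * pt -> Qxy) : M \in unitmx -> is_polygon P ->
  ssum (edge (affine_map M t @` P)) be = ssum (edge P) (be \o eaff M t).
Proof.
move=> uM polP; have inj := can_inj (affK t uM).
apply: ssum_bij.
- by apply: fin_edge; apply: fin_lat_polygon.
- by move=> [a b] [c d]; rewrite /eaff; case: ifP => _ /= [/inj -> /inj ->].
- by move=> e; apply: edge_affine.
- move=> [a b] _; have [c ->] := aff_surj t uM a; have [d ->] := aff_surj t uM b.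
  by case E: (\det M == 1); [exists (c, d)|exists (d, c)]; rewrite /eaff E.
Qed.

Lemma Zval_equivariant al be :
  (forall M t v, M \in unitmx -> al (aff M t v) = affine_act M t (al v)) ->
  (forall M t e, M \in unitmx -> be (eaff M t e) = affine_act M t (be e)) ->
  equivariant (@Zval al be).
Proof.
move=> alE beE P M t /lattice_polygonP polP uM.
rewrite /Zval ssum_lat_affine // ssum_edge_affine // affine_actD.
have fP := fin_lat_polygon polP.
rewrite !(ssum_morph _ _ (affine_actD M t) (affine_act0 M t)).
congr (_ + _); first by apply: eq_ssum => // v _; exact: alE.
by apply: eq_ssum => [|e _]; [exact: fin_edge|exact: beE].
Qed.
End Valuations.

(** * Every lattice point is left by as many edges as arrive there *)

Section ExtremeRays.
Implicit Types (V L : seq pt) (eps : int) (x y z : pt).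

Definition ray V v := primitive v /\ exists2 k : int, 0 < k & k *: v \in V.
(** With V the generators seen from a lattice point p, the extreme vectors for eps = 1 are the edges
    leaving p, and those for eps = -1 point back along the edges arriving at p. *)
Definition extreme eps V v := ray V v /\ forall x, x \in V -> 0 <= eps * det2 v x.

(** The Pluecker relation; it makes comparison of angles transitive in [extreme_opposite]. *)
Lemma plucker v x y z :
  det2 x z * det2 v y = det2 x y * det2 v z + det2 y z * det2 v x.
Proof. by rewrite /det2; ring. Qed.

(** If - v is a ray it is the opposite one. Otherwise all nonzero vectors of V make an angle in [0,
    pi) with v, measured in the sense of eps; the sign of D orders them by angle, and a last one
    spans the opposite ray. *)
Lemma extreme_opposite eps V v : eps = 1 \/ eps = -1 ->
  extreme eps V v -> exists w, extreme (- eps) V w.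
Proof.
move=> epsE [[pv [k0 k00 kv]] vV].
have [[k k1 kN]|nk] := pselect (exists2 k : int, 0 < k & k *: (- v) \in V).
  exists (- v); split; first by split; [rewrite primitiveN|exists k].
  by move=> x /vV; rewrite det2N mulrNN.
pose D x y := eps * det2 x y.
have Dpos x : x \in V -> x != 0 -> 0 < D v x \/ exists2 k : int, 0 < k & x = k *: v.
  move=> xV x0; have [d|d] := eqVneq (det2 v x) 0; last first.
    left; rewrite lt0r vV // andbT mulf_neq0 //.
    by case: epsE => ->.
  have [k xk] := primitive_parallel pv d; right; exists k => //.
  rewrite ltNge; apply/negP => k1; apply: nk; exists (- k); last by rewrite scalerN scaleNr opprK -xk.
  rewrite oppr_gt0 lt_neqAle k1 andbT; apply: contraNneq x0 => k2.
  by rewrite xk k2 scale0r.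
have Dvv : D v v = 0 by rewrite /D det2xx mulr0.
have DC x y : D y x = - D x y by rewrite /D det2C mulrN.
have DZl k x y : D (k *: x) y = k * D x y by rewrite /D det2Zl mulrCA.
have DZr k x y : D x (k *: y) = k * D x y by rewrite /D det2Zr mulrCA.
pose H x := 0 < D v x \/ exists2 k : int, 0 < k & x = k *: v.
have trans x y z : H x -> H y -> H z -> 0 <= D x y -> 0 <= D y z -> 0 <= D x z.
  move=> Hx Hy Hz xy yz.
  have Dv u : H u -> 0 <= D v u.
    by case=> [/ltW //|[k _ ->]]; rewrite DZr Dvv mulr0.
  case: Hy => [vy|[k k1 yk]].
    have : 0 <= D x z * D v y.
      have -> : D x z * D v y = D x y * D v z + D y z * D v x.
        have := plucker v x y z; rewrite /D => E.
        transitivity (eps * eps * (det2 x z * det2 v y)); first by ring.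
        by rewrite E; ring.
      by rewrite addr_ge0 // mulr_ge0 // Dv.
    by rewrite pmulr_lge0.
  case: Hx => [vx|[l l0 xl]].
    by move: xy; rewrite yk DZr DC mulrN oppr_ge0 pmulr_rle0 // leNgt vx.
  by rewrite xl DZl mulr_ge0 ?Dv // ltW.
have max L : L != [::] -> (forall x, x \in L -> H x) ->
    exists2 w, w \in L & forall x, x \in L -> 0 <= D x w.
  elim: L => // a L IH _ HL.
  have [->|L0] := eqVneq L [::].
    by exists a; rewrite ?inE // => x; rewrite inE => /eqP ->; rewrite /D det2xx mulr0.
  have [//||w wL wmax] := IH; first by move=> x xL; apply: HL; rewrite inE xL orbT.
  have Ha : H a by apply: HL; rewrite inE eqxx.
  have [aw|aw] := leP 0 (D a w).
    exists w; first by rewrite inE wL orbT.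
    by move=> x; rewrite inE => /predU1P[->|/wmax].
  exists a; first by rewrite inE eqxx.
  move=> x; rewrite inE => /predU1P[->|xL]; first by rewrite /D det2xx mulr0.
  apply: (trans x w a) => //; try by [apply: HL; rewrite inE ?xL ?wL orbT|apply: wmax].
  by rewrite DC oppr_ge0 ltW.
have [||w] := max [seq x <- V | x != 0].
- have : k0 *: v \in [seq x <- V | x != 0].
    rewrite mem_filter kv andbT; apply: contra (primitive_neq0 pv) => /eqP E.
    have Ei i : v i 0 = 0.
      have /eqP := congr1 (fun u : pt => u i 0) E.
      by rewrite !mxE mulf_eq0 (gt_eqF k00) => /eqP.
    by apply/eqP/ptP; rewrite mxE Ei.
  by case: [seq x <- V | x != 0].
- by move=> x; rewrite mem_filter => /andP[x0 xV]; exact: Dpos.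
rewrite mem_filter => /andP[w0 wV] wmax.
have [w' [g [pw g0 wE]]] := primitive_part w0.
exists w'; split; first by split=> //; exists g; rewrite -?wE.
move=> x xV; have [->|x0] := eqVneq x 0.
  by rewrite /det2 !mxE !mulr0.
have := wmax x; rewrite mem_filter x0 xV => /(_ isT).
by rewrite wE DZr pmulr_rge0 // DC /D -mulNr.
Qed.

Lemma extreme_unique eps V v w : eps = 1 \/ eps = -1 ->
  extreme eps V v -> extreme eps V w -> w = v \/ w = - v.
Proof.
move=> epsE [[pv [k k0 kv]] vV] [[pw [l l0 lw]] wV].
apply: primitive_parallel_eq => //.
have := vV _ lw; have := wV _ kv; rewrite !det2Zr (det2C v w).
by case: epsE => ->; nia.
Qed.

Lemma extreme_both eps V v w : eps = 1 \/ eps = -1 ->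
  extreme eps V v -> extreme eps V (- v) ->
  extreme eps V w <-> extreme (- eps) V w.
Proof.
move=> epsE ev enV.
have line x : x \in V -> det2 v x = 0.
  have [_ h1] := ev; have [_ h2] := enV; move=> xV.
  by have := h1 x xV; have := h2 x xV; rewrite det2N; case: epsE => ->; lia.
have flip e e' u : ray V u -> extreme e V u -> extreme e' V u.
  move=> ru _; split=> // x xV.
  have [pu [k k0 ku]] := ru.
  have [k' uk'] : exists k, u = k *: v.
    apply: primitive_parallel ev.1.1 _.
    by have /eqP := line _ ku; rewrite det2Zr mulf_eq0 (gt_eqF k0) => /eqP.
  by rewrite uk' det2Zl line // !mulr0.
by split=> ew; apply: (flip _ _ _ ew.1 ew).
Qed.

Lemma count_unique (T : eqType) (r : seq T) (p : pred T) (t : T) :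
  uniq r -> t \in r -> p t -> (forall u : T, p u -> u = t) -> count p r = 1%N.
Proof.
move=> ur tr pt pu; have := count_uniq_mem t ur; rewrite tr => E; rewrite -[RHS]E.
by apply: eq_count => u /=; apply/idP/eqP => [/pu|->].
Qed.

(** If V lies on a line, the two kinds of extreme rays coincide. Otherwise there is at most one of
    each kind, and by [extreme_opposite] they exist together. *)
Lemma count_extreme V (r : seq pt) : uniq r -> (forall v, ray V v -> v \in r) ->
  count (fun v => `[< extreme 1 V v >]) r = count (fun v => `[< extreme (-1) V v >]) r.
Proof.
move=> ur rV.
have e1 : (1 : int) = 1 \/ (1 : int) = -1 by left.
have e2 : (-1 : int) = 1 \/ (-1 : int) = -1 by right.
have [[v ev]|n1] := pselect (exists v, extreme 1 V v); last first.
  have n2 v : ~ extreme (-1) V v.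
    move=> /(extreme_opposite e2)[w]; rewrite opprK => ew; by apply: n1; exists w.
  apply: eq_count => v /=; apply/asboolP/asboolP => h; first by case: n1; exists v.
  by case: (n2 v).
have [w ew] := extreme_opposite e1 ev.
have [env|nv] := pselect (extreme 1 V (- v)).
  by apply: eq_count => u /=; apply: asbool_equiv_eq; apply: (extreme_both _ e1 ev env).
rewrite (@count_unique _ r _ v) //; first last.
- move=> y /asboolP ey; have [//|yv] := extreme_unique e1 ev ey.
  by case: nv; rewrite -yv.
- exact/asboolP.
- by apply: rV; exact: ev.1.
rewrite (@count_unique _ r _ w) //; first last.
- move=> y /asboolP ey; have [//|yw] := extreme_unique e2 ew ey.
  (* Then w and - w are extreme for 1 as well, and v is one of them, so - v would be extreme too. *)
  have enw : extreme (-1) V (- w) by rewrite -yw.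
  case: nv; have vv : extreme 1 V w.
    have := extreme_both w e2 ew enw; rewrite opprK => h; exact/h.
  have vnv : extreme 1 V (- w).
    have := extreme_both (- w) e2 ew enw; rewrite opprK => h; exact/h.
  have [wv|wv] := extreme_unique e1 ev vv; first by rewrite -wv.
  by rewrite -wv.
- exact/asboolP.
- by apply: rV; exact: ew.1.
Qed.
End ExtremeRays.

Section Balance.
Variable R : realType.
Local Notation plane := 'cV[R]_2.
Local Notation pl := (@to_plane R).
Local Notation hull := (@hull R).
Variable s : seq pt.
Local Notation P := (hull s).

Let V (p : pt) := [seq w - p | w <- s].

Lemma cvx_segment (p v : pt) (k : int) : 0 < k -> P (pl p) -> p + k *: v \in s -> P (pl (p + v)).
Proof.
move=> k0 Pp ks; have := @cvx_line R P p v 0 1 k (@cvx_hull R s).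
rewrite scale0r addr0 scale1r; apply=> //; first exact: hull_mem.
Qed.

Lemma edge_out (p b : pt) : P (pl p) ->
  edge P (p, b) <-> extreme 1 (V p) (b - p).
Proof.
move=> Pp; split.
  move=> e; have [/= pe _ _ l] := e; split.
    split=> //; have [k k0 ks] := support_right pe l (edge_mid e).
    by exists k => //; apply/mapP; exists (p + k *: (b - p)); rewrite // [p + _ *: _]addrC addrK.
  move=> x /mapP[w ws ->]; rewrite mul1r.
  by have := l _ (@hull_mem R _ _ ws); rewrite /= cr_pl ler0z.
move=> [[pe [k k0 /mapP[w ws wE]]] l]; split=> //=.
  have -> : b = p + (b - p) by rewrite addrC subrK.
  by apply: (cvx_segment k0 Pp); rewrite wE addrC subrK.
apply: hull_nonneg_left => v vs /=; rewrite -[X in _ <= X]mul1r; apply: l.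
exact: map_f.
Qed.

Lemma edge_in (p a : pt) : P (pl p) ->
  edge P (a, p) <-> extreme (-1) (V p) (a - p).
Proof.
have dE (w : pt) : det2 (p - a) (w - a) = -1 * det2 (a - p) (w - p).
  by rewrite /det2 !mxE; ring.
move=> Pp; split.
  move=> e; have [/= pe _ _ l] := e; split.
    split; first by rewrite -opprB primitiveN.
    have [k k0 ks] := support_left pe l (edge_mid e).
    (* A generator at position k <= 0 from a along p - a is at position 1 - k from p along a - p. *)
    exists (1 - k); first by lia.
    apply/mapP; exists (a + k *: (p - a)) => //.
    by apply/matrixP => i j; rewrite !mxE; ring.
  move=> x /mapP[w ws ->]; rewrite -dE.
  by have := l _ (@hull_mem R _ _ ws); rewrite /= cr_pl ler0z.
move=> [[pe [k k0 /mapP[w ws wE]]] l]; split=> //=.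
- by rewrite -opprB primitiveN.
- have -> : a = p + (a - p) by rewrite addrC subrK.
  by apply: (cvx_segment k0 Pp); rewrite wE addrC subrK.
- apply: hull_nonneg_left => v vs /=; rewrite dE; apply: l.
  exact: map_f.
Qed.

Lemma edge_degree (r : seq pt) (p : pt) : uniq r -> (forall v, (v \in r) <-> lat P v) ->
  (\sum_(b <- r) `[< edge P (p, b) >] = \sum_(a <- r) `[< edge P (a, p) >])%N.
Proof.
move=> ur rP; have [Pp|nP] := pselect (P (pl p)); last first.
  by rewrite !big1 // => b _; rewrite (asboolF (P := edge _ _)) // => -[].
pose r' := [seq b - p | b <- r].
have ur' : uniq r' by rewrite map_inj_uniq //; exact: addIr.
have := @count_extreme (V p) r' ur' _.
rewrite !count_map -!sum1_count.
rewrite [X in _ -> X = _](eq_bigr (fun b => if `[< extreme 1 (V p) (b - p) >] then 1 else 0)%N).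
  rewrite [X in _ -> _ = X](eq_bigr (fun b => if `[< extreme (-1) (V p) (b - p) >] then 1 else 0)%N).
    rewrite -!big_mkcond /=; apply => v [pv [k k0 /mapP[w ws wE]]].
    apply/mapP; exists (p + v); last by rewrite addrC addKr.
    by apply/rP; apply: (cvx_segment k0 Pp); rewrite wE addrC subrK.
  by move=> b _; rewrite (asbool_equiv_eq (edge_in b Pp)); case: asbool.
by move=> b _; rewrite (asbool_equiv_eq (edge_out b Pp)); case: asbool.
Qed.

Lemma edge_balance (phi : pt -> Qxy) :
  ssum (edge P) (fun e => phi e.2 - phi e.1) = 0.
Proof.
have [r ur rP] := fin_setP (@fin_lat R s).
have rE e : edge P e -> e \in [seq (a, b) | a <- r, b <- r].
  case: e => a b [_ Pa Pb _]; apply/allpairsP; exists (a, b).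
  by split=> //=; apply/rP.
have urr : uniq [seq (a, b) | a <- r, b <- r].
  by apply: allpairs_uniq => // -[a b] [c d].
rewrite ssumB !(ssum_mulrn _ urr rE) !big_allpairs /=.
apply/eqP; rewrite subr_eq0; apply/eqP; rewrite exchange_big /=.
apply: eq_bigr => p _; rewrite !sumrMnr; congr (_ *+ _).
by rewrite edge_degree.
Qed.
End Balance.

Lemma oE : o = vec 0 0. Proof. by apply: ptP; rewrite !mxE. Qed.
Lemma e1E : e1 = vec 1 0. Proof. by apply: ptP; rewrite !mxE. Qed.
Lemma e2E : e2 = vec 0 1. Proof. by apply: ptP; rewrite !mxE. Qed.
Lemma vec00 : vec 0 0 = 0. Proof. by rewrite -oE. Qed.

(** * Values at the point, the segment and the standard triangle *)

Section Values.
Variable R : realType.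
Local Notation plane := 'cV[R]_2.
Local Notation pl := (@to_plane R).
Local Notation hull := (@hull R).

Lemma lat_halfplane s (a b c : int) v : lat (hull s) v ->
  (forall w, w \in s -> c <= a * w 0 0 + b * w 1 0) -> c <= a * v 0 0 + b * v 1 0.
Proof.
move=> hv h; have := @hull_halfplane R s a%:~R b%:~R c%:~R _ _ hv.
rewrite !plE -!rmorphM -rmorphD ler_int; apply=> w ws.
by rewrite !plE -!rmorphM -rmorphD ler_int; apply: h.
Qed.

Lemma lat_point v : v \in [:: vec 0 0] <-> lat (hull [:: vec 0 0]) v.
Proof. by rewrite inE hull_point /lat /=; split=> [/eqP ->|/pl_inj ->]. Qed.

Lemma lat_segment v :
  v \in [:: vec 0 0; vec 1 0] <-> lat (hull [:: vec 0 0; vec 1 0]) v.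
Proof.
split=> [vs|hv]; first exact: hull_mem.
have h a b c := @lat_halfplane _ a b c v hv.
have h1 : 0 <= 1 * v 0 0 + 0 * v 1 0.
  by apply: h => w; rewrite !inE => /orP[] /eqP ->; rewrite vec0 vec1.
have h2 : -1 <= -1 * v 0 0 + 0 * v 1 0.
  by apply: h => w; rewrite !inE => /orP[] /eqP ->; rewrite vec0 vec1.
have h3 : 0 <= 0 * v 0 0 + 1 * v 1 0.
  by apply: h => w; rewrite !inE => /orP[] /eqP ->; rewrite vec0 vec1.
have h4 : 0 <= 0 * v 0 0 + -1 * v 1 0.
  by apply: h => w; rewrite !inE => /orP[] /eqP ->; rewrite vec0 vec1.
have v1 : v 1 0 = 0 by lia.
have [v0|v0] : v 0 0 = 0 \/ v 0 0 = 1 by lia.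
  by rewrite (vecE v) v0 v1 !inE eqxx.
by rewrite (vecE v) v0 v1 !inE eqxx orbT.
Qed.

Lemma lat_triangle v : v \in [:: vec 1 0; vec 0 1; vec 0 0] <->
  lat (hull [:: vec 1 0; vec 0 1; vec 0 0]) v.
Proof.
split=> [vs|hv]; first exact: hull_mem.
have h a b c := @lat_halfplane _ a b c v hv.
have h1 : 0 <= 1 * v 0 0 + 0 * v 1 0.
  by apply: h => w; rewrite !inE => /or3P[] /eqP ->; rewrite vec0 vec1.
have h2 : -1 <= -1 * v 0 0 + -1 * v 1 0.
  by apply: h => w; rewrite !inE => /or3P[] /eqP ->; rewrite vec0 vec1.
have h3 : 0 <= 0 * v 0 0 + 1 * v 1 0.
  by apply: h => w; rewrite !inE => /or3P[] /eqP ->; rewrite vec0 vec1.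
rewrite (vecE v) !inE.
have [[-> ->]|[[-> ->]|[-> ->]]] : (v 0 0 = 1 /\ v 1 0 = 0) \/
  (v 0 0 = 0 /\ v 1 0 = 1) \/ (v 0 0 = 0 /\ v 1 0 = 0) by lia.
- by rewrite eqxx.
- by rewrite eqxx orbT.
- by rewrite eqxx !orbT.
Qed.

Definition edge_seq (s r : seq pt) : seq (pt * pt) :=
  [seq e <- [seq (a, b) | a <- r, b <- r] |
    primitive (e.2 - e.1) && all (fun v => 0 <= det2 (e.2 - e.1) (v - e.1)) s].

Lemma edge_seqP (s r : seq pt) e : (forall v, v \in r <-> lat (hull s) v) ->
  e \in edge_seq s r <-> edge (hull s) e.
Proof.
case: e => a b rP; rewrite mem_filter /=; split.
  move=> /andP[/andP[pe /allP l] /allpairsP[[a' b'] /= [ar br [aE bE]]]].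
  rewrite -aE in ar; rewrite -bE in br.
  split=> //=; [exact: (iffLR (rP a) ar)|exact: (iffLR (rP b) br)|].
  exact: hull_nonneg_left.
move=> [/= pe ha hb l]; rewrite pe /=; apply/andP; split.
  apply/allP => v vs; have := l _ (@hull_mem R _ _ vs).
  by rewrite cr_pl ler0z.
by apply/allpairsP; exists (a, b); split=> //=; [exact: (iffRL (rP a) ha)|exact: (iffRL (rP b) hb)].
Qed.

Lemma prim_vec a b c d : primitive (vec a b - vec c d) = coprimez (a - c) (b - d).
Proof. by rewrite /primitive vecN vecD vec0 vec1. Qed.
Lemma det_vec a b c d e f : det2 (vec a b - vec c d) (vec e f - vec c d)
  = (a - c) * (f - d) - (b - d) * (e - c).
Proof. by rewrite /det2 !vecN !vecD !vec0 !vec1. Qed.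

Lemma vec_eq a b c d : (vec a b == vec c d) = (a == c) && (b == d).
Proof.
by apply/eqP/andP => [/vec_inj[-> ->]|[/eqP -> /eqP ->]].
Qed.

Lemma ssum_lat s (r : seq pt) F : uniq r -> (forall v, v \in r <-> lat (hull s) v) ->
  ssum (lat (hull s)) F = \sum_(v <- r) F v :> Qxy.
Proof. exact: ssumE. Qed.

Lemma ssum_edge s (r : seq pt) F : uniq r -> (forall v, v \in r <-> lat (hull s) v) ->
  ssum (edge (hull s)) F = \sum_(e <- edge_seq s r) F e :> Qxy.
Proof.
move=> ur rP; apply: ssumE => [|e]; last exact: edge_seqP.
by apply: filter_uniq; apply: allpairs_uniq => // -[a b] [c d].
Qed.

(** On integer coordinates the selection of edges is a computation, which produces the three lists
    below. *)
Lemma edge_seq_vec (s r : seq (int * int)) :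
  edge_seq [seq vec p.1 p.2 | p <- s] [seq vec p.1 p.2 | p <- r] =
  [seq (vec e.1.1 e.1.2, vec e.2.1 e.2.2) | e <- [seq (a, b) | a <- r, b <- r] &
    coprimez (e.2.1 - e.1.1) (e.2.2 - e.1.2) &&
    all (fun p => 0 <= (e.2.1 - e.1.1) * (p.2 - e.1.2) - (e.2.2 - e.1.2) * (p.1 - e.1.1)) s].
Proof.
rewrite /edge_seq allpairs_mapl allpairs_mapr.
rewrite -(map_allpairs (fun e => (vec e.1.1 e.1.2, vec e.2.1 e.2.2)) pair) filter_map.
congr map; apply: eq_filter => -[a b] /=; rewrite prim_vec all_map; congr andb.
by apply: eq_all => p /=; rewrite det_vec.
Qed.

Lemma edge_seq_point : edge_seq [:: vec 0 0] [:: vec 0 0] = [::].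
Proof. by have := edge_seq_vec [:: (0, 0)] [:: (0, 0)]. Qed.

Lemma edge_seq_segment :
  edge_seq [:: vec 0 0; vec 1 0] [:: vec 0 0; vec 1 0] =
  [:: (vec 0 0, vec 1 0); (vec 1 0, vec 0 0)].
Proof. exact: edge_seq_vec [:: (0, 0); (1, 0)] [:: (0, 0); (1, 0)]. Qed.

Lemma edge_seq_triangle :
  edge_seq [:: vec 1 0; vec 0 1; vec 0 0] [:: vec 1 0; vec 0 1; vec 0 0] =
  [:: (vec 1 0, vec 0 1); (vec 0 1, vec 0 0); (vec 0 0, vec 1 0)].
Proof.
exact: edge_seq_vec [:: (1, 0); (0, 1); (0, 0)] [:: (1, 0); (0, 1); (0, 0)].
Qed.

Lemma Zval_point al be : Zval al be (hull [:: vec 0 0]) = al (vec 0 0).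
Proof.
rewrite /Zval (ssum_lat _ _ lat_point) ?(ssum_edge _ _ lat_point) //.
by rewrite edge_seq_point big_seq1 big_nil addr0.
Qed.

Lemma Zval_segment al be : Zval al be (hull [:: vec 0 0; vec 1 0]) =
  al (vec 0 0) + al (vec 1 0) + (be (vec 0 0, vec 1 0) + be (vec 1 0, vec 0 0)).
Proof.
have ur : uniq [:: vec 0 0; vec 1 0] by rewrite /= inE vec_eq.
rewrite /Zval (ssum_lat _ ur lat_segment) (ssum_edge _ ur lat_segment).
by rewrite edge_seq_segment !big_cons !big_nil !addr0.
Qed.

Lemma Zval_triangle al be : Zval al be (hull [:: vec 1 0; vec 0 1; vec 0 0]) =
  al (vec 1 0) + al (vec 0 1) + al (vec 0 0) +
  (be (vec 1 0, vec 0 1) + be (vec 0 1, vec 0 0) + be (vec 0 0, vec 1 0)).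
Proof.
have ur : uniq [:: vec 1 0; vec 0 1; vec 0 0] by rewrite /= !inE !vec_eq.
rewrite /Zval (ssum_lat _ ur lat_triangle) (ssum_edge _ ur lat_triangle).
by rewrite edge_seq_triangle !big_cons !big_nil !addr0 !addrA.
Qed.

Lemma set0_hull : [set 0 : plane] = hull [:: vec 0 0].
Proof. by rewrite hull_point vec00 pl0. Qed.

(** * The part determined by the values at points and segments *)

Section Boundary.
Variables (c : rat) (g : fps rat).

(** The value prescribed for the segment from 0 to a primitive u, less that of its ends, which
    [point_term] counts already. *)
Definition seg_series (u : pt) : Qxy :=
  (f1_of g)@[u, 0] - cst c * (1 + ex (lin u)).

Lemma seg_seriesN u : ex (lin u) * seg_series (- u) = seg_series u.
Proof.
rewrite /seg_series mulrBr linN (@sub2_f1N g (lin u) (lin 0) (lin 0)) //.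
by rewrite mulrCA mulrDr mulr1 exN // [ex _ + 1]addrC.
Qed.

Definition point_term (p : pt) : Qxy := cst c * ex (lin p).
(** Half, because a segment has each of its primitive pieces as an edge in both orientations, with
    equal terms by [seg_term_swap]. *)
Definition seg_term (e : pt * pt) : Qxy :=
  cst 2^-1 * (ex (lin e.1) * seg_series (e.2 - e.1)).

Lemma seg_termE e : seg_term e = cst 2^-1 * (ex (lin e.1) * (f1_of g)@[e.2 - e.1, 0]
   - cst c * (ex (lin e.1) + ex (lin e.2))).
Proof.
rewrite /seg_term /seg_series mulrBr; congr (_ * (_ - _)).
by rewrite mulrCA mulrDr mulr1 -exD // -linD [e.1 + _]addrC subrK.
Qed.

Lemma seg_term_swap a b : seg_term (b, a) = seg_term (a, b).
Proof.
rewrite /seg_term /= -[in RHS]seg_seriesN opprB; congr (_ * _).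
by rewrite mulrA -exD // -linD [a + (b - a)]addrC subrK.
Qed.

Lemma seg_term_aff M t a b :
  affine_act M t (seg_term (a, b)) = seg_term (aff M t a, aff M t b).
Proof.
rewrite !seg_termE /= affine_act_cst affine_actB affine_act_cst affine_actD.
by rewrite !affine_act_ex affine_act_form mulmx0 affB.
Qed.

Definition Zboundary : set plane -> Qxy := Zval point_term seg_term.

Lemma Zboundary_valuation : valuation Zboundary.
Proof. exact: Zval_valuation. Qed.

Lemma Zboundary_equivariant : equivariant Zboundary.
Proof.
apply: Zval_equivariant => M t e uM.
  by rewrite /point_term affine_act_cst affine_act_ex.
case: e => a b; rewrite seg_term_aff /eaff /=.
by case: ifP => _; [reflexivity|exact: seg_term_swap].
Qed.

Lemma cst2 f : cst 2^-1 * f + cst 2^-1 * f = f.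
Proof. by rewrite -mulrDl -cstD (_ : 2^-1 + 2^-1 = 1) ?cst1 ?mul1r. Qed.

Lemma Zboundary_point : Zboundary [set 0] = cst c.
Proof. by rewrite set0_hull /Zboundary Zval_point /point_term vec00 lin0 ex0 mulr1. Qed.

Lemma f1_of_e1 : sub2 (f1_of g) (lin (vec 1 0)) 0 = f1_of g.
Proof. by rewrite -vx_lin f1_of_sub2. Qed.

Lemma Zboundary_segment : Zboundary (hull [:: vec 0 0; vec 1 0]) = f1_of g.
Proof.
rewrite /Zboundary Zval_segment (seg_term_swap (vec 0 0)) seg_termE /= !vec00 subr0 lin0 f1_of_e1.
rewrite cst2 /point_term lin0 ex0; ring.
Qed.

Lemma Zboundary_triangle :
  Zboundary (hull [:: vec 1 0; vec 0 1; vec 0 0]) = boundary_part (f1_of g).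
Proof.
rewrite /Zboundary Zval_triangle (seg_term_swap (vec 0 0)) !seg_termE /= /point_term vec00.
rewrite !subr0 lin0 ex0 !mul1r.
have -> : vec 0 1 - vec 1 0 = vec (-1) 1 by rewrite vecN vecD.
rewrite /boundary_part !sub2E !fexpE.
have -> : sub2 (f1_of g) vy (- vx) = (f1_of g)@[vec 0 1, 0].
  by rewrite -vy_lin !sub2_f1 //; auto.
have -> : sub2 (f1_of g) (- vx + vy) (- vx) = (f1_of g)@[vec (-1) 1, 0].
  by rewrite linE mulrN1z mulr1z !sub2_f1 //; auto.
rewrite !lin0 f1_of_e1 -vx_lin -vy_lin.
set A := sub2 _ (lin (vec (-1) 1)) 0; set B := sub2 _ vy 0.
set X := ex vx; set Y := ex vy; set F := f1_of g.
(* Each vertex lies on two edges, whose halved corrections cancel its own weight c. *)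
have h : cst c = cst 2^-1 * cst c + cst 2^-1 * cst c by rewrite cst2.
have -> : cst c * X + cst c * Y + cst c * 1 =
  cst 2^-1 * (cst c * (X + Y)) + cst 2^-1 * (cst c * (1 + Y)) + cst 2^-1 * (cst c * (1 + X)).
  by rewrite {1 2 3}h; ring.
ring.
Qed.
End Boundary.

(** * The simple part attached to rho *)

Section Simple.
Variables rho f2 : Qxy.
Hypotheses (rhoD4 : D4_invariant rho) (rhoE : rho_equation rho).
Hypothesis f2E : is_f2 rho f2.

Definition tri_term (e : pt * pt) : Qxy := tri rho 0 e.1 e.2.
Definition Zsimple : set plane -> Qxy := Zval (fun=> 0) tri_term.

Lemma Zsimple_valuation : valuation Zsimple.
Proof. exact: Zval_valuation. Qed.

Lemma ssum0 (I : choiceType) (A : set I) : ssum A (fun=> 0 : Qxy) = 0.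
Proof. exact: big1. Qed.

(** The image of the base point 0 is a new base point, and the resulting differences of phi cancel
    by [edge_balance]. For determinant -1, the sign in [tri_equivariant] is undone by the exchange
    of ends in [eaff]. *)
Lemma Zsimple_equivariant : equivariant Zsimple.
Proof.
move=> P M t /lattice_polygonP[s ->] uM.
have polP : is_polygon (hull s) by exists s.
rewrite /Zsimple /Zval !ssum0 !add0r ssum_edge_affine //.
rewrite (ssum_morph _ _ (affine_actD M t) (affine_act0 M t)).
have fE := fin_edge (@fin_lat R s).
pose phi p := tri rho 0 (aff M t 0) (aff M t p) *~ \det M.
have bal := @edge_balance R s phi.
rewrite -[RHS]addr0 -bal -ssumD; apply: eq_ssum => // -[a b] _ /=.
have step x y : tri rho 0 (aff M t x) (aff M t y) =
    tri rho (aff M t 0) (aff M t x) (aff M t y) +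
    (tri rho 0 (aff M t 0) (aff M t y) - tri rho 0 (aff M t 0) (aff M t x)).
  exact: (tri_base rhoD4 rhoE f2E).
have eq x y := tri_equivariant rhoD4 rhoE f2E t 0 x y uM.
rewrite /tri_term /eaff /phi; case: (unitmx_det uM) => dM; rewrite dM /=.
  by rewrite step eq dM !mulr1z.
rewrite step eq dM !mulrN1z (tri_anti rhoD4 rhoE f2E 0 a b).
by rewrite affine_actN !opprK; congr (_ + _); rewrite addrC.
Qed.

Lemma Zsimple_point : Zsimple [set 0] = 0.
Proof. by rewrite set0_hull /Zsimple Zval_point. Qed.

Lemma Zsimple_segment : Zsimple (hull [:: vec 0 0; vec 1 0]) = 0.
Proof.
rewrite /Zsimple Zval_segment !add0r /tri_term /=.
by rewrite (tri_anti rhoD4 rhoE f2E 0 (vec 1 0)) addNr.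
Qed.

(** Edges through the base point 0 give degenerate triangles; only the edge from e1 to e2
    contributes. *)
Lemma Zsimple_triangle : Zsimple (hull [:: vec 1 0; vec 0 1; vec 0 0]) = f2.
Proof.
rewrite /Zsimple Zval_triangle !add0r /tri_term /= vec00.
rewrite (tri_T rhoD4 rhoE f2E) (tri_anti rhoD4 rhoE f2E 0 0) !(tri_refl rhoD4 rhoE f2E).
by rewrite oppr0 !addr0.
Qed.
End Simple.

Lemma converse_part (c : rat) (g : fps rat) (rho : Qxy) :
  D4_invariant rho -> rho_equation rho ->
  exists f2 : Qxy, is_f2 rho f2 /\
    exists Z : set plane -> Qxy,
      [/\ valuation Z, equivariant Z,
          Z [set 0] = cst c,
          Z (hull [:: o; e1]) = f1_of g &
          Z (T R) = f2 + boundary_part (f1_of g)].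
Proof.
move=> rhoD4 rhoE; have [f2 f2E] := exists_f2 rhoD4; exists f2; split=> //.
exists (fun P => Zboundary c g P + Zsimple rho P); split.
- move=> P Q lP lQ PQ; rewrite addrACA [RHS]addrACA.
  by congr (_ + _); [apply: Zboundary_valuation|apply: Zsimple_valuation].
- move=> P M t lP uM; rewrite affine_actD.
  congr (_ + _); first exact: Zboundary_equivariant.
  exact: (Zsimple_equivariant rhoD4 rhoE f2E).
- by rewrite Zboundary_point Zsimple_point addr0.
- rewrite oE e1E Zboundary_segment (Zsimple_segment rhoD4 rhoE f2E).
  by rewrite addr0.
- rewrite /T oE e1E e2E Zboundary_triangle (Zsimple_triangle rhoD4 rhoE f2E).
  by rewrite addrC.
Qed.
End Values.

(** * Decomposition of an arbitrary equivariant valuation *)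

Definition mxc (u w : pt) : 'M[int]_2 := mx2 (u 0 0) (w 0 0) (u 1 0) (w 1 0).

Lemma col0_mxc u w : col 0 (mxc u w) = u.
Proof. by apply: ptP; rewrite !mxE. Qed.
Lemma col1_mxc u w : col 1 (mxc u w) = w.
Proof. by apply: ptP; rewrite !mxE. Qed.

Lemma affine_act_mxc u w t f :
  affine_act (mxc u w) t f = ex (lin t) * f@[u, w].
Proof. by rewrite affine_actE col0_mxc col1_mxc. Qed.

Lemma aff_mxc u w t a b : aff (mxc u w) t (vec a b) = t + (a *: u + b *: w).
Proof.
rewrite /aff mulmx2E col0_mxc col1_mxc addrC; congr (_ + _).
by apply: ptP; rewrite ?vec0 ?vec1 !mxE /= ?vec0 ?vec1 mulrC [w _ _ * _]mulrC.
Qed.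

Lemma mxc_unit u w : `|det2 u w| = 1 -> mxc u w \in unitmx.
Proof.
move=> d; rewrite unitmxE; have -> : \det (mxc u w) = det2 u w.
  by rewrite detM2 !mxE /= /det2 mulrC [w _ _ * _]mulrC mulrC; ring.
by apply/orP; have [->|->] : det2 u w = 1 \/ det2 u w = -1 by [lia]; [left|right].
Qed.

Lemma primitive_basis v : primitive v -> exists w, det2 v w = 1.
Proof.
move=> /primitiveP[x [y xy]]; exists (vec (- y) x).
by rewrite /det2 vec0 vec1 -xy; ring.
Qed.

Lemma affine_act_mul M N f :
  affine_act (M *m N) 0 f = affine_act M 0 (affine_act N 0 f).
Proof.
rewrite !affine_actE lin0 ex0 !mul1r sub2_comp // !sub2_lin -!mulmx2E.
have colM j : col j (M *m N) = M *m col j N.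
  by apply/matrixP => i k; rewrite !mxE; apply: eq_bigr => l _; rewrite !mxE.
by rewrite !colM.
Qed.

Lemma affine_act1 f : affine_act 1%:M 0 f = f.
Proof.
rewrite affine_actE lin0 ex0 mul1r -[RHS]sub2_id; congr sub2.
  by rewrite vx_lin; congr lin; apply: ptP; rewrite !mxE.
by rewrite vy_lin; congr lin; apply: ptP; rewrite !mxE.
Qed.

Lemma generated_invariant (S : set 'M[int]_2) f :
  (forall M, S M -> affine_act M 0 f = f) ->
  forall M, generated S M -> affine_act M 0 f = f.
Proof.
move=> Sf M; elim=> [N /Sf //||N L _ NE _ LE|N _ NE].
- exact: affine_act1.
- by rewrite affine_act_mul LE NE.
(* [invmx] leaves a non-invertible matrix unchanged. *)
- have [uN|nN] := boolP (N \in unitmx); last by rewrite invmx_out.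
  transitivity (affine_act (invmx N *m N) 0 f); last by rewrite (mulVmx uN) affine_act1.
  by rewrite affine_act_mul NE.
Qed.

(** ** Recovering rho from the value at the standard triangle *)

Section RecoverRho.
Variable F : Qxy.
Local Notation f u w := (F@[u, w]).
Local Notation X u := (ex (lin u)).
Let x := vec 1 0.
Let y := vec 0 1.

(** The first two hypotheses are affine symmetries generating all permutations of the vertices of
    the standard triangle; the third cuts the unit square along each of its diagonals. *)
Hypothesis F_sym : f y x = F.
Hypothesis F_rot : X y * f (- y) (x - y) = F.
Hypothesis F_flip : F + X (x + y) * f (- x) (- y) = f x (x + y) + f y (x + y).

Let lincombx u w : lincomb u w x = u.
Proof. by apply: ptP; rewrite !mxE /= ?mulr1 ?mulr0 ?addr0. Qed.
Let lincomby u w : lincomb u w y = w.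
Proof. by apply: ptP; rewrite !mxE /= ?mulr1 ?mulr0 ?add0r. Qed.
Let lincombD u w a b : lincomb u w (a + b) = lincomb u w a + lincomb u w b.
Proof. by apply: ptP; rewrite !mxE /=; ring. Qed.
Let lincombN u w a : lincomb u w (- a) = - lincomb u w a.
Proof. by apply: ptP; rewrite !mxE /=; ring. Qed.

Let fsub a b u w : (f a b)@[u, w] = f (lincomb u w a) (lincomb u w b).
Proof. by rewrite sub2_comp // !sub2_lin. Qed.
Let Xsub a u w : (X a)@[u, w] = X (lincomb u w a).
Proof. by rewrite sub2_ex // sub2_lin. Qed.

Let fC u w : f u w = f w u.
Proof. by rewrite -[in LHS]F_sym fsub lincombx lincomby. Qed.

Let f_rot u w : f u w = X w * f (- w) (u - w).
Proof.
rewrite -[in LHS]F_rot sub2M // Xsub fsub lincombD !lincombN lincombx lincomby.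
by [].
Qed.

Let f_flip u w : f u w + X (u + w) * f (- u) (- w) = f u (u + w) + f w (u + w).
Proof.
have := congr1 (fun h => h@[u, w]) F_flip.
rewrite (sub2D _ _ F) (sub2D _ _ (f x (x + y))) (sub2M _ _ (X (x + y))) //.
by rewrite !fsub Xsub !lincombN !lincombD lincombx lincomby.
Qed.

Let f_base u w : f u w = X u * f (- u) (w - u).
Proof. by rewrite fC f_rot. Qed.

Let XD u w : X (u + w) = X u * X w.
Proof. by rewrite linD exD. Qed.
Let XN u : X u * X (- u) = 1.
Proof. by rewrite linN exN. Qed.

(* The value at the parallelogram spanned by u and w. *)
Definition sq u w : Qxy := f u w + X (u + w) * f (- u) (- w).

Let sqC u w : sq u w = sq w u.
Proof. by rewrite /sq fC [f (- u) _]fC [u + w]addrC. Qed.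

(** Translated by u, the parallelogram of - u and w is that of u and w, cut along the other
    diagonal. *)
Let sqN u w : X u * sq (- u) w = sq u w.
Proof.
rewrite [RHS]f_flip /sq opprK.
rewrite (f_base u (u + w)) (f_base w (u + w)) addrK [u + w - u]addrC addrA addNr add0r.
rewrite [f (- w) u]fC mulrDr; congr (_ + _).
by rewrite mulrA XD mulrA XN mul1r.
Qed.

(** The parallelogram of u and u + w consists of the triangle (0, u, u + w) and the translate by u
    of (0, w, u + w). *)
Let sq_shift u w : sq u (u + w) = f u (u + w) + X u * f w (u + w).
Proof.
rewrite /sq; congr (_ + _); rewrite [f w _]f_rot XD -mulrA; congr (_ * (_ * _)).
by rewrite fC [u + w]addrC opprD addrA subrr add0r.
Qed.

(** All three parallelograms are made of translates of the triangles (0, u, u + w) and (0, w, u +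
    w). Divided by the product of e^u - 1, e^w - 1 and e^(u+w) - 1, this is the additivity of
    tau. *)
Let sq_split u w :
  (X (u + w) - 1) * sq u w = (X w - 1) * sq u (u + w) + (X u - 1) * sq w (u + w).
Proof.
have E : sq w (u + w) = f w (u + w) + X w * f u (u + w).
  by rewrite [u + w]addrC sq_shift.
by rewrite sq_shift E {1}/sq f_flip XD; ring.
Qed.

(** The parallelograms 0, u, u + w, w and u, w, 2 w, u + w share the triangle (u, w, u + w). What
    remains is (0, u, w) and its translate by w. *)
Let sq_f2 u w : (X w - 1) * f u w = X u * sq (w - u) w - sq u w.
Proof.
rewrite /sq mulrDr mulrA -XD addrA [u + (w - u)]addrC subrK opprB.
have -> : X u * f (w - u) w = X (u + w) * f (- u) (- w).
  rewrite f_rot XD -mulrA; congr (_ * (_ * _)); rewrite fC; congr (sub2 _ (lin _) _).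
  by rewrite addrAC subrr add0r.
have -> : X (w + w) * f (u - w) (- w) = X w * f u w.
  by rewrite [in RHS]f_rot XD -mulrA [f (u - w) _]fC.
ring.
Qed.

(** The Bernoulli series u / (e^u - 1); see [lin_Ei]. *)
Definition Ei u : Qxy := inv1 (ex1 (lin u)).

Let EiP u : ex1 (lin u) * Ei u = 1.
Proof. by rewrite /Ei inv1P //; apply: order_ge_ex1. Qed.

Let EiN u : Ei (- u) = X u * Ei u.
Proof.
have := ex1N (order_ge_lin u); rewrite -linN => E.
rewrite -[LHS]mulr1 -(EiP u) -E.
transitivity (X u * Ei u * (ex1 (lin (- u)) * Ei (- u))); first by ring.
by rewrite EiP mulr1.
Qed.

Let lin_Ei u : (X u - 1) * Ei u = lin u.
Proof. by rewrite -ex_ex1 // -mulrA EiP mulr1. Qed.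

(** The product u w tau(u, w), where tau(u, w) = s(u, w) / ((e^u - 1) (e^w - 1)), written without
    fractions. *)
Definition sigma_of u w : Qxy := sq u w * (Ei u * Ei w).

Let sigma_ofC u w : sigma_of u w = sigma_of w u.
Proof. by rewrite /sigma_of sqC [Ei u * _]mulrC. Qed.
Let sigma_ofN u w : sigma_of (- u) w = sigma_of u w.
Proof. by rewrite /sigma_of EiN -(sqN u) -!mulrA mulrCA. Qed.

(** The solution of rho(a, b - a) = sigma(a, b), as [rho_sub] confirms. *)
Definition rho_of : Qxy := sigma_of x (x + y).

Let rho_sub u w : rho_of@[u, w - u] = sigma_of u w.
Proof.
rewrite /rho_of /sigma_of /sq /Ei sub2M // (sub2D _ _ (f x (x + y))).
rewrite (sub2M _ _ (X _)) // (sub2M _ _ (inv1 _)) // !fsub Xsub.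
rewrite !sub2_inv1 ?sub2_ex1 // ?sub2_lin; try by apply: order_ge_ex1.
by rewrite !lincombN !lincombD lincombx lincomby [u + (w - u)]addrC subrK.
Qed.

Let rho_subD u w : rho_of@[u, w] = sigma_of u (u + w).
Proof. by rewrite -rho_sub addrAC subrr add0r. Qed.

Lemma rho_of_D4 : D4_invariant rho_of.
Proof.
apply: generated_invariant => M /= ME.
have -> : affine_act M 0 rho_of = rho_of@[col 0 M, col 1 M].
  by rewrite affine_actE lin0 ex0 mul1r.
have xy : x + y = vec 1 1 by rewrite vecD.
case: ME => ->.
  have -> : col 0 (mx2 1 0 1 (-1)) = vec 1 1 by apply: ptP; rewrite !mxE.
  have -> : col 1 (mx2 1 0 1 (-1)) = vec 0 (-1) by apply: ptP; rewrite !mxE.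
  by rewrite rho_subD vecD sigma_ofC /rho_of xy.
have -> : col 0 (mx2 1 (-2) 0 (-1)) = vec 1 0 by apply: ptP; rewrite !mxE.
have -> : col 1 (mx2 1 (-2) 0 (-1)) = vec (-2) (-1) by apply: ptP; rewrite !mxE.
rewrite rho_subD vecD /rho_of xy (_ : vec (1 + -2) (0 + -1) = - vec 1 1).
  by rewrite sigma_ofC sigma_ofN sigma_ofC.
by rewrite vecN.
Qed.

Lemma rho_of_equation : rho_equation rho_of.
Proof.
rewrite /rho_equation !sub2E.
have xE : vx = lin x by exact: vx_lin.
have yE : vy = lin y by exact: vy_lin.
have -> : vx *+ 2 + vy = lin (x + (x + y)) by rewrite !linD addrA -mulr2n -xE -yE.
have -> : vx + vy = lin (x + y) by rewrite linD xE yE.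
rewrite xE !rho_subD [x + y + x]addrC {1}/rho_of.
move: (x + y) => w; rewrite /sigma_of -(lin_Ei (x + w)) -(lin_Ei w) -(lin_Ei x).
transitivity ((X (x + w) - 1) * sq x w * (Ei (x + w) * Ei x * Ei w)); first by ring.
by rewrite sq_split; ring.
Qed.

Lemma rho_of_f2 : is_f2 rho_of F.
Proof.
rewrite /is_f2 !sub2E !fexpE !fexp1E.
have xE : vx = lin x by exact: vx_lin.
have yE : vy = lin y by exact: vy_lin.
have F_id : F = f x y by rewrite -xE -yE sub2_id.
rewrite xE yE -linB [in LHS]F_id !rho_subD subrK [x + (y - x)]addrC subrK /sigma_of.
transitivity ((X y - 1) * f x y * Ei y); first by rewrite mulrAC lin_Ei.
rewrite sq_f2.
transitivity ((ex1 (lin (y - x)) * Ei (y - x)) * (X x * sq (y - x) y * Ei y)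
  - (ex1 (lin x) * Ei x) * (sq x y * Ei y)); last by ring.
by rewrite !EiP; ring.
Qed.
End RecoverRho.

Section Decomposition.
Variable R : realType.
Local Notation plane := 'cV[R]_2.
Local Notation pl := (@to_plane R).
Local Notation hull := (@hull R).
Implicit Types (p q : plane) (s : seq pt).

Lemma plv a b : pl (vec a b) = pvec a%:~R b%:~R.
Proof. by apply: planeP; rewrite ?pvec0 ?pvec1 plE ?vec0 ?vec1. Qed.

Lemma hull_pairP (a b : pt) p :
  hull [:: a; b] p <-> exists t, [/\ 0 <= t, t <= 1 & p = mix t (pl a) (pl b)].
Proof.
split=> [|[t [t0 t1 ->]]]; last by apply: cvx_hull => //; apply: hull_mem; rewrite !inE eqxx ?orbT.
apply: (@hull_sub R [:: a; b] [set p | exists t, [/\ 0 <= t, t <= 1 & p = mix t (pl a) (pl b)]]).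
  move=> _ _ r [t [t0 t1 ->]] [u [u0 u1 ->]] r0 r1; exists (r * t + (1 - r) * u).
  split; [nra|nra|].
  by apply: planeP; rewrite !mixE; ring.
move=> v; rewrite !inE => /orP[] /eqP ->; [exists 1|exists 0];
  by split; rewrite ?mix1 ?mix0 ?lexx ?ler01.
Qed.

Lemma hull_tripleP (a b c : pt) p :
  hull [:: a; b; c] p <-> exists x y, [/\ 0 <= x, 0 <= y, x + y <= 1 &
    p = x *: pl a + y *: pl b + (1 - x - y) *: pl c].
Proof.
split=> [|[x [y [x0 y0 xy ->]]]].
  apply: (@hull_sub R [:: a; b; c] [set p | exists x y, [/\ 0 <= x, 0 <= y, x + y <= 1 &
    p = x *: pl a + y *: pl b + (1 - x - y) *: pl c]]).
    move=> _ _ r [x [y [x0 y0 xy ->]]] [x' [y' [x0' y0' xy' ->]]] r0 r1.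
    exists (r * x + (1 - r) * x'), (r * y + (1 - r) * y'); split; [nra|nra|nra|].
    by apply: planeP; rewrite mixE !mxE; ring.
  move=> v; rewrite !inE => /or3P[] /eqP ->;
    [exists 1, 0|exists 0, 1|exists 0, 0]; split; rewrite ?lexx ?ler01 ?addr0 ?add0r //;
    by apply: planeP; rewrite !mxE; ring.
have ha : hull [:: a; b; c] (pl a) by apply: hull_mem; rewrite !inE eqxx.
have hb : hull [:: a; b; c] (pl b) by apply: hull_mem; rewrite !inE eqxx orbT.
have hc : hull [:: a; b; c] (pl c) by apply: hull_mem; rewrite !inE eqxx !orbT.
have [xy0|xy0] := eqVneq (x + y) 0.
  have [-> ->] : x = 0 /\ y = 0 by split; lra.
  by rewrite !scale0r !add0r !subr0 scale1r.
have xyp : 0 < x + y by rewrite lt0r xy0 addr_ge0.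
have -> : x *: pl a + y *: pl b + (1 - x - y) *: pl c =
    mix (x + y) (mix (x / (x + y)) (pl a) (pl b)) (pl c).
  by apply: planeP; rewrite !mixE !mxE; field.
apply: cvx_hull => //; last exact: ltW.
apply: cvx_hull => //; first by rewrite divr_ge0 // ltW.
by rewrite ler_pdivrMr // mul1r; lra.
Qed.

(** * The unit square and its two diagonals *)

Definition box : set plane := [set p | [/\ 0 <= p 0 0, p 0 0 <= 1, 0 <= p 1 0 & p 1 0 <= 1]].

Lemma cvx_box : cvx box.
Proof.
move=> p q t [p1 p2 p3 p4] [q1 q2 q3 q4] t0 t1; rewrite /box /= !mixE.
by split; nra.
Qed.

Local Notation x := (vec 1 0).
Local Notation y := (vec 0 1).
Local Notation z := (vec 0 0).
Local Notation xy := (vec 1 1).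

Ltac in_triple u v := apply/hull_tripleP; exists u, v;
  split; [lra|lra|lra|]; by apply: planeP; rewrite !mxE /=; ring.
Ltac from_triple := move=> /hull_tripleP[a [b [a0 b0 ab ->]]]; rewrite !mxE /=.

Lemma triangle_xyz p : hull [:: x; y; z] p <->
  [/\ 0 <= p 0 0, 0 <= p 1 0 & p 0 0 + p 1 0 <= 1].
Proof.
split=> [|[p0 p1 p01]]; last by in_triple (p 0 0) (p 1 0).
by from_triple; split; lra.
Qed.

Lemma triangle_xyxy p : hull [:: x; y; xy] p <->
  [/\ p 0 0 <= 1, p 1 0 <= 1 & 1 <= p 0 0 + p 1 0].
Proof.
split=> [|[p0 p1 p01]]; last by in_triple (1 - p 1 0) (1 - p 0 0).
by from_triple; split; lra.
Qed.

Lemma triangle_xxyz p : hull [:: x; xy; z] p <->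
  [/\ p 0 0 <= 1, 0 <= p 1 0 & p 1 0 <= p 0 0].
Proof.
split=> [|[p0 p1 p01]]; last by in_triple (p 0 0 - p 1 0) (p 1 0).
by from_triple; split; lra.
Qed.

Lemma triangle_yxyz p : hull [:: y; xy; z] p <->
  [/\ 0 <= p 0 0, p 1 0 <= 1 & p 0 0 <= p 1 0].
Proof.
split=> [|[p0 p1 p01]]; last by in_triple (p 1 0 - p 0 0) (p 0 0).
by from_triple; split; lra.
Qed.

Lemma square_xy : hull [:: x; y; z] `|` hull [:: x; y; xy] = box.
Proof.
apply/seteqP; split=> p.
  by case=> [/triangle_xyz[h1 h2 h3]|/triangle_xyxy[h1 h2 h3]]; rewrite /box /=; split; lra.
move=> [h1 h2 h3 h4]; have [h|h] := leP (p 0 0 + p 1 0) 1.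
  by left; apply/triangle_xyz.
by right; apply/triangle_xyxy; split=> //; exact: ltW.
Qed.

Lemma square_diag : hull [:: x; xy; z] `|` hull [:: y; xy; z] = box.
Proof.
apply/seteqP; split=> p.
  by case=> [/triangle_xxyz[h1 h2 h3]|/triangle_yxyz[h1 h2 h3]]; rewrite /box /=; split; lra.
move=> [h1 h2 h3 h4]; have [h|h] := leP (p 1 0) (p 0 0).
  by left; apply/triangle_xxyz.
by right; apply/triangle_yxyz; split=> //; exact: ltW.
Qed.

Lemma square_xy_meet : hull [:: x; y; z] `&` hull [:: x; y; xy] = hull [:: x; y].
Proof.
apply/seteqP; split=> p.
  move=> [/triangle_xyz[h1 h2 h3] /triangle_xyxy[h4 h5 h6]].
  apply/hull_pairP; exists (p 0 0); split=> //.
  by apply: planeP; rewrite !mxE /=; lra.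
move=> /hull_pairP[t [t0 t1 ->]]; split; [apply/triangle_xyz|apply/triangle_xyxy];
  by rewrite !mxE /=; split; lra.
Qed.

Lemma square_diag_meet : hull [:: x; xy; z] `&` hull [:: y; xy; z] = hull [:: z; xy].
Proof.
apply/seteqP; split=> p.
  move=> [/triangle_xxyz[h1 h2 h3] /triangle_yxyz[h4 h5 h6]].
  apply/hull_pairP; exists (1 - p 0 0); split; [lra|lra|].
  by apply: planeP; rewrite !mxE /=; lra.
move=> /hull_pairP[t [t0 t1 ->]]; split; [apply/triangle_xxyz|apply/triangle_yxyz];
  by rewrite !mxE /=; split; lra.
Qed.

Lemma segment_xP (n m : int) p : n <= m -> hull [:: vec n 0; vec m 0] p <->
  [/\ n%:~R <= p 0 0, p 0 0 <= m%:~R & p 1 0 = 0].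
Proof.
move=> nm; have nmR : n%:~R <= m%:~R :> R by rewrite ler_int.
split=> [/hull_pairP[t [t0 t1 ->]]|[h1 h2 h3]].
  by rewrite !mxE /=; split; [nra|nra|ring].
apply/hull_pairP; have [nm'|nm'] := eqVneq (n%:~R : R) m%:~R.
  exists 0; rewrite mix0 lexx ler01; split=> //; apply: planeP; rewrite !mxE /=; last by [].
  by apply/eqP; rewrite eq_le h2 -nm'.
have lt : 0 < (m%:~R - n%:~R : R) by rewrite subr_gt0 lt_neqAle nm' nmR.
exists ((m%:~R - p 0 0) / (m%:~R - n%:~R)); split.
- by rewrite divr_ge0 ?(ltW lt) // subr_ge0.
- by rewrite ler_pdivrMr // mul1r lerD2l lerN2.
- by apply: planeP; rewrite !mxE /= ?h3; field; rewrite gt_eqF.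
Qed.

(** * Equivariant valuations on points, segments and triangles *)

Section Equivariant.
Variable Z : set plane -> Qxy.
Hypotheses (Zv : valuation Z) (Ze : equivariant Z).

Lemma hull_polygon a s : lattice_polygon (hull (a :: s)).
Proof. by exists (a :: s). Qed.

Lemma Z_frame u w t a s : `|det2 u w| = 1 ->
  Z (hull (map (aff (mxc u w) t) (a :: s))) = ex (lin t) * (Z (hull (a :: s)))@[u, w].
Proof.
move=> d; rewrite -affine_map_hull Ze; last by apply: mxc_unit.
  exact: affine_act_mxc.
exact: hull_polygon.
Qed.

Lemma Z_point : Z [set 0] = cst (coefxy (Z [set 0]) 0 0).
Proof.
have inv u w : `|det2 u w| = 1 -> (Z [set 0])@[u, w] = Z [set 0].
  move=> d; have := Z_frame 0 z [::] d; rewrite lin0 ex0 mul1r.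
  by rewrite /= aff_mxc !scale0r !addr0 -vec00 -!set0_hull.
apply: const_invariant.
  have -> : vx + vy = lin xy by rewrite linE !mulr1z.
  by rewrite vx_lin inv // /det2 !vec0 !vec1.
by rewrite vx_lin vy_lin inv // /det2 !vec0 !vec1.
Qed.

(** The shear fixing e1 fixes the segment and rules out powers of y; the reflection exchanging its
    ends gives the functional equation of [f1_of_reflection]. *)
Lemma Z_segment : exists g, Z (hull [:: z; x]) = f1_of g.
Proof.
apply: f1_of_reflection.
  apply: shear_invariant.
  have -> : vx + vy = lin xy by rewrite linE !mulr1z.
  have d : `|det2 x xy| = 1 by rewrite /det2 !vec0 !vec1.
  have := Z_frame 0 z [:: x] d; rewrite lin0 ex0 mul1r -vx_lin => <-.
  by rewrite /= !aff_mxc !scale0r !addr0 scale1r !add0r vec00.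
have d : `|det2 (- x) y| = 1 by rewrite vecN /det2 !vec0 !vec1.
have := Z_frame x z [:: x] d; rewrite -vx_lin linN -vx_lin -vy_lin => <-.
rewrite /= !aff_mxc !scale0r !addr0 scale1r subrr -vec00; congr (Z _).
by apply: hull_eq => v; rewrite !inE orbC.
Qed.

Hypotheses (Z0 : Z [set 0] = 0) (Z1 : Z (hull [:: z; x]) = 0).

Lemma Z_vertex v : Z (hull [:: v]) = 0.
Proof.
have d : `|det2 x y| = 1 by rewrite /det2 !vec0 !vec1.
have := Z_frame v z [::] d; rewrite -set0_hull Z0 sub2_0 mulr0 => <-.
by rewrite /= aff_mxc !scale0r !addr0.
Qed.

Lemma Z_long_segment (n : nat) : Z (hull [:: z; vec n 0]) = 0.
Proof.
elim: n => [|n IHn].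
  by rewrite -(Z_vertex z); congr (Z _); apply: hull_eq => v; rewrite !inE orbb.
have cup : hull [:: z; vec n 0] `|` hull [:: vec n 0; vec n.+1 0] = hull [:: z; vec n.+1 0].
  apply/seteqP; split=> p.
    case=> /segment_xP[|h1 h2 h3]; try by lia.
      apply/segment_xP; first by lia.
      by split=> //; apply: (le_trans h2); rewrite ler_int; lia.
    apply/segment_xP; first by lia.
    by split=> //; apply: le_trans h1; rewrite ler_int.
  move=> /segment_xP[|h1 h2 h3]; first by lia.
  have [h|h] := leP (p 0 0) n%:Z%:~R; [left|right]; apply/segment_xP => //; first by lia.
  by split=> //; exact: ltW.
have cap : hull [:: z; vec n 0] `&` hull [:: vec n 0; vec n.+1 0] = hull [:: vec n 0].
  apply/seteqP; split=> p.
    move=> [/segment_xP[|h1 h2 h3]]; first by lia.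
    move=> /segment_xP[|h4 h5 h6]; first by lia.
    rewrite hull_point plv; apply: planeP; rewrite ?pvec0 ?pvec1 //.
    by apply/eqP; rewrite eq_le h2 h4.
  by move=> hp; split; apply: hull_subset hp => v; rewrite !inE => ->; rewrite ?orbT.
have := Zv (hull_polygon z [:: vec n 0]) (hull_polygon (vec n 0) [:: vec n.+1 0]).
rewrite cup cap IHn Z_vertex addr0 add0r => ->; last by apply/cvxP; exact: cvx_hull.
have d : `|det2 x y| = 1 by rewrite /det2 !vec0 !vec1.
have := Z_frame (vec n 0) z [:: x] d; rewrite Z1 sub2_0 mulr0 => <-; congr (Z _).
rewrite /= !aff_mxc !scale0r !addr0 scale1r; congr (hull [:: _; _]).
by rewrite vecD; congr vec; lia.
Qed.

Lemma Z_lattice_segment v (a : pt) (k : int) : primitive v -> 0 <= k ->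
  Z (hull [:: a; a + k *: v]) = 0.
Proof.
move=> pv k0; have [w d] := primitive_basis pv.
have d1 : `|det2 v w| = 1 by rewrite d.
have := Z_frame a z [:: vec (absz k) 0] d1; rewrite Z_long_segment sub2_0 mulr0 => <-.
by rewrite /= !aff_mxc !scale0r !addr0 gez0_abs.
Qed.

Lemma dim_collinear s : (Defs.dim (hull s) <= 1)%N ->
  forall a b c, a \in s -> b \in s -> c \in s -> det2 (b - a) (c - a) = 0.
Proof.
move=> dim1 a b c as_ bs cs; apply/eqP/negPn/negP => d.
suff : (2 <= Defs.dim (hull s))%N by lia.
have i2 : (2 < 3)%N by [].
rewrite /Defs.dim; apply: (@leq_bigmax_cond _ _ (fun k : 'I_3 => k : nat) (Ordinal i2)).
apply/asboolP; exists (pl a), [tuple pl (b - a); pl (c - a)]; split.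
- exact: hull_mem.
- rewrite free_cons span_seq1; apply/andP; split; last first.
    rewrite free_cons span_nil memv0 nil_free andbT.
    apply: contraNneq d => E; have -> : c - a = 0 by apply: (@pl_inj R); rewrite E pl0.
    by rewrite /det2 !mxE !mulr0.
  apply/negP => /vlineP[k E]; move/eqP: d; apply.
  apply/eqP; rewrite -(intr_eq0 R) -cr_pl /cr.
  have E0 := congr1 (fun p : plane => p 0 0) E; have E1 := congr1 (fun p : plane => p 1 0) E.
  move: E0 E1; rewrite !plD !plN !mxE => -> ->; apply/eqP; ring.
- move=> v; rewrite !inE => /orP[] /eqP ->; rewrite -plD addrC subrK;
  exact: hull_mem.
Qed.

Lemma int_extremes (s : seq int) : s != [::] ->
  exists m n, [/\ m \in s, n \in s & forall k, k \in s -> m <= k <= n].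
Proof.
elim: s => // k s IH _; have [->|s0] := eqVneq s [::].
  by exists k, k; rewrite !inE eqxx; split=> // i; rewrite inE => /eqP ->; rewrite lexx.
have [m [n [ms ns h]]] := IH s0.
exists (if k <= m then k else m), (if n <= k then k else n).
split; try by case: ifP => _; rewrite inE ?eqxx ?ms ?ns ?orbT.
move=> i; rewrite inE => /predU1P[->|/h]; first by do 2?case: ifP; lia.
by do 2?case: ifP; lia.
Qed.

(** Collinear generators are integer steps along one primitive vector from one of them, so the hull
    is the segment between the two outermost. Unimodular maps and cuts at lattice points reduce it
    to unit segments. *)
Lemma Z_simple : simple Z.
Proof.
move=> P [s s0 ->] dim1; have col := dim_collinear dim1.
case: s s0 dim1 col => // a s _ _ col.
have [/allP sa|/allPn[b bs ba]] := boolP (all (pred1 a) s).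
  rewrite -(Z_vertex a); congr (Z _); apply: hull_eq => v.
  by rewrite !inE; case: eqP => //= va; apply/negP => /sa /eqP.
have ba0 : b - a != 0 by rewrite subr_eq0.
have [v [k [pv k0 bE]]] := primitive_part ba0.
have colv c : c \in a :: s -> exists k, c = a + k *: v.
  have as_ : a \in a :: s by rewrite inE eqxx.
  have bs_ : b \in a :: s by rewrite inE bs orbT.
  move=> cs; have /eqP := col a b c as_ bs_ cs.
  rewrite bE det2Zl mulf_eq0 (gt_eqF k0) /= => /eqP /(primitive_parallel pv)[i E].
  by exists i; rewrite -E addrC subrK.
have [ks ksE] : exists ks : seq int, a :: s = [seq a + i *: v | i <- ks].
  elim: (a :: s) colv => [|c s' IH] h; first by exists [::].
  have [|ks ->] := IH; first by move=> d ds; apply: h; rewrite inE ds orbT.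
  have [|i ->] := h c; first by rewrite inE eqxx.
  by exists (i :: ks).
have [|m [n [ms ns mn]]] := @int_extremes ks; first by case: ks ksE.
have m_n : m <= n by have := mn m ms; lia.
have -> : hull (a :: s) = hull [:: a + m *: v; a + m *: v + (n - m) *: v].
  have nE : a + m *: v + (n - m) *: v = a + n *: v.
    by rewrite -addrA -scalerDl addrC [m + _]addrC subrK addrC.
  rewrite nE ksE; apply/seteqP; split; apply: hull_sub_hull => c.
    move=> /mapP[i /mn /andP[mi ni] ->].
    by apply: (cvx_line (@cvx_hull R _) _ _ mi ni); apply: hull_mem; rewrite !inE eqxx ?orbT.
  by rewrite !inE => /orP[] /eqP ->; apply: hull_mem; apply: map_f.
by apply: Z_lattice_segment => //; lia.
Qed.

Let F := Z (hull [:: x; y; z]).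

Lemma Z_triangle u w t : `|det2 u w| = 1 ->
  Z (hull [:: t + u; t + w; t]) = ex (lin t) * F@[u, w].
Proof.
move=> d; rewrite -(Z_frame t x [:: y; z] d) /= !aff_mxc.
by rewrite !scale0r !scale1r !addr0 add0r.
Qed.

Lemma F_sym : F@[y, x] = F.
Proof.
have d : `|det2 y x| = 1 by rewrite /det2 !vec0 !vec1.
have := Z_triangle z d; rewrite vec00 lin0 ex0 mul1r !add0r => <-; rewrite /F vec00.
by congr (Z _); apply: hull_eq => v; rewrite !inE orbCA.
Qed.

Lemma F_rot : ex (lin y) * F@[- y, x - y] = F.
Proof.
have d : `|det2 (- y) (x - y)| = 1 by rewrite !vecN !vecD /det2 !vec0 !vec1.
rewrite -(Z_triangle y d) subrr addrC subrK /F vec00.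
by congr (Z _); apply: hull_eq => v; rewrite !inE orbC orbA.
Qed.

(** The union of the two triangles is the same square for either diagonal, and the diagonals, being
    lattice segments, have value 0. *)
Lemma F_flip : F + ex (lin (x + y)) * F@[- x, - y] = F@[x, x + y] + F@[y, x + y].
Proof.
have xyE : x + y = xy by rewrite vecD.
have d1 : `|det2 (- x) (- y)| = 1 by rewrite !vecN /det2 !vec0 !vec1.
have d2 : `|det2 x xy| = 1 by rewrite /det2 !vec0 !vec1.
have d3 : `|det2 y xy| = 1 by rewrite /det2 !vec0 !vec1.
have xyx : x + y - x = y by rewrite addrAC subrr add0r.
have := Z_triangle (x + y) d1; rewrite xyx addrK => <-.
have := Z_triangle z d2; rewrite vec00 lin0 ex0 mul1r !add0r xyE => <-.
have := Z_triangle z d3; rewrite vec00 lin0 ex0 mul1r !add0r => <-.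
have E1 := Zv (hull_polygon x [:: y; z]) (hull_polygon x [:: y; xy]).
have E2 := Zv (hull_polygon x [:: xy; z]) (hull_polygon y [:: xy; z]).
rewrite square_xy square_xy_meet in E1; rewrite square_diag square_diag_meet in E2.
have -> : hull [:: y; x; xy] = hull [:: x; y; xy].
  by apply: hull_eq => v; rewrite !inE orbCA.
have cb : @convex_set R plane box by apply/cvxP; exact: cvx_box.
have seg_xy : Z (hull [:: x; y]) = 0.
  have pv : primitive (vec (-1) 1) by rewrite /primitive vec0 vec1.
  by have := @Z_lattice_segment _ x 1 pv isT; rewrite scale1r vecD.
have seg_zxy : Z (hull [:: z; xy]) = 0.
  have pv : primitive xy by rewrite /primitive vec0 vec1.
  by have := @Z_lattice_segment _ z 1 pv isT; rewrite scale1r vecD.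
have {}E1 := E1 cb; have {}E2 := E2 cb; rewrite seg_xy addr0 in E1; rewrite seg_zxy addr0 in E2.
by rewrite -vec00 -E2 E1.
Qed.
End Equivariant.

Lemma direct_part (Z : set plane -> Qxy) : valuation Z -> equivariant Z ->
  exists (c : rat) (g : fps rat) (rho f2 : Qxy),
    [/\ Z [set 0] = cst c,
        Z (hull [:: o; e1]) = f1_of g,
        D4_invariant rho,
        rho_equation rho &
        [/\ is_f2 rho f2,
            Z (T R) = f2 + boundary_part (f1_of g) &
            exists Z1 Z2 : set plane -> Qxy,
              [/\ (valuation Z1 /\ equivariant Z1) /\
                    (valuation Z2 /\ equivariant Z2),
                  forall P, lattice_polygon P -> Z P = Z1 P + Z2 P,
                  [/\ Z1 [set 0] = cst c,
                      Z1 (hull [:: o; e1]) = f1_of g &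
                      Z1 (T R) = boundary_part (f1_of g)],
                  simple Z2 &
                  Z2 (T R) = f2]]].
Proof.
move=> Zv Ze; have [g gE] := Z_segment Ze.
set c := coefxy (Z [set 0]) 0 0; have cE : Z [set 0] = cst c by apply: Z_point.
pose Z1 := @Zboundary R c g; pose Z2 P := Z P - Z1 P.
have Z1v : valuation Z1 by exact: Zboundary_valuation.
have Z1e : equivariant Z1 by exact: Zboundary_equivariant.
have Z2v : valuation Z2.
  move=> P Q lP lQ PQ; rewrite /Z2 addrACA -opprD Zv // Z1v // opprD.
  by rewrite addrACA.
have Z2e : equivariant Z2.
  move=> P M t lP uM; rewrite /Z2 affine_actB; congr (_ - _).
    exact: Ze.
  exact: Z1e.
have Z20 : Z2 [set 0] = 0 by rewrite /Z2 cE /Z1 Zboundary_point subrr.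
have Z21 : Z2 (hull [:: z; x]) = 0 by rewrite /Z2 gE /Z1 Zboundary_segment subrr.
have TE : T R = hull [:: x; y; z] by rewrite /T oE e1E e2E.
have Fs := F_sym Z2e; have Fr := F_rot Z2e; have Ff := F_flip Z2v Z2e Z20 Z21.
exists c, g, (rho_of (Z2 (T R))), (Z2 (T R)); rewrite TE oE e1E; split=> //.
- exact: rho_of_D4.
- exact: rho_of_equation.
split.
- exact: rho_of_f2.
- by rewrite /Z2 /Z1 Zboundary_triangle subrK.
exists Z1, Z2; split=> //.
- by move=> P _; rewrite /Z2 addrC subrK.
- by split; [exact: Zboundary_point|exact: Zboundary_segment|exact: Zboundary_triangle].
- exact: Z_simple.
Qed.
End Decomposition.

Theorem theorem2 (R : realType) :
  (forall Z : set 'cV[R]_2 -> Qxy, valuation Z -> equivariant Z ->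
     exists (c : rat) (g : fps rat) (rho f2 : Qxy),
       [/\ Z [set 0] = cst c,
           Z (hull [:: o; e1]) = f1_of g,
           D4_invariant rho,
           rho_equation rho &
           [/\ is_f2 rho f2,
               Z (T R) = f2 + boundary_part (f1_of g) &
               exists Z1 Z2 : set 'cV[R]_2 -> Qxy,
                 [/\ (valuation Z1 /\ equivariant Z1) /\
                       (valuation Z2 /\ equivariant Z2),
                     forall P, lattice_polygon P -> Z P = Z1 P + Z2 P,
                     [/\ Z1 [set 0] = cst c,
                         Z1 (hull [:: o; e1]) = f1_of g &
                         Z1 (T R) = boundary_part (f1_of g)],
                     simple Z2 &
                     Z2 (T R) = f2]]])
  /\
  (forall (c : rat) (g : fps rat) (rho : Qxy),
     D4_invariant rho -> rho_equation rho ->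
     exists f2 : Qxy, is_f2 rho f2 /\
       exists Z : set 'cV[R]_2 -> Qxy,
         [/\ valuation Z, equivariant Z,
             Z [set 0] = cst c,
             Z (hull [:: o; e1]) = f1_of g &
             Z (T R) = f2 + boundary_part (f1_of g)]).
Proof.
by split=> [Z|c g rho]; [exact: direct_part|exact: converse_part].
Qed.
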